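(* Let $R>0$, $h_0\in(0,1)$, $h\in[h_0,1)$. Let $\lambda_0>1$ be a sufficiently large number, depending on the parameters $$h_0,\ A,\ \sigma,\ R,\ N,\ \Omega^h,\ \|G^h\|_{C_N^h(\overline{\Omega}_1^h)},\ \|F^h\|_{C_N^h(\overline{\Omega}_1^h)},\qquad( * )$$ such that for every $\lambda\ge\lambda_0$, every $\gamma\in(0,1)$ and all $W^{(1),h},W^{(2),h}\in\overline{K^h(R)}$ $$J_{\lambda,\gamma}(W^{(2),h})-J_{\lambda,\gamma}(W^{(1),h})-J'_{\lambda,\gamma}(W^{(1),h})(W^{(2),h}-W^{(1),h})\ge\frac18\|W^{(2),h}-W^{(1),h}\|^2_{L^h_{2,N}(\Omega^h)}+\gamma\|W^{(2),h}-W^{(1),h}\|^2_{H^{1,h}_{0,N}(\Omega_1^h)}.$$ Let $\lambda\ge\lambda_0$ and $\gamma\in(0,1)$, let $W^h_{\min}\in\overline{K^h(R)}$ be the unique minimizer of $J_{\lambda,\gamma}$ on $\overline{K^h(R)}$, let $W_0^h\in K^h(R)$ be an arbitrary point, and consider the gradient projection sequence with step $\rho\in(0,1)$ $$W_n^h=P_{\overline{K^h(R)}}\left(W_{n-1}^h-\rho J'_{\lambda,\gamma}(W_{n-1}^h)\right),\qquad n=1,2,\dots,$$ where $P_{\overline{K^h(R)}}$ is the projection operator of $H^{1,h}_{0,N}(\Omega_1^h)$ onto the closed convex set $\overline{K^h(R)}$. Then there exists a sufficiently small number $\rho_0\in(0,1)$ depending on the parameters $( * )$ such that for every $\rho\in(0,\rho_0)$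 there exists a number $\eta=\eta(\rho)\in(0,1)$ such that this sequence converges to $W^h_{\min}$ and $$\|W^h_{\min}-W^h_n\|_{H^{1,h}_{0,N}(\Omega_1^h)}\le\eta^n\|W^h_{\min}-W^h_0\|_{H^{1,h}_{0,N}(\Omega_1^h)}.$$
   Context: **Grid.** Fix $A,\sigma>0$, an integer $N\ge1$, $a>0$, $h_0\in(0,1)$ and a grid step $h\in[h_0,1)$ with $B=1/h$ an integer. Put $x_i=ih$, $y_j=jh$, $0\le i,j\le B$. $\Omega^h$ is the set of points $(x_i,y_j,z)$ with $1\le i,j\le B-1$, $z\in(A,A+\sigma)$; $\Omega_1^h$ is the same with $0\le i,j\le B$; for $\overline{\Omega}^h,\overline{\Omega}_1^h$ one takes $z\in[A,A+\sigma]$. Write $\mathbf{x}^h(z)$ for the collection of grid points at height $z$. The lateral boundary $\Gamma$ corresponds to $i\in\{0,B\}$ or $j\in\{0,B\}$; $B_A$ corresponds to $z=A$. **Basis.** $\{\Psi_n\}_{n\ge1}$ is the orthonormal system in $L_2(0,1)$ obtained by Gram-Schmidt orthonormalization of $\xi_n(\alpha)=(\alpha+a)^{n-1}e^{\alpha}$, $n\ge1$. $M_N=(a_{mn})_{m,n=1}^N$, $a_{mn}=\int_0^1\Psi_n'\Psi_m\,d\alpha$; this matrix is invertible. **Semidiscrete functions and spaces.** A semidiscrete ($N$-component) function is $Q^h=(Q_k^{i,j}(z))$, $k=1,\dots,N$, $0\le i,j\le B$, $z\in[A,A+\sigma]$. $C_N^h(\overline{\Omega}_1^h)$ consists of those continuous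 in $z$, with norm $\max_{z}\max_k\max_{0\le i,j\le B}|Q_k^{i,j}(z)|$. $\|Q^h\|^2_{L^h_{2,N}(\Omega^h)}=\int_A^{A+\sigma}h^2\sum_{k=1}^N\sum_{i,j=1}^{B-1}(Q_k^{i,j}(z))^2dz$. $H^{1,h}_{0,N}(\Omega_1^h)$ is the (Hilbert) space of $Q^h$ vanishing on $\Gamma\cup B_A$ with finite norm $\|Q^h\|^2_{H^{1,h}_{0,N}(\Omega_1^h)}=\|Q^h\|^2_{L^h_{2,N}(\Omega^h)}+\|\partial_zQ^h\|^2_{L^h_{2,N}(\Omega^h)}$. The subscripts $x,y$ denote central differences at interior nodes: $Q_{x}^{i,j}=(Q^{i+1,j}-Q^{i-1,j})/(2h)$, $Q_{y}^{i,j}=(Q^{i,j+1}-Q^{i,j-1})/(2h)$, $1\le i,j\le B-1$. **Data and the operator $P$.** Data are $G^h=(g_1^h,\dots,g_N^h)^T$ and $F^h=(f_1^h,\dots,f_N^h)^T$ in $C_N^h(\overline{\Omega}_1^h)$, $F^h$ being given at $z=A+\sigma$ only (independent of $z$). $\Phi^h=(G^h,G_x^h,G_y^h,F^h,F_x^h,F_y^h)$. For $W^h=(w_1^h,\dots,w_N^h)^T$ put $$w^h=\sum_{n=1}^Nw_n^h\Psi_n(\alpha),\quad g^h=\sum_{n=1}^Ng_n^h\Psi_n(\alpha),\quad f^h=\sum_{n=1}^Nf_n^h\Psi_n(\alpha),$$ $$u_0^h=\frac{A^2}{(x_i-\alpha)^2+(y_j-1/2)^2+A^2},\qquad u^h=u_0^h+w^h+g^h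 .$$ $P=(P_1,\dots,P_N)^T$ is defined at interior nodes, whenever $u^h>0$, by $$P_n=\int_0^1\Psi_n(\alpha)\,\partial_\alpha\Big(-\int_z^{A+\sigma}\frac{u_x^h}{2\sqrt{u^h}}(\mathbf{x}^h(t),\alpha)\,dt+f_x^h\Big)^2d\alpha+\int_0^1\Psi_n(\alpha)\,\partial_\alpha\Big(-\int_z^{A+\sigma}\frac{u_y^h}{2\sqrt{u^h}}(\mathbf{x}^h(t),\alpha)\,dt+f_y^h\Big)^2d\alpha .$$ **The sets $K^h(R)$.** $K^h(R)$ is the set of $W^h\in H^{1,h}_{0,N}(\Omega_1^h)$ with $\|W^h\|_{H^{1,h}_{0,N}(\Omega_1^h)}<R$ and $(w^h+g^h)(\mathbf{x}^h(z),\alpha)>0$ on $\overline{\Omega}_1^h\times[0,1]$; $\overline{K^h(R)}$ is its closure in $H^{1,h}_{0,N}(\Omega_1^h)$. **The functional.** For $\lambda>0$ and the regularization parameter $\gamma>0$, $$J_{\lambda,\gamma}(W^h)=e^{-2\lambda A}\left\|\left[W^h-M_N^{-1}P(W^h,W_x^h,W_y^h,\Phi^h,\mathbf{x}^h(z))\right]e^{\lambda z}\right\|^2_{L^h_{2,N}(\Omega^h)}+\gamma\|W^h\|^2_{H^{1,h}_{0,N}(\Omega_1^h)}.$$ The Fréchet derivative $J'_{\lambda,\gamma}(W^h)$ is identified with an element of $H^{1,h}_{0,N}(\Omega_1^h)$ by the Riesz theorem, and $J'_{\lambda,\gamma}(W^h)(V)$ denotes its action on $V$ (scalar product in $H^{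1,h}_{0,N}(\Omega_1^h)$).
   Formalization: The step bound ρ_0 is allowed to depend on λ as well as on the parameters ( * ); a ρ_0 depending on ( * ) alone fails in general, since the Lipschitz constant of J'_{λ,γ} grows with λ like e^{2λσ} up to powers of λ. *)

(* Defs.v *)
From mathcomp Require Import all_boot all_order all_algebra.
From mathcomp Require Import all_classical all_reals all_analysis.

Set Implicit Arguments.
Unset Strict Implicit.
Unset Printing Implicit Defensive.

Import Order.TTheory GRing.Theory Num.Theory.
Import numFieldNormedType.Exports.

Local Open Scope classical_set_scope.
Local Open Scope ring_scope.

(* The node (i h, j h) of the grid is the pair of ordinals (i, j), 0 <= i, j <= B. *)
Definition grid_vec (R : realType) (N B : nat) := 'I_N -> 'M[R]_B.+1.

(* [Q z k i j] is the value at height z of the k-th component at node (i, j). *)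
Definition semidiscrete (R : realType) (N B : nat) := R -> 'I_N -> 'M[R]_B.+1.

Section Basis.
Context {R : realType} (a : R).
Let mu := @lebesgue_measure R.

Definition L2_01 (f g : R -> R) : R := \int[mu]_(x in `[0, 1]) (f x * g x).

(* xi 0, xi 1, ... are the functions written xi_1, xi_2, ... on paper. *)
Definition xi (n : nat) : R -> R := fun x => (x + a) ^+ n * expR x.

Fixpoint gram_schmidt (n : nat) : seq (R -> R) :=
  if n is m.+1 then
    let s := gram_schmidt m in
    let v : R -> R := fun x => xi m x - \sum_(p <- s) L2_01 (xi m) p * p x in
    rcons s (fun x => v x / Num.sqrt (L2_01 v v))
  else [::].

Definition Psi (n : nat) : R -> R := nth (fun=> 0) (gram_schmidt n.+1) n.

Definition MN (N : nat) : 'M[R]_N :=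
  \matrix_(m < N, n < N) L2_01 (derive1 (Psi n)) (Psi m).

End Basis.

Section Grid.
Context {R : realType} (N B : nat) (h : R).

Definition interior (i : 'I_B.+1) : bool := (0 < i < B)%N.

(* Central differences; the values at boundary nodes are meaningless and
   are never used. *)
Definition Dx (M : 'M[R]_B.+1) : 'M[R]_B.+1 :=
  \matrix_(i, j) ((M (inord i.+1) j - M (inord i.-1) j) / (2 * h)).

Definition Dy (M : 'M[R]_B.+1) : 'M[R]_B.+1 :=
  \matrix_(i, j) ((M i (inord j.+1) - M i (inord j.-1)) / (2 * h)).

End Grid.

Section Spaces.
Context {R : realType} (A sigma h : R) {N B : nat}.
Let mu := @lebesgue_measure R.
Implicit Types Q V W : semidiscrete R N B.

Definition continuous_z Q : Prop :=
  forall k i j, {within `[A, A + sigma], continuous (fun z => Q z k i j)}.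

Definition normC Q : R :=
  sup [set x | exists z k i j, z \in `[A, A + sigma] /\ x = `|Q z k i j|].

Definition ipL2 Q V : R :=
  \int[mu]_(z in `[A, A + sigma])
    (h ^+ 2 * \sum_(k < N) \sum_(i < B.+1 | interior i)
                \sum_(j < B.+1 | interior j) Q z k i j * V z k i j).

Definition normL2 Q : R := Num.sqrt (ipL2 Q Q).

(* H^1(A, A + sigma) consists of the primitives of L_2 functions; the weak
   derivative q is unique up to a null set. *)
Definition is_weak_derivative (f q : R -> R) : Prop :=
  [/\ measurable_fun `[A, A + sigma] q,
      mu.-integrable `[A, A + sigma] (EFin \o (fun t => q t ^+ 2))
    & forall z, z \in `[A, A + sigma] -> f z = f A + \int[mu]_(t in `[A, z]) q t].

Definition weak_derivative (f : R -> R) : R -> R :=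
  xget (fun=> 0) [set q | is_weak_derivative f q].

Definition dz Q : semidiscrete R N B :=
  fun z k => \matrix_(i, j) weak_derivative (fun t => Q t k i j) z.

Definition ipH1 Q V : R := ipL2 Q V + ipL2 (dz Q) (dz V).

Definition normH1 Q : R := Num.sqrt (ipH1 Q Q).

(* Functions on [A, A + sigma] are represented by functions on R vanishing
   outside of the interval, so that equality in the space is Leibniz equality. *)
Definition H1_0 : set (semidiscrete R N B) :=
  [set Q : semidiscrete R N B | [/\ forall z, z \notin `[A, A + sigma] -> Q z = 0,
               forall k i j, exists q, is_weak_derivative (fun t => Q t k i j) q,
               forall z k i j, ~~ (interior i && interior j) -> Q z k i j = 0
             & Q A = 0]].

Definition closureH1 (S : set (semidiscrete R N B)) : set (semidiscrete R N B) :=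
  [set W : semidiscrete R N B | H1_0 W /\
     forall eps : R, 0 < eps -> exists2 V, S V & normH1 (W - V) < eps].

(* Frechet differentiability at W in the Hilbert space H1_0, the derivative
   being V |-> ipH1 g V. *)
Definition is_gradient (J : semidiscrete R N B -> R) W (g : semidiscrete R N B) : Prop :=
  H1_0 g /\
  forall eps : R, 0 < eps -> exists2 delta : R, 0 < delta &
    forall V, H1_0 V -> normH1 V < delta ->
      `|J (W + V) - J W - ipH1 g V| <= eps * normH1 V.

Definition gradient (J : semidiscrete R N B -> R) W : semidiscrete R N B :=
  xget 0 [set g : semidiscrete R N B | is_gradient J W g].

Definition is_projection (S : set (semidiscrete R N B)) V W : Prop :=
  S W /\ forall W', S W' -> normH1 (V - W) <= normH1 (V - W').

Definition is_unique_minimizer (J : semidiscrete R N B -> R)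
    (S : set (semidiscrete R N B)) W : Prop :=
  S W /\ forall V, S V -> V <> W -> J W < J V.

End Spaces.

Section Functional.
Context {R : realType} (A sigma a h : R) {N B : nat}.
Let mu := @lebesgue_measure R.
Variables (G : semidiscrete R N B) (F : grid_vec R N B).
Implicit Types W : semidiscrete R N B.

Definition expand (c : grid_vec R N B) (x : R) : 'M[R]_B.+1 :=
  \sum_(n < N) Psi a n x *: c n.

Definition u0 (x : R) : 'M[R]_B.+1 :=
  \matrix_(i, j)
    (A ^+ 2 / ((i%:R * h - x) ^+ 2 + (j%:R * h - 2^-1) ^+ 2 + A ^+ 2)).

Definition u W (z x : R) : 'M[R]_B.+1 := u0 x + expand (W z) x + expand (G z) x.

(* [D] is Dx h or Dy h. *)
Definition flux (D : 'M[R]_B.+1 -> 'M[R]_B.+1) W (z : R)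
    (i j : 'I_B.+1) (x : R) : R :=
  - (\int[mu]_(t in `[z, A + sigma])
       (D (u W t x) i j / (2 * Num.sqrt (u W t x i j))))
  + D (expand F x) i j.

(* Only the values at interior nodes and at points where u > 0 are meaningful. *)
Definition P W : semidiscrete R N B := fun z n => \matrix_(i, j)
  (\int[mu]_(x in `[0, 1])
     (Psi a n x * derive1 (fun y => flux (Dx h) W z i j y ^+ 2) x) +
   \int[mu]_(x in `[0, 1])
     (Psi a n x * derive1 (fun y => flux (Dy h) W z i j y ^+ 2) x)).

Definition MinvP W : semidiscrete R N B := fun z n =>
  \sum_(m < N) invmx (MN a N) n m *: P W z m.

Definition J (lambda gamma : R) W : R :=
  expR (- 2 * lambda * A) *
    normL2 A sigma h (fun z n => expR (lambda * z) *: (W z n - MinvP W z n)) ^+ 2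
  + gamma * normH1 A sigma h W ^+ 2.

Definition KR (r : R) : set (semidiscrete R N B) :=
  [set W : semidiscrete R N B | [/\ H1_0 A sigma W, normH1 A sigma h W < r
    & forall z x i j, z \in `[A, A + sigma] -> x \in `[0, 1] ->
        0 < (expand (W z) x + expand (G z) x) i j]].

Definition KRbar (r : R) : set (semidiscrete R N B) := closureH1 A sigma h (KR r).

Definition J' (lambda gamma : R) W : semidiscrete R N B :=
  gradient A sigma h (J lambda gamma) W.

End Functional.

(* Main.v *)
Require Import Defs.
From mathcomp Require Import all_boot all_order all_algebra.
From mathcomp Require Import all_classical all_reals all_analysis.
From mathcomp Require Import measurable_realfun ring lra.

Set Implicit Arguments.
Unset Strict Implicit.
Unset Printing Implicit Defensive.

Import Order.TTheory GRing.Theory Num.Theory.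
Import numFieldNormedType.Exports.

Local Open Scope classical_set_scope.
Local Open Scope ring_scope.

(* The functional is J = J_0 + gamma |W|^2 (norm of H^1_0), where J_0 is the weighted residual.
   On the closed set under consideration u is bounded below by a positive constant, and every
   operation entering J_0 (products, 1 / sqrt u, integrals in z and alpha) is of class C^{1,1};
   since integration in z dominates pointwise values by L_2 norms, the derivative of J_0 is
   Lipschitz with respect to the L_2 norm alone, uniformly in the data with given norms.  The
   assumed convexity inequality makes that derivative L_2-monotone with constant 1/4, whence for
   rho small the step W - rho J'(W) contracts the H^1_0 norm by the factor 1 - 2 rho gamma;
   projecting onto a convex set does not increase distances. *)

(** [J'] is a choice among gradients, with a default when there is none, so existence must be proved
    at every point of the closed set, boundary points included. A gradient tests all directions,
    hence J_0 has to be controlled on an H^1_0-neighbourhood of that set. Here u_0 matters: it has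
    the positive lower bound [u0_inf], positivity of w + g gives u > u_0, and by the sup embedding
    of H^1_0 half of the bound survives small perturbations. The gradient is then constructed
    explicitly: the derivative of J_0 is an L_2 pairing with continuous kernels, and a two-point
    boundary value problem at each node represents this pairing in H^1_0. The residual at height z
    contains W(z) itself besides integrals over the heights above z, so at fixed z the L_2 norm does
    not control it. A seminorm adding the values at height z to the L_2 norm is carried along, and
    the final integration of the square in z leaves the L_2 norm alone. The bound on rho is chosen
    before gamma, G and F, so every constant must be uniform in them. *)

(** * Extension of functions from a segment to the line *)

Section Clamp.
Context {R : realType}.
Implicit Types (a b t : R) (f : R -> R).

(** Composition with this retraction onto [a, b] turns a function continuous within the segment into
    one continuous everywhere with the same values on the segment, so that lemmas on globally
    continuous functions apply. *)
Definition clamp a b t := Num.max a (Num.min t b).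

Lemma clamp_in a b t : a <= b -> clamp a b t \in `[a, b].
Proof. by move=> ab; rewrite /clamp in_itv/= le_max lexx/= ge_max ab/= ge_min lexx orbT. Qed.

Lemma clamp_id a b t : t \in `[a, b] -> clamp a b t = t.
Proof.
by rewrite in_itv/= => /andP[at_ tb]; rewrite /clamp (min_idPl tb) (max_idPr at_).
Qed.

Lemma continuous_clamp a b : continuous (clamp a b).
Proof.
move=> t; apply: (@continuous_max _ _ (cst a) (fun t => Num.min t b)).
  exact: cvg_cst.
apply: (@continuous_min _ _ id (cst b)); [exact: cvg_id|exact: cvg_cst].
Qed.

Lemma within_clamp a b f : a <= b -> {within `[a, b], continuous f} ->
  continuous (f \o clamp a b).
Proof.
move=> ab /subspace_continuousP cf t.
apply: (@cvg_comp _ _ _ (clamp a b) f _ (within `[a, b]%classic (nbhs (clamp a b t)))).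
  move=> /= U UV.
  have h : \forall s \near t, `[a, b]%classic (clamp a b s) -> U (clamp a b s).
    exact: (@continuous_clamp a b t _ UV).
  by apply: filterS h => s; apply; exact: clamp_in.
by have := cf (clamp a b t); apply; exact: clamp_in.
Qed.

Lemma continuous_integrable f a b : continuous f ->
  (@lebesgue_measure R).-integrable `[a, b] (EFin \o f).
Proof.
move=> cf; apply: continuous_compact_integrable; first exact: segment_compact.
exact: continuous_subspaceT.
Qed.

End Clamp.

(** * Integrals depending continuously on parameters and endpoints *)

Section Integral.
Context {R : realType}.
Notation mu := (@lebesgue_measure R).

Lemma continuous_pair (T U V : topologicalType) (f : T -> U) (g : T -> V) t :
  {for t, continuous f} -> {for t, continuous g} ->
  {for t, continuous (fun x => (f x, g x))}.
Proof. by move=> cf cg; exact: (@cvg_pair T U V (nbhs t) (nbhs (f t)) (nbhs (g t))). Qed.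

Lemma continuous_fst_snd (f : R * R -> R) x : continuous f -> continuous (fun t => f (t, x)).
Proof.
move=> cf t; apply: (@continuous_comp _ _ _ (fun t => (t, x)) f); last exact: cf.
by apply: continuous_pair; [exact: cvg_id|exact: cvg_cst].
Qed.

Lemma continuous_snd_fst (f : R * R -> R) x : continuous f -> continuous (fun t => f (x, t)).
Proof.
move=> cf t; apply: (@continuous_comp _ _ _ (fun t => (x, t)) f); last exact: cf.
by apply: continuous_pair; [exact: cvg_cst|exact: cvg_id].
Qed.

Lemma continuous_swap (f : R * R -> R) : continuous f -> continuous (fun p => f (p.2, p.1)).
Proof.
move=> cf t; apply: (@continuous_comp _ _ _ (fun p : R * R => (p.2, p.1)) f); last exact: cf.
by apply: continuous_pair; [exact: cvg_snd|exact: cvg_fst].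
Qed.

Lemma continuous_fst_comp (f : R -> R) : continuous f -> continuous (fun p : R * R => f p.1).
Proof.
by move=> cf t; apply: (@continuous_comp _ _ _ fst f); [exact: cvg_fst|exact: cf].
Qed.

Lemma continuous_snd_comp (f : R -> R) : continuous f -> continuous (fun p : R * R => f p.2).
Proof.
by move=> cf t; apply: (@continuous_comp _ _ _ snd f); [exact: cvg_snd|exact: cf].
Qed.

(** Tube argument: compactness of [a, b], in its near-covering form, makes continuity in the second
    variable uniform in the first. Near each t both f s y and f s x are compared with f t x. *)
Lemma uniform_near_slice (T : topologicalType) (a b : R) (f : R -> T -> R) (x : T) (e : R) :
  0 < e ->
  (forall t, t \in `[a, b] -> {for (t, x), continuous (fun p : R * T => f p.1 p.2)}) ->
  \forall y \near x, forall t, t \in `[a, b] -> `|f t y - f t x| < e.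
Proof.
move=> e0 cf.
have /compact_near_coveringP cK := @segment_compact R a b.
have U := cK _ (nbhs x) (fun y t => `|f t y - f t x| < e) (nbhs_filter x).
apply: filterS (U _) => [y yU t tab|t tab]; first exact: (yU t tab).
have /cvgrPdist_lt/(_ _ (divr_gt0 e0 (ltr0Sn _ 1))) := cf t tab.
move=> [[U1 V] /= [Ut Vx] UV].
exists (U1, V) => //= -[s y]/= [Us Vy].
have h1 := UV (s, y) (conj Us Vy); have h2 := UV (s, x) (conj Us (nbhs_singleton Vx)).
rewrite /= in h1 h2; rewrite distrC (splitr e).
have -> : f s x - f s y = (f t x - f s y) - (f t x - f s x) by ring.
by apply: (le_lt_trans (ler_normB _ _)); rewrite ltrD.
Qed.

Lemma fine_mu_itv (c d : R) : c <= d -> fine (mu `[c, d]) = d - c.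
Proof.
by move=> cd; rewrite lebesgue_measure_itv/= lte_fin; case: ltgtP cd => //= ->; rewrite subrr.
Qed.

Lemma Rint_bound (c d : R) (X : R -> R) (M : R) : c <= d ->
  mu.-integrable `[c, d] (EFin \o X) ->
  (forall t, t \in `[c, d] -> `|X t| <= M) ->
  `|\int[mu]_(t in `[c, d]) X t| <= M * (d - c).
Proof.
move=> cd iX bX; apply: le_trans (le_normr_Rintegral _ iX) _ => //.
rewrite -(fine_mu_itv cd) -Rintegral_cst//.
apply: le_Rintegral => //.
- by have := integrable_norm iX.
- by apply: (@continuous_integrable _ (cst M)) => x; exact: cvg_cst.
Qed.

(** The increment splits into a change of endpoint at the fixed parameter [p0.2], small by
    continuity of the primitive, and a change of parameter, small uniformly on the segment by
    [uniform_near_slice]. *)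
Lemma cont_int_l (a b : R) (f : R * R -> R) : a <= b -> continuous f ->
  continuous (fun p : R * R => \int[mu]_(t in `[a, clamp a b p.1]) f (t, p.2)).
Proof.
move=> ab cf p0.
(* The +1 keeps the inverse meaningful when a = b; an increment below c0 * (e / 2) then integrates
   to at most e / 2. *)
have [c0 ac0 c0b] : exists2 c : R, 0 < c & (b - a) * c < 1.
  exists (b - a + 1)^-1; first by rewrite invr_gt0; lra.
  by rewrite ltr_pdivrMr; lra.
have hcl s : a <= clamp a b s <= b by have := clamp_in s ab; rewrite in_itv.
have ii y s : mu.-integrable `[a, clamp a b s] (EFin \o (fun t => f (t, y))).
  exact/continuous_integrable/continuous_fst_snd.
have ch : continuous (fun s => \int[mu]_(t in `[a, clamp a b s]) f (t, p0.2)).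
  apply: (@within_clamp _ _ _ (fun s => \int[mu]_(t in `[a, s]) f (t, p0.2))) => //.
  apply: parameterized_integral_continuous => //.
  exact/continuous_integrable/continuous_fst_snd.
apply/cvgrPdist_lt => e e0.
have e2 : 0 < e / 2 by rewrite divr_gt0.
have H1 : \forall p \near p0,
    `|\int[mu]_(t in `[a, clamp a b p0.1]) f (t, p0.2) -
      \int[mu]_(t in `[a, clamp a b p.1]) f (t, p0.2)| < e / 2.
  by have /cvgrPdist_lt/(_ _ e2) := @continuous_fst_comp _ ch p0.
have H2 : \forall p \near p0, forall t, t \in `[a, b] ->
    `|f (t, p.2) - f (t, p0.2)| < c0 * (e / 2).
  have : \forall y \near p0.2, forall t, t \in `[a, b] ->
    `|f (t, y) - f (t, p0.2)| < c0 * (e / 2).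
    apply: (@uniform_near_slice _ a b (fun t y => f (t, y))); first exact: mulr_gt0.
    move=> t _; apply: (@continuous_comp _ _ _ (fun p : R * R => (p.1, p.2)) f); last exact: cf.
    by rewrite (_ : (fun p => _) = id); [exact: cvg_id|apply/funext => -[]].
  exact: (@cvg_snd _ _ (nbhs p0.1) (nbhs p0.2)).
near=> p.
have h1 : `|\int[mu]_(t in `[a, clamp a b p0.1]) f (t, p0.2) -
      \int[mu]_(t in `[a, clamp a b p.1]) f (t, p0.2)| < e / 2 by near: p.
have h2 : forall t, t \in `[a, b] -> `|f (t, p.2) - f (t, p0.2)| < c0 * (e / 2) by near: p.
have h3 : `|\int[mu]_(t in `[a, clamp a b p.1]) f (t, p0.2) -
      \int[mu]_(t in `[a, clamp a b p.1]) f (t, p.2)| <= e / 2.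
  rewrite -RintegralB//.
  have /andP[h3 h4] := hcl p.1.
  apply: (@le_trans _ _ (c0 * (e / 2) * (clamp a b p.1 - a))).
    apply: Rint_bound => //.
      apply: (@continuous_integrable _ (fun t => f (t, p0.2) - f (t, p.2))) => t.
      by apply: cvgB; exact: continuous_fst_snd.
    move=> t tc; rewrite distrC ltW// h2//.
    by move: tc; rewrite !in_itv/= => /andP[-> /= tc]; exact: le_trans tc h4.
  rewrite mulrAC ler_piMl//; first exact: ltW.
  apply: ltW; apply: le_lt_trans c0b; rewrite mulrC ler_wpM2r//; first exact: ltW.
  by rewrite lerB.
rewrite (splitr e) -(subrKA (\int[mu]_(t in `[a, clamp a b p.1]) f (t, p0.2))).
by apply: le_lt_trans (ler_normD _ _) _; rewrite ltr_leD.
Unshelve. all: by end_near. Qed.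

Lemma cont_int_full (a b : R) (f : R * R -> R) : a <= b -> continuous f ->
  continuous (fun x => \int[mu]_(t in `[a, b]) f (t, x)).
Proof.
move=> ab cf.
have := @continuous_snd_fst _ b (@cont_int_l _ _ f ab cf).
by rewrite /= clamp_id// in_itv/= ab lexx.
Qed.

Lemma Rint_split (a b c : R) (f : R -> R) : c \in `[a, b] ->
  mu.-integrable `[a, b] (EFin \o f) ->
  \int[mu]_(t in `[a, b]) f t = \int[mu]_(t in `[a, c]) f t + \int[mu]_(t in `[c, b]) f t.
Proof.
rewrite in_itv/= => /andP[ac cb] fi.
have fi' : mu.-integrable `]c, b] (EFin \o f).
  by apply: integrableS fi => //; apply: subset_itv; rewrite bnd_simp.
by rewrite -(Rintegral_itv_obnd_cbnd fi') -(@Rintegral_itvB _ _ (BLeft a) (BRight b) c)// ?bnd_simp// addrC subrK.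
Qed.

Lemma cont_int_r (a b : R) (f : R * R -> R) : a <= b -> continuous f ->
  continuous (fun p : R * R => \int[mu]_(t in `[clamp a b p.1, b]) f (t, p.2)).
Proof.
move=> ab cf.
have -> : (fun p : R * R => \int[mu]_(t in `[clamp a b p.1, b]) f (t, p.2)) =
   (fun p => \int[mu]_(t in `[a, b]) f (t, p.2) -
   \int[mu]_(t in `[a, clamp a b p.1]) f (t, p.2)).
  apply/funext => p; rewrite (@Rint_split a b (clamp a b p.1))//; last 2 first.
  - exact: clamp_in.
  - exact/continuous_integrable/continuous_fst_snd.
  by rewrite addrC addKr.
move=> p0; apply: cvgB; last exact: cont_int_l.
exact: (continuous_snd_comp (cont_int_full ab cf)).
Qed.

Section Integrable.
Variables (c d : R).
Implicit Types f g : R -> R.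
Local Notation itg f := (mu.-integrable `[c, d] (EFin \o f)).

Lemma itg_eq f g : {in `[c, d], f =1 g} -> itg f -> itg g.
Proof.
by move=> fg; apply: eq_integrable => // t; rewrite inE => tab; rewrite /= fg.
Qed.

Lemma itgD f g : itg f -> itg g -> itg (fun t => f t + g t).
Proof. by move=> hf hg; have := integrableD _ hf hg; exact. Qed.

Lemma itgZ k f : itg f -> itg (fun t => k * f t).
Proof. by move=> hf; have := integrableZl _ k hf; exact. Qed.

Lemma itgB f g : itg f -> itg g -> itg (fun t => f t - g t).
Proof. by move=> hf hg; have := integrableB _ hf hg; exact. Qed.

Lemma itg_cst k : itg (cst k).
Proof. by apply: (@continuous_integrable _ (cst k)) => x; exact: cvg_cst. Qed.

Lemma itg_sum (I : Type) (s : seq I) (P : pred I) (F : I -> R -> R) :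
  (forall i, P i -> itg (F i)) -> itg (fun t => \sum_(i <- s | P i) F i t).
Proof.
move=> h; elim: s => [|i s ih]; first by under [X in EFin \o X]eq_fun do rewrite big_nil; exact: itg_cst.
under [X in EFin \o X]eq_fun do rewrite big_cons.
by case Pi : (P i) => //; apply: itgD => //; exact: h.
Qed.

Lemma Rint_sum (I : Type) (s : seq I) (P : pred I) (F : I -> R -> R) :
  (forall i, P i -> itg (F i)) ->
  \int[mu]_(t in `[c, d]) (\sum_(i <- s | P i) F i t) =
  \sum_(i <- s | P i) \int[mu]_(t in `[c, d]) F i t.
Proof.
move=> h; elim: s => [|i s ih].
  by rewrite big_nil; under eq_Rintegral do rewrite big_nil; rewrite Rintegral_cst// mul0r.
rewrite big_cons -ih; under eq_Rintegral do rewrite big_cons.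
by case Pi : (P i) => //; rewrite RintegralD//; [exact: h|exact: itg_sum].
Qed.

End Integrable.

End Integral.

(** * Measurability and exchange of integrals on rectangles and triangles *)

Section Fubini.
Context {R : realType}.
Notation mu := (@lebesgue_measure R).

(** Fubini asks for measurability with respect to the product sigma-algebra. Freezing the first
    variable on strips of width 1 / (n + 1) gives functions measurable for it, and by continuity
    they converge pointwise to f. *)
Lemma continuous2_measurable (f : R * R -> R) : continuous f ->
  measurable_fun [set: measurableTypeR R * measurableTypeR R] (f : measurableTypeR R * measurableTypeR R -> measurableTypeR R).
Proof.
move=> cf.
(* Rounding down to a multiple of 1 / (n + 1); this local name is unrelated to the flux of the
   problem. *)
pose node_flux n (z : R) := (Num.floor (z * n.+1%:R))%:~R / n.+1%:R : R.
apply: (@measurable_realfun.measurable_fun_cvg _ _ R _ (fun n p => f (node_flux n p.1, p.2))).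
  move=> n.
  (* The strips are indexed by integers and the union by naturals: the encoding of [int] bridges the
     two, a natural that codes no integer giving the empty set. *)
  pose E k : set (measurableTypeR R * measurableTypeR R) :=
    if (unpickle k : option int) is Some m then
    `[m%:~R / n.+1%:R, (m + 1)%:~R / n.+1%:R[ `*` setT else set0.
  have mE k : measurable (E k).
    by rewrite /E; case: unpickle => [m|]//; apply: measurableX.
  have UE : \bigcup_k E k = setT.
    apply/seteqP; split=> // p _.
    exists (pickle (Num.floor (p.1 * n.+1%:R))) => //.
    rewrite /E pickleK; split => //=.
    rewrite in_itv/= ler_pdivrMr// ltr_pdivlMr//.
    by apply/andP; split; [exact: floor_le|exact: floorD1_gt].
  rewrite -UE; apply/measurable_fun_bigcup => // k.
  rewrite /E; case: unpickle => [m|]; last exact: measurable_fun_set0.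
  apply: (@eq_measurable_fun _ _ _ _ _ (fun p => f (m%:~R / n.+1%:R, p.2))).
    move=> p; rewrite inE => -[/= + _]; rewrite in_itv/= ler_pdivrMr// ltr_pdivlMr// => pm.
    rewrite /node_flux; congr (f (_ / _, _)); congr (_%:~R); exact/esym/floor_def.
  apply: measurable_funTS.
  apply: (@measurableT_comp _ _ _ _ _ _ (fun y => f (m%:~R / n.+1%:R, y)) _ snd) => //.
  exact: (continuous_measurable_fun (continuous_snd_fst cf)).
move=> [z x] _.
apply: (@cvg_comp _ _ _ (fun n => (node_flux n z, x)) f _ (nbhs (z, x))); last exact: cf.
apply: (@cvg_pair _ _ _ \oo (nbhs z) (nbhs x)); last exact: cvg_cst.
apply/cvgrPdist_le => e e0; near=> n.
have n0 : 0 < n.+1%:R :> R by [].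
have h1 : (Num.floor (z * n.+1%:R))%:~R <= z * n.+1%:R := floor_le _.
have h2 := floorD1_gt (z * n.+1%:R).
have h3 : n.+1%:R^-1 <= e by apply: ltW; near: n; exact: near_infty_natSinv_lt (PosNum e0).
apply: le_trans h3; rewrite /node_flux /=.
have -> : z - (Num.floor (z * n.+1%:R))%:~R / n.+1%:R =
  (z * n.+1%:R - (Num.floor (z * n.+1%:R))%:~R) * n.+1%:R^-1.
  by rewrite mulrBl mulfK// gt_eqF.
rewrite normrM [X in _ * X]ger0_norm ?invr_ge0// ler_piMl ?invr_ge0//.
rewrite ger0_norm ?subr_ge0// lerBlDr ltW//.
by move: h2; rewrite intrD1 addrC.
Unshelve. all: by end_near. Qed.

(** The product majorant makes the restriction of f to the product of D1 and D2 integrable by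
    Tonelli. Fubini is applied to this restriction on the whole plane, and its sections are then
    identified with those of f. *)
Lemma Rfubini (D1 D2 : set (measurableTypeR R)) (f : R * R -> R) (k1 k2 : R -> R) :
  measurable D1 -> measurable D2 ->
  measurable_fun [set: measurableTypeR R * measurableTypeR R] (f : measurableTypeR R * measurableTypeR R -> measurableTypeR R) ->
  (forall x, 0 <= k1 x) -> (forall x, 0 <= k2 x) ->
  mu.-integrable D1 (EFin \o k1) -> mu.-integrable D2 (EFin \o k2) ->
  (forall x y, D1 x -> D2 y -> `|f (x, y)| <= k1 x * k2 y) ->
  \int[mu]_(x in D1) \int[mu]_(y in D2) f (x, y) =
  \int[mu]_(y in D2) \int[mu]_(x in D1) f (x, y).
Proof.
move=> mD1 mD2 mf k10 k20 ik1 ik2 fk.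
pose g := f \_ (D1 `*` D2).
have mfx x : measurable_fun setT (fun y => f (x, y)).
  exact: (measurableT_comp mf (pair1_measurable x)).
have mfy y : measurable_fun setT (fun x => f (x, y)).
  exact: (measurableT_comp mf (pair2_measurable y)).
have gx x : D1 x -> (fun y => (g (x, y))%:E) = (fun y => (f (x, y))%:E) \_ D2.
  move=> xD; apply/funext => y; rewrite /g !patchE in_setX/= (mem_set xD)/=.
  by case: ifP.
have gy y : D2 y -> (fun x => (g (x, y))%:E) = (fun x => (f (x, y))%:E) \_ D1.
  move=> yD; apply/funext => x; rewrite /g !patchE in_setX/= (mem_set yD)/= andbT.
  by case: ifP.
have g0x x : ~ D1 x -> (fun y => (g (x, y))%:E) = cst 0%E.
  by move=> xD; apply/funext => y; rewrite /g !patchE in_setX/= (memNset xD)/=.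
have g0y y : ~ D2 y -> (fun x => (g (x, y))%:E) = cst 0%E.
  by move=> yD; apply/funext => x; rewrite /g !patchE in_setX/= (memNset yD)/= andbF.
have gxy x y : g (x, y) = if (x \in D1) && (y \in D2) then f (x, y) else 0.
  by rewrite /g patchE in_setX.
have ifx x : D1 x -> mu.-integrable D2 (EFin \o (fun y => f (x, y))).
  move=> xD; apply: (@le_integrable _ _ R mu D2 mD2 (EFin \o (fun y => f (x, y))) (EFin \o (fun y => k1 x * k2 y))).
  - by apply/measurable_EFinP; exact: (measurable_funTS (mfx x)).
  - by move=> y yD; rewrite /= lee_fin (le_trans (fk _ _ xD yD))// ler_norm.
  - by have := integrableZl mD2 (k1 x) ik2.
have ify y : D2 y -> mu.-integrable D1 (EFin \o (fun x => f (x, y))).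
  move=> yD; apply: (@le_integrable _ _ R mu D1 mD1 (EFin \o (fun x => f (x, y))) (EFin \o (fun x => k2 y * k1 x))).
  - by apply/measurable_EFinP; exact: (measurable_funTS (mfy y)).
  - by move=> x xD; rewrite /= lee_fin mulrC (le_trans (fk _ _ xD yD))// ler_norm.
  - by have := integrableZl mD1 (k2 y) ik1.
have mg : measurable_fun setT g.
  apply: (measurable_restrictT _ _).1; first exact: measurableX.
  exact: measurable_funTS.
have ig : (mu \x mu)%E.-integrable setT (EFin \o g).
  apply/integrable12ltyP.
    exact/measurable_EFinP.
  apply: (@le_lt_trans _ _ (\int[mu]_x (((k1 \_ D1) x)%:E * \int[mu]_(y in D2) (k2 y)%:E))%E).
    apply: ge0_le_integral => //.
    - by move=> x _; exact: integral_ge0.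
    - apply: (@measurable_fun_fubini_tonelli_F _ _ _ _ R mu (fun p => `|(g p)%:E|%E)) => //.
      by apply: measurableT_comp => //; exact/measurable_EFinP.
    - apply: emeasurable_funM => //; apply/measurable_EFinP.
      apply: (measurable_restrictT _ _).1 => //.
      by have /integrableP[/measurable_EFinP] := ik1.
    - move=> x _; have [xD|xD] := pselect (D1 x); last first.
        rewrite patchE memNset// mul0e; rewrite (eq_integral (cst 0%E)) ?integral0//.
        by move=> y _; have e : (EFin \o g) (x, y) = 0%E := congr1 (fun h => h y) (g0x _ xD); rewrite e abse0.
      rewrite patchE mem_set//= -integralZl//.
      rewrite [leRHS]integral_mkcond; apply: ge0_le_integral => //.
      + apply/measurable_EFinP; apply: measurableT_comp => //.
        exact: (measurableT_comp mg (pair1_measurable x)).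
      + apply/(measurable_restrictT _ _).1 => //.
        by have /integrableP[] := integrableZl mD2 (k1 x) ik2.
      + move=> y _; rewrite gxy (mem_set xD)/= patchE; case: ifPn => [|_]; last by rewrite normr0.
        by rewrite inE => yD; rewrite /= lee_fin fk.
  have k2fin : (\int[mu]_(y in D2) (k2 y)%:E)%E \is a fin_num by exact: integrable_fin_num.
  rewrite -(fineK k2fin) ge0_integralZr//; last 3 first.
  - apply/measurable_EFinP; apply: (measurable_restrictT _ _).1 => //.
    by have /integrableP[/measurable_EFinP] := ik1.
  - by move=> x _; rewrite lee_fin patchE; case: ifP.
  - by rewrite lee_fin fine_ge0// integral_ge0// => y _; rewrite lee_fin.
  apply: lte_mul_pinfty => //.
  - by apply: integral_ge0 => x _; rewrite lee_fin patchE; case: ifP.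
  - apply: (@integrable_fin_num _ _ _ mu _ _ (EFin \o (k1 \_ D1))) => //.
    by rewrite -restrict_EFin -integrable_mkcond.
  - by rewrite ltry.
have := Fubini ig.
have e1 : (\int[mu]_x \int[mu]_y (EFin \o g) (x, y) = \int[mu]_(x in D1) (\int[mu]_(y in D2) f (x, y))%:E)%E.
  rewrite [RHS]integral_mkcond; apply: eq_integral => x _.
  rewrite patchE; case: ifPn => [|]; rewrite ?inE ?notin_setE => xD.
    rewrite /Rintegral fineK; last exact: integrable_fin_num (ifx _ xD).
    by rewrite [RHS]integral_mkcond; have /= -> := gx _ xD.
  by have /= -> := g0x _ xD; rewrite integral0.
have e2 : (\int[mu]_y \int[mu]_x (EFin \o g) (x, y) = \int[mu]_(y in D2) (\int[mu]_(x in D1) f (x, y))%:E)%E.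
  rewrite [RHS]integral_mkcond; apply: eq_integral => y _.
  rewrite patchE; case: ifPn => [|]; rewrite ?inE ?notin_setE => yD.
    rewrite /Rintegral fineK; last exact: integrable_fin_num (ify _ yD).
    by rewrite [RHS]integral_mkcond; have /= -> := gy _ yD.
  by have /= -> := g0y _ yD; rewrite integral0.
by rewrite e1 e2 => e; rewrite /Rintegral in e *; rewrite e.
Qed.

(** Once both variables are clamped f is bounded on the whole plane, so constants serve as
    majorants. *)
Lemma Rfubini_cont (a b c d : R) (f : R * R -> R) : a <= b -> c <= d -> continuous f ->
  \int[mu]_(x in `[a, b]) \int[mu]_(y in `[c, d]) f (x, y) =
  \int[mu]_(y in `[c, d]) \int[mu]_(x in `[a, b]) f (x, y).
Proof.
move=> ab cd cf.
pose g p := f (clamp a b p.1, clamp c d p.2).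
have cg : continuous g.
  move=> p; apply: (@continuous_comp _ _ _ (fun p : R * R => (clamp a b p.1, clamp c d p.2)) f); last exact: cf.
  apply: continuous_pair.
  - apply: (continuous_fst_comp (@continuous_clamp _ a b)).
  - apply: (continuous_snd_comp (@continuous_clamp _ c d)).
have fg x y : x \in `[a, b] -> y \in `[c, d] -> f (x, y) = g (x, y).
  by move=> xab ycd; rewrite /g !clamp_id.
have cc (u v w : R) : mu.-integrable `[u, v] (EFin \o cst w).
  by apply: (@continuous_integrable _ (cst w)) => z; exact: cvg_cst.
have [M HM] : exists M, forall p, `|g p| <= M.
  have /compact_bounded[M [_ HM]] : compact (f @` (`[a, b] `*` `[c, d])).
    apply: continuous_compact; first exact: continuous_subspaceT.
    by apply: compact_setX; exact: segment_compact.
  exists (`|M| + 1) => p; apply: (HM (`|M| + 1)); first by rewrite (le_lt_trans (ler_norm _))// ltrDl.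
  by exists (clamp a b p.1, clamp c d p.2) => //; split; exact: clamp_in.
transitivity (\int[mu]_(x in `[a, b]) \int[mu]_(y in `[c, d]) g (x, y)).
  by apply: eq_Rintegral => x; rewrite inE => xab; apply: eq_Rintegral => y; rewrite inE => ycd; exact: fg.
transitivity (\int[mu]_(y in `[c, d]) \int[mu]_(x in `[a, b]) g (x, y)); last first.
  by apply: eq_Rintegral => x; rewrite inE => xab; apply: eq_Rintegral => y; rewrite inE => ycd; apply/esym/fg.
apply: (@Rfubini _ _ g (cst `|M|) (cst 1)) => //.
- exact: continuous2_measurable.
- by move=> x y _ _; rewrite /= mulr1 (le_trans (HM _))// ler_norm.
Qed.

(** The exchange over the triangle a <= z <= s <= b, encoded by truncating q z * y s to z <= s. The
    factors are only integrable, so that q may be a weak derivative: this is the integration by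
    parts of [parts_H1]. With continuous factors it moves tail integrals off the test function in
    [FRep_triple]. *)
Lemma Rfubini_triangle (a b : R) (q y : R -> R) : a <= b ->
  measurable_fun setT q -> measurable_fun setT y ->
  mu.-integrable `[a, b] (EFin \o q) -> mu.-integrable `[a, b] (EFin \o y) ->
  \int[mu]_(z in `[a, b]) (q z * \int[mu]_(s in `[z, b]) y s) =
  \int[mu]_(s in `[a, b]) (y s * \int[mu]_(z in `[a, s]) q z).
Proof.
move=> ab mq my iq iy.
pose f (p : R * R) := if p.1 <= p.2 then q p.1 * y p.2 else 0.
transitivity (\int[mu]_(z in `[a, b]) \int[mu]_(s in `[a, b]) f (z, s)).
  apply: eq_Rintegral => z; rewrite inE/= => zab.
  rewrite -RintegralZl//; last first.
    apply: integrableS iy => //; apply: subset_itvr; rewrite bnd_simp.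
    by move: zab; rewrite in_itv => /andP[].
  rewrite [RHS](_ : _ = \int[mu]_(s in `[a, b]) ((fun s => q z * y s) \_ `[z, b]) s).
    rewrite -Rintegral_mkcondr; congr Rintegral; apply/esym/setIidr; apply: subset_itvr; rewrite bnd_simp.
    by move: zab; rewrite in_itv => /andP[].
  apply: eq_Rintegral => s; rewrite inE/= in_itv/= => /andP[_ sb].
  rewrite patchE mem_setE in_itv/= sb andbT /f/=.
  by case: ifP.
transitivity (\int[mu]_(s in `[a, b]) \int[mu]_(z in `[a, b]) f (z, s)); last first.
  apply: eq_Rintegral => s; rewrite inE/= => sab.
  rewrite -RintegralZl//; last first.
    apply: integrableS iq => //; apply: subset_itvl; rewrite bnd_simp.
    by move: sab; rewrite in_itv => /andP[].
  rewrite (_ : \int[mu]_(z in `[a, b]) f (z, s) = \int[mu]_(z in `[a, b]) ((fun z => y s * q z) \_ `[a, s]) z).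
    rewrite -Rintegral_mkcondr; congr Rintegral; apply/setIidr; apply: subset_itvl; rewrite bnd_simp.
    by move: sab; rewrite in_itv => /andP[].
  apply: eq_Rintegral => z; rewrite inE/= in_itv/= => /andP[az _].
  rewrite patchE mem_setE in_itv/= az /f/=.
  by case: ifP => _ //; rewrite mulrC.
apply: (@Rfubini _ _ f (fun z => `|q z|) (fun z => `|y z|)) => //.
- apply: measurable_fun_ifT => //.
    by apply: measurable_fun_ler; [exact: measurable_fst|exact: measurable_snd].
  apply: measurable_funM.
  + exact: (measurableT_comp mq measurable_fst).
  + exact: (measurableT_comp my measurable_snd).
- exact: (integrable_norm iq).
- exact: (integrable_norm iy).
- by move=> z s _ _; rewrite /f/=; case: ifP => _; rewrite ?normrM// normr0 mulr_ge0.
Qed.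

End Fubini.

(** * Positive semidefinite forms on a subspace *)

Section PreHilbert.
Context {R : realType} {E : lmodType R}.
Implicit Types (H : set E) (ip : E -> E -> R) (x y z : E).

(** The axioms are relative to a set H because the spaces at hand are sets of total functions inside
    a larger module, and the integrals are known to be bilinear only there. Positivity is
    semidefinite, which suits plain functions that are not identified almost everywhere. *)
Definition is_ip H ip := [/\ H 0 /\ (forall x y, H x -> H y -> H (x + y)),
  forall k x, H x -> H (k *: x),
  forall x y, H x -> H y -> ip x y = ip y x,
  (forall x y z, H x -> H y -> H z -> ip (x + y) z = ip x z + ip y z) /\
  (forall k x y, H x -> H y -> ip (k *: x) y = k * ip x y)
  & forall x, H x -> 0 <= ip x x].

Definition nrm ip x := Num.sqrt (ip x x).

Variables (H : set E) (ip : E -> E -> R).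
Hypothesis Hip : is_ip H ip.

Lemma subspD x y : H x -> H y -> H (x + y). Proof. by case: Hip => -[_ h] _ _ _ _; exact: h. Qed.
Lemma subspZ k x : H x -> H (k *: x). Proof. by case: Hip => _ h _ _ _; exact: h. Qed.
Lemma subspN x : H x -> H (- x). Proof. by rewrite -scaleN1r; exact: subspZ. Qed.
Lemma subspB x y : H x -> H y -> H (x - y). Proof. by move=> hx hy; apply: subspD => //; exact: subspN. Qed.
Lemma ipC x y : H x -> H y -> ip x y = ip y x. Proof. by case: Hip => _ _ h _ _; exact: h. Qed.
Lemma ipDl x y z : H x -> H y -> H z -> ip (x + y) z = ip x z + ip y z.
Proof. by case: Hip => _ _ _ [h _] _; exact: h. Qed.
Lemma ipZl k x y : H x -> H y -> ip (k *: x) y = k * ip x y.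
Proof. by case: Hip => _ _ _ [_ h] _; exact: h. Qed.
Lemma ipDr x y z : H x -> H y -> H z -> ip x (y + z) = ip x y + ip x z.
Proof. by move=> hx hy hz; rewrite ipC ?ipDl 1?(ipC hy) 1?(ipC hz)//; exact: subspD. Qed.
Lemma ipZr k x y : H x -> H y -> ip x (k *: y) = k * ip x y.
Proof. by move=> hx hy; rewrite ipC ?ipZl 1?(ipC hy)//; exact: subspZ. Qed.
Lemma ipNl x y : H x -> H y -> ip (- x) y = - ip x y.
Proof. by move=> hx hy; rewrite -scaleN1r ipZl// mulN1r. Qed.
Lemma ipNr x y : H x -> H y -> ip x (- y) = - ip x y.
Proof. by move=> hx hy; rewrite -scaleN1r ipZr// mulN1r. Qed.
Lemma ipBl x y z : H x -> H y -> H z -> ip (x - y) z = ip x z - ip y z.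
Proof. by move=> hx hy hz; rewrite ipDl ?ipNl//; exact: subspN. Qed.
Lemma ipBr x y z : H x -> H y -> H z -> ip x (y - z) = ip x y - ip x z.
Proof. by move=> hx hy hz; rewrite ipDr ?ipNr//; exact: subspN. Qed.
Lemma ip_ge0 x : H x -> 0 <= ip x x. Proof. by case: Hip => _ _ _ _; exact. Qed.

(** Nonnegativity of the form at x + t y, a quadratic in t. The form may be degenerate: when ip y y
    = 0 the quadratic is affine in t and nonnegative, which forces ip x y = 0. *)
Lemma ip_CS_sqr x y : H x -> H y -> ip x y ^+ 2 <= ip x x * ip y y.
Proof.
move=> hx hy.
have q t : 0 <= ip x x + 2 * t * ip x y + t ^+ 2 * ip y y.
  have hty := subspZ t hy; have := ip_ge0 (subspD hx hty).
  rewrite ipDl ?ipDr ?ipZl ?ipZr// 1?(ipC hy hx); [|exact: subspD..].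
  by move=> h; apply: le_trans h _; rewrite le_eqVlt; apply/orP; left; apply/eqP; ring.
have c0 := ip_ge0 hy; have a0 := ip_ge0 hx.
move: q c0 a0; set a := ip x x; set b := ip x y; set c := ip y y => q c0 a0.
have [c00|c00] := eqVneq c 0.
  rewrite c00 mulr0; have [->|b0] := eqVneq b 0; first by rewrite expr0n.
  exfalso; have := q (- (a + 1) / (2 * b)); rewrite c00 mulr0 addr0.
  have -> : a + 2 * (- (a + 1) / (2 * b)) * b = - 1 by field.
  by rewrite lerNr oppr0 ler10.
have cp : 0 < c by rewrite lt_def c00.
have := q (- b / c).
have -> : a + 2 * (- b / c) * b + (- b / c) ^+ 2 * c = a - b ^+ 2 / c by field.
by rewrite subr_ge0 ler_pdivrMr.
Qed.

Lemma nrm_ge0 x : 0 <= nrm ip x. Proof. exact: sqrtr_ge0. Qed.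

Lemma sqr_nrm x : H x -> nrm ip x ^+ 2 = ip x x.
Proof. by move=> hx; rewrite sqr_sqrtr// ip_ge0. Qed.

Lemma ip_CS x y : H x -> H y -> `|ip x y| <= nrm ip x * nrm ip y.
Proof.
move=> hx hy; rewrite -sqrtrM ?ip_ge0// -sqrtr_sqr.
by rewrite ler_wsqrtr// ip_CS_sqr.
Qed.

Lemma nrmD x y : H x -> H y -> nrm ip (x + y) <= nrm ip x + nrm ip y.
Proof.
move=> hx hy; have n0 := nrm_ge0.
rewrite -(@ler_pXn2r _ 2)// ?nnegrE ?addr_ge0// sqr_nrm; last exact: subspD.
rewrite ipDl ?ipDr// 1?(ipC hy hx); last exact: subspD.
have := le_trans (ler_norm _) (ip_CS hx hy); rewrite sqrrD !sqr_nrm//.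
lra.
Qed.

Lemma nrmZ k x : H x -> nrm ip (k *: x) = `|k| * nrm ip x.
Proof.
move=> hx; rewrite /nrm ipZl ?ipZr//; last exact: subspZ.
by rewrite mulrA -expr2 sqrtrM ?sqr_ge0// sqrtr_sqr.
Qed.

Lemma nrmN x : H x -> nrm ip (- x) = nrm ip x.
Proof. by move=> hx; rewrite -scaleN1r nrmZ// normrN normr1 mul1r. Qed.

Lemma nrmB x y : H x -> H y -> nrm ip (x - y) = nrm ip (y - x).
Proof. by move=> hx hy; rewrite -opprB nrmN//; exact: subspB. Qed.

End PreHilbert.

(** * Square integrable functions on a segment *)

Section L2.
Context {R : realType} (a b : R).
Hypothesis ab : a < b.
Notation mu := (@lebesgue_measure R).
Implicit Types f g : R -> R.

Definition L2c f := measurable_fun `[a, b] f /\ mu.-integrable `[a, b] (EFin \o (fun t => f t ^+ 2)).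
Definition ip2 f g := \int[mu]_(t in `[a, b]) (f t * g t).

Lemma L2c_mul f g : L2c f -> L2c g -> mu.-integrable `[a, b] (EFin \o (fun t => f t * g t)).
Proof.
move=> [mf f2] [mg g2].
apply: (@le_integrable _ _ R mu _ _ _ (EFin \o (fun t => f t ^+ 2 + g t ^+ 2))) => //.
- by apply/measurable_EFinP; exact: measurable_funM.
- move=> t _; rewrite /= lee_fin normrM [leRHS]ger0_norm ?addr_ge0 ?sqr_ge0//.
  rewrite -(real_normK (num_real (f t))) -(real_normK (num_real (g t))).
  have := sqr_ge0 (`|f t| - `|g t|); have := normr_ge0 (f t); have := normr_ge0 (g t); nra.
- by have := integrableD _ f2 g2; exact.
Qed.

Lemma L2c_cont f : continuous f -> L2c f.
Proof.
move=> cf; split; first by apply: measurable_funTS; exact: continuous_measurable_fun.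
apply: (@continuous_integrable _ (fun t => f t ^+ 2)) => t.
by apply: (@continuous_comp _ _ _ f (fun x => x ^+ 2)); [exact: cf|exact: exprn_continuous].
Qed.

Lemma L2c_int f : L2c f -> mu.-integrable `[a, b] (EFin \o f).
Proof.
move=> hf; have h1 : L2c (cst 1) by apply: L2c_cont => x; exact: cvg_cst.
by apply: itg_eq (L2c_mul hf h1) => t _ /=; rewrite mulr1.
Qed.

Lemma L2c_eq f g : {in `[a, b], f =1 g} -> L2c f -> L2c g.
Proof.
move=> fg [mf f2]; split.
  by apply: eq_measurable_fun mf => t; rewrite inE => tab; apply: fg.
by apply: eq_integrable f2 => // t; rewrite inE => tab /=; rewrite fg.
Qed.

Lemma L2cD f g : L2c f -> L2c g -> L2c (fun t => f t + g t).
Proof.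
move=> hf hg; have [mf f2] := hf; have [mg g2] := hg; split; first exact: measurable_funD.
have fg := L2c_mul hf hg.
apply: itg_eq (itgD (itgD f2 g2) (itgZ 2 fg)) => t _ /=; ring.
Qed.

Lemma L2cZ k f : L2c f -> L2c (fun t => k * f t).
Proof.
move=> hf; have [mf f2] := hf; split.
  by apply: measurable_funM => //; exact: measurable_cst.
by apply: itg_eq (itgZ (k ^+ 2) f2) => t _ /=; ring.
Qed.

Lemma L2c_norm f : L2c f -> L2c (fun t => `|f t|).
Proof.
move=> [mf f2]; split; first by apply: measurableT_comp => //.
by apply: eq_integrable f2 => // t _ /=; rewrite real_normK// num_real.
Qed.

Lemma ip2_ip : @is_ip R (R -> R^o) L2c ip2.
Proof.
split.
- split; first by apply: (@L2c_cont (cst 0)) => x; exact: cvg_cst.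
  exact: L2cD.
- exact: L2cZ.
- by move=> f g _ _; rewrite /ip2; apply: eq_Rintegral => t _; rewrite mulrC.
- split => [f g k hf hg hk|k f g hf hg]; rewrite /ip2.
    by rewrite -RintegralD//; [apply: eq_Rintegral => t _; rewrite -mulrDl|exact: L2c_mul..].
  by rewrite -RintegralZl//; [apply: eq_Rintegral => t _; rewrite mulrA|exact: L2c_mul].
- by move=> f _; apply: Rintegral_ge0 => t _; rewrite -expr2 sqr_ge0.
Qed.

(** Cauchy-Schwarz against the constant 1. *)
Lemma L2_norm1 f : L2c f -> \int[mu]_(t in `[a, b]) `|f t| <= Num.sqrt (b - a) * nrm ip2 f.
Proof.
move=> hf; have h1 : L2c (cst 1) by apply: L2c_cont => x; exact: cvg_cst.
have := ip_CS ip2_ip (L2c_norm hf) h1.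
rewrite {1}/ip2; under eq_Rintegral do rewrite mulr1.
move=> h; apply: le_trans (le_trans (ler_norm _) h) _.
rewrite /nrm mulrC; apply: ler_pM; rewrite ?sqrtr_ge0//.
  rewrite /ip2 -(fine_mu_itv (ltW ab)) -[fine _]mul1r -Rintegral_cst//.
  by rewrite le_eqVlt; apply/orP; left; apply/eqP; congr Num.sqrt; apply: eq_Rintegral => t _; rewrite mulr1.
rewrite le_eqVlt; apply/orP; left; apply/eqP; congr Num.sqrt; apply: eq_Rintegral => t _.
by rewrite -normrM ger0_norm// -expr2 sqr_ge0.
Qed.

Lemma L2_norm2 f g : L2c f -> L2c g ->
  \int[mu]_(t in `[a, b]) (`|f t| * `|g t|) <= nrm ip2 f * nrm ip2 g.
Proof.
move=> hf hg; apply: le_trans (ler_norm _) _.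
have := ip_CS ip2_ip (L2c_norm hf) (L2c_norm hg) => h; apply: le_trans h _.
suff e k : nrm ip2 (fun t => `|k t|) = nrm ip2 k by rewrite !e.
congr Num.sqrt; apply: eq_Rintegral => t _.
by rewrite -normrM ger0_norm// -expr2 sqr_ge0.
Qed.

End L2.

(** * Weak derivatives and the spaces L_2 and H^1_0 of semidiscrete functions *)

Section WeakDerivative.
Context {R : realType}.
Notation mu := (@lebesgue_measure R).

(** Lebesgue differentiation: extended by zero, q is almost everywhere the derivative of its
    primitive, and this primitive vanishes identically on the open interval. The two endpoints form
    a null set. *)
Lemma primitive0_ae (a b : R) (q : R -> R) : a < b -> mu.-integrable `[a, b] (EFin \o q) ->
  (forall z, z \in `[a, b] -> \int[mu]_(t in `[a, z]) q t = 0) ->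
  {ae mu, forall x, x \in `[a, b] -> q x = 0}.
Proof.
move=> ab iq q0; pose qq := q \_ `[a, b].
have lqq : locally_integrable [set: R] qq by exact: integrable_locally.
have iqq : mu.-integrable setT (EFin \o qq).
  by rewrite -restrict_EFin -integrable_mkcond.
have iqqy (y : R) : mu.-integrable [set` Interval (BLeft a) (BRight y)] (EFin \o qq).
  by apply: integrableS iqq.
have neg c : {ae mu, forall x, x <> c}.
  exists [set c]; split => //; first by rewrite lebesgue_measure_set1.
  by move=> x /= /contrapT.
have := FTC1 iqqy lqq => H.
apply: filterS3 (neg a) (neg b) H => x xa xb /= Fx xab.
have xoo : a < x < b.
  move: xab; rewrite in_itv/= !le_eqVlt => /andP[/orP[/eqP/esym//|->] /orP[/eqP//|->]] //.
have /andP[ax xb'] := xoo.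
have /Fx[_] : (a%:E < (x : R)%:E)%E by rewrite lte_fin.
rewrite {2}/qq patchE mem_set// => <-.
rewrite derive1E -[RHS](@derive_cst _ R R (0 : R) (x : R) 1); apply: near_eq_derive.
have : x \in `]a, b[ by rewrite in_itv/= xoo.
move=> /near_in_itvoo; apply: filterS => y yab.
rewrite /cst -[RHS](q0 y); last exact: subset_itv_oo_cc yab.
apply: eq_Rintegral => t; rewrite inE/= in_itv/= => /andP[at_ ty].
rewrite /qq patchE mem_set//= in_itv/= at_/= (le_trans ty)//.
by move: yab; rewrite in_itv/= => /andP[_ /ltW].
Qed.

Variables (A sigma h : R) (N B : nat).
Hypotheses (sigma_gt0 : 0 < sigma) (h_gt0 : 0 < h).
Local Notation b := (A + sigma).
Implicit Types (Q V W : semidiscrete R N B).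

Let Ab : A < b. Proof. by rewrite ltrDl. Qed.
Let Ab' : A <= b. Proof. exact: ltW. Qed.

Local Notation wd := (is_weak_derivative A sigma).
Local Notation L2 := (L2c A b).
Local Notation ip := (ip2 A b).

Lemma wd_L2c f q : wd f q -> L2 q.
Proof. by case. Qed.

(** Two weak derivatives of f have the same primitive, so they agree almost everywhere by
    [primitive0_ae]. Inner products therefore do not depend on the choice hidden in
    [weak_derivative]. *)
Lemma wd_uniq f q1 q2 g : wd f q1 -> wd f q2 -> L2 g -> ip q1 g = ip q2 g.
Proof.
move=> w1 w2 hg; have h1 := wd_L2c w1; have h2 := wd_L2c w2.
have h12 : L2 (fun t => q1 t - q2 t).
  by have := subspB (ip2_ip A b) h1 h2.
suff : ip (fun t => q1 t - q2 t) g = 0.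
  have /= -> := ipBl (ip2_ip A b) h1 h2 hg.
  by move=> /eqP; rewrite subr_eq0 => /eqP.
have ae : {ae mu, forall x, x \in `[A, b] -> q1 x - q2 x = 0}.
  apply: primitive0_ae => //; first exact: L2c_int.
  move=> z zab; have zI : `[A, z] `<=` `[A, b].
    by apply: subset_itvl; rewrite bnd_simp; move: zab; rewrite in_itv/= => /andP[].
  rewrite RintegralB//; last 2 first.
  - by apply: integrableS (L2c_int h1).
  - by apply: integrableS (L2c_int h2).
  case: w1 => _ _ /(_ _ zab) e1; case: w2 => _ _ /(_ _ zab) e2.
  by apply/eqP; rewrite subr_eq0; apply/eqP; apply: (addrI (f A)); rewrite -e1 -e2.
rewrite /ip2 /Rintegral (ae_eq_integral (cst 0%E)) ?integral0//.
  by case/integrableP: (L2c_mul h12 hg).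
move: ae; apply: filterS => [|x h0 xI]; first exact: (ae_filter_ringOfSetsType mu).
by rewrite /= h0// mul0r.
Qed.

Lemma wdD f1 f2 q1 q2 : wd f1 q1 -> wd f2 q2 ->
  wd (fun t => f1 t + f2 t) (fun t => q1 t + q2 t).
Proof.
move=> w1 w2; have h1 := wd_L2c w1; have h2 := wd_L2c w2.
have [m12 i12] := L2cD h1 h2; split => // z zab.
have zI : `[A, z] `<=` `[A, b].
  by apply: subset_itvl; rewrite bnd_simp; move: zab; rewrite in_itv/= => /andP[].
rewrite RintegralD//; last 2 first.
- by apply: integrableS (L2c_int h1).
- by apply: integrableS (L2c_int h2).
case: w1 => _ _ /(_ _ zab) ->; case: w2 => _ _ /(_ _ zab) ->.
by rewrite addrACA.
Qed.

Lemma wdZ k f q : wd f q -> wd (fun t => k * f t) (fun t => k * q t).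
Proof.
move=> w1; have h1 := wd_L2c w1.
have [m12 i12] := L2cZ k h1; split => // z zab.
have zI : `[A, z] `<=` `[A, b].
  by apply: subset_itvl; rewrite bnd_simp; move: zab; rewrite in_itv/= => /andP[].
rewrite RintegralZl//; last by apply: integrableS (L2c_int h1).
by case: w1 => _ _ /(_ _ zab) ->; rewrite mulrDr.
Qed.

Lemma wd0 : wd (cst 0) (cst 0).
Proof.
have [m i] : L2 (cst 0) by apply: L2c_cont => // x; exact: cvg_cst.
by split => // z _; rewrite Rintegral_cst// mul0r addr0.
Qed.

Lemma wd_continuous f q : wd f q -> {within `[A, b], continuous f}.
Proof.
move=> w; have iq := L2c_int (wd_L2c w).
have c := parameterized_integral_continuous Ab' iq.
apply: (@subspace_eq_continuous _ _ _ (fun z => f A + \int[mu]_(t in `[A, z]) q t)).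
  by move=> z; rewrite inE => zI; case: w => _ _ wz; rewrite /= [RHS](wz _ zI).
by move=> z; apply: cvgD; [exact: cvg_cst|exact: c].
Qed.

(** Merging the indices of component and grid point turns a semidiscrete function into a finite
    family of scalar functions of z, and the triple sums of the norms into single sums. *)
Definition node := ('I_N * ('I_B.+1 * 'I_B.+1))%type.
Definition innode (x : node) := Defs.interior x.2.1 && Defs.interior x.2.2.
Definition comp Q (x : node) : R -> R := fun z => Q z x.1 x.2.1 x.2.2.
Definition wdc Q x := weak_derivative A sigma (comp Q x).

Lemma sum_node (F : node -> R) :
  \sum_(k < N) \sum_(i < B.+1 | Defs.interior i) \sum_(j < B.+1 | Defs.interior j) F (k, (i, j)) =
  \sum_(x | innode x) F x.
Proof.
under eq_bigr do rewrite pair_big/=.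
rewrite pair_big/=; apply: eq_big => -[k [i j]]//=.
Qed.

Lemma compD Q V x : comp (Q + V) x = (fun t => comp Q x t + comp V x t).
Proof. by apply/funext => t; rewrite /comp !fctE mxE. Qed.

Lemma compZ k Q x : comp (k *: Q) x = (fun t => k * comp Q x t).
Proof. by apply/funext => t; rewrite /comp !fctE mxE. Qed.

Lemma ipL2E Q V : (forall x, innode x -> L2 (comp Q x)) -> (forall x, innode x -> L2 (comp V x)) ->
  ipL2 A sigma h Q V = h ^+ 2 * \sum_(x | innode x) ip (comp Q x) (comp V x).
Proof.
move=> hQ hV; rewrite /ipL2.
under eq_Rintegral do rewrite (sum_node (fun x => comp Q x _ * comp V x _)).
rewrite RintegralZl//.
  by rewrite Rint_sum// => x xi; apply: L2c_mul => //; [exact: hQ|exact: hV].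
by apply: itg_sum => x xi; apply: L2c_mul => //; [exact: hQ|exact: hV].
Qed.

Lemma H1_wd Q x : H1_0 A sigma Q -> wd (comp Q x) (wdc Q x).
Proof.
move=> [_ /(_ x.1 x.2.1 x.2.2) [q hq] _ _].
rewrite /wdc /weak_derivative; case: xgetP => [y _ //|/(_ q)]; by move=> /(_ hq).
Qed.

Lemma H1_prim Q x z : H1_0 A sigma Q -> z \in `[A, b] -> comp Q x z = \int[mu]_(t in `[A, z]) wdc Q x t.
Proof.
move=> HQ zI; have [_ _ /(_ _ zI) ->] := H1_wd x HQ.
by case: HQ => _ _ _ QA; rewrite /comp QA mxE add0r.
Qed.

Lemma H1_cont Q x : H1_0 A sigma Q -> {within `[A, b], continuous (comp Q x)}.
Proof. by move=> HQ; exact: wd_continuous (H1_wd x HQ). Qed.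

Lemma L2c_within (f : R -> R) : {within `[A, b], continuous f} -> L2 f.
Proof.
move=> /(within_clamp Ab') cf.
have cf' : L2 (f \o clamp A b) by exact: L2c_cont.
by apply: L2c_eq cf' => // t tI; rewrite /= clamp_id.
Qed.

Lemma H1_L2c Q x : H1_0 A sigma Q -> L2 (comp Q x).
Proof. by move=> HQ; exact/L2c_within/H1_cont. Qed.

Lemma comp_dz Q x : comp (dz A sigma Q) x = wdc Q x.
Proof. by apply/funext => t; rewrite /comp /dz mxE. Qed.

(** The chosen weak derivative of a sum need not be the sum of the chosen ones. Allowing arbitrary
    weak derivatives [q] and [v] gives bilinearity in [ipH1_ip] and lets [riesz] use an explicit
    derivative. *)
Lemma ipH1E Q V (q v : node -> R -> R) : H1_0 A sigma Q -> H1_0 A sigma V ->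
  (forall x, wd (comp Q x) (q x)) -> (forall x, wd (comp V x) (v x)) ->
  ipH1 A sigma h Q V = h ^+ 2 * \sum_(x | innode x) (ip (comp Q x) (comp V x) + ip (q x) (v x)).
Proof.
move=> HQ HV wq wv; rewrite /ipH1 !ipL2E; last 4 first.
- by move=> x _; rewrite comp_dz; exact: wd_L2c (H1_wd x HQ).
- by move=> x _; rewrite comp_dz; exact: wd_L2c (H1_wd x HV).
- by move=> x _; exact: H1_L2c.
- by move=> x _; exact: H1_L2c.
rewrite -mulrDr -big_split/=; congr (_ * _); apply: eq_bigr => x _; congr (_ + _).
rewrite !comp_dz (wd_uniq (H1_wd x HQ) (wq x)); last exact: wd_L2c (H1_wd x HV).
rewrite /ip2; under eq_Rintegral do rewrite mulrC.
have := wd_uniq (H1_wd x HV) (wv x) (wd_L2c (wq x)); rewrite /ip2 => ->.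
by apply: eq_Rintegral => t _; rewrite mulrC.
Qed.

Lemma H1_D Q V : H1_0 A sigma Q -> H1_0 A sigma V -> H1_0 A sigma (Q + V).
Proof.
move=> HQ HV; have [q1 q2 q3 q4] := HQ; have [v1 v2 v3 v4] := HV; split.
- by move=> z zI; rewrite fctE q1// v1// addr0.
- move=> k i j; have := wdD (H1_wd (k, (i, j)) HQ) (H1_wd (k, (i, j)) HV).
  by rewrite -(compD Q V (k, (i, j))) => w; eexists; exact: w.
- by move=> z k i j ij; rewrite !fctE mxE q3// v3// addr0.
- by rewrite fctE q4 v4 addr0.
Qed.

Lemma H1_Z k Q : H1_0 A sigma Q -> H1_0 A sigma (k *: Q).
Proof.
move=> HQ; have [q1 q2 q3 q4] := HQ; split.
- by move=> z zI; rewrite fctE q1// scaler0.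
- move=> c i j; have := wdZ k (H1_wd (c, (i, j)) HQ).
  by rewrite -(compZ k Q (c, (i, j))) => w; eexists; exact: w.
- by move=> z c i j ij; rewrite !fctE mxE q3// mulr0.
- by rewrite fctE q4 scaler0.
Qed.

Lemma H1_0_0 : H1_0 A sigma (0 : semidiscrete R N B).
Proof.
split=> //.
- move=> k i j; exists (cst 0); rewrite (_ : (fun t => _) = cst 0); first exact: wd0.
  by apply/funext => t; rewrite mxE.
- by move=> z k i j _; rewrite mxE.
Qed.

Lemma ipH1_ip : is_ip (@H1_0 R A sigma N B) (ipH1 A sigma h).
Proof.
have E Q V := @ipH1E Q V (wdc Q) (wdc V).
split.
- by split; [exact: H1_0_0|exact: H1_D].
- exact: H1_Z.
- move=> Q V HQ HV; rewrite !E//; try by move=> x; exact: H1_wd.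
  congr (_ * _); apply: eq_bigr => x _.
  congr (_ + _).
    by apply: (ipC (ip2_ip A b)); exact: H1_L2c.
  by apply: (ipC (ip2_ip A b)); apply: wd_L2c; exact: H1_wd.
- split => [Q V W HQ HV HW|k Q V HQ HV].
    have wQV x : wd (comp (Q + V) x) (fun t => wdc Q x t + wdc V x t).
      by rewrite compD; exact: wdD (H1_wd x HQ) (H1_wd x HV).
    rewrite (ipH1E (H1_D HQ HV) HW wQV (fun x => H1_wd x HW)).
    rewrite !E//; try by move=> x; exact: H1_wd.
    rewrite -mulrDr -big_split; congr (_ * _); apply: eq_bigr => x _.
    rewrite compD /= addrACA; congr (_ + _).
      by apply: (ipDl (ip2_ip A b)); exact: H1_L2c.
    by apply: (ipDl (ip2_ip A b)); apply: wd_L2c; exact: H1_wd.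
  have wQ x : wd (comp (k *: Q) x) (fun t => k * wdc Q x t).
    by rewrite compZ; exact: wdZ (H1_wd x HQ).
  rewrite (ipH1E (H1_Z k HQ) HV wQ (fun x => H1_wd x HV)).
  rewrite !E//; try by move=> x; exact: H1_wd.
  rewrite mulrCA; congr (_ * _); rewrite mulr_sumr; apply: eq_bigr => x _.
  rewrite compZ mulrDr; congr (_ + _).
    by apply: (ipZl (ip2_ip A b)); exact: H1_L2c.
  by apply: (ipZl (ip2_ip A b)); apply: wd_L2c; exact: H1_wd.
- move=> Q HQ; rewrite E//; try by move=> x; exact: H1_wd.
  rewrite mulr_ge0 ?sqr_ge0// sumr_ge0// => x _.
  rewrite addr_ge0//.
    by apply: (ip_ge0 (ip2_ip A b)); exact: H1_L2c.
  by apply: (ip_ge0 (ip2_ip A b)); apply: wd_L2c; exact: H1_wd.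
Qed.

Lemma ipL2_ip : is_ip (@H1_0 R A sigma N B) (ipL2 A sigma h).
Proof.
have E Q V : H1_0 A sigma Q -> H1_0 A sigma V -> ipL2 A sigma h Q V = h ^+ 2 * \sum_(x | innode x) ip (comp Q x) (comp V x).
  by move=> HQ HV; apply: ipL2E => x _; exact: H1_L2c.
split.
- by split; [exact: H1_0_0|exact: H1_D].
- exact: H1_Z.
- move=> Q V HQ HV; rewrite !E//.
  congr (_ * _); apply: eq_bigr => x _.
  by apply: (ipC (ip2_ip A b)); exact: H1_L2c.
- split => [Q V W HQ HV HW|k Q V HQ HV].
    rewrite !E//; last exact: H1_D.
    rewrite -mulrDr -big_split; congr (_ * _); apply: eq_bigr => x _.
    by rewrite compD; apply: (ipDl (ip2_ip A b)); exact: H1_L2c.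
  rewrite !E//; last exact: H1_Z.
  rewrite mulrCA; congr (_ * _); rewrite mulr_sumr; apply: eq_bigr => x _.
  by rewrite compZ; apply: (ipZl (ip2_ip A b)); exact: H1_L2c.
- move=> Q HQ; rewrite E//.
  rewrite mulr_ge0 ?sqr_ge0// sumr_ge0// => x _.
  by apply: (ip_ge0 (ip2_ip A b)); exact: H1_L2c.
Qed.

Lemma normL2_le_normH1 Q : H1_0 A sigma Q -> normL2 A sigma h Q <= normH1 A sigma h Q.
Proof.
move=> HQ; rewrite ler_wsqrtr// /ipH1 lerDl ipL2E.
- rewrite mulr_ge0 ?sqr_ge0// sumr_ge0// => x _; rewrite comp_dz.
  by apply: (ip_ge0 (ip2_ip A b)); apply: wd_L2c; exact: H1_wd.
- by move=> x _; rewrite comp_dz; exact: wd_L2c (H1_wd x HQ).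
- by move=> x _; rewrite comp_dz; exact: wd_L2c (H1_wd x HQ).
Qed.

Lemma comp_out Q x z : H1_0 A sigma Q -> ~~ innode x -> comp Q x z = 0.
Proof. by move=> [_ _ q _] xi; rewrite /comp q. Qed.

(** The factor 1 / h undoes the weight h^2 of the squared norm. The norm does not see the nodes
    outside the interior, but there the components vanish. *)
Lemma nrm_comp_L2 Q x : H1_0 A sigma Q -> nrm ip (comp Q x) <= h^-1 * normL2 A sigma h Q.
Proof.
move=> HQ; have [xi|xi] := boolP (innode x); last first.
  rewrite /nrm /ip2; under eq_Rintegral do rewrite (comp_out _ HQ xi) mul0r.
  by rewrite Rintegral_cst// mul0r sqrtr0 mulr_ge0 ?sqrtr_ge0// invr_ge0 ltW.
rewrite ler_pdivlMl// -[X in X * _](ger0_norm (ltW h_gt0)) -sqrtr_sqr -sqrtrM ?sqr_ge0//.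
rewrite ler_wsqrtr// ipL2E; try by move=> y _; exact: H1_L2c.
rewrite ler_wpM2l ?sqr_ge0// (bigD1 x)//= lerDl sumr_ge0// => y _.
by apply: (ip_ge0 (ip2_ip A b)); exact: H1_L2c.
Qed.

Lemma nrm_wdc_H1 Q x : H1_0 A sigma Q -> innode x -> nrm ip (wdc Q x) <= h^-1 * normH1 A sigma h Q.
Proof.
move=> HQ xi.
rewrite ler_pdivlMl// -[X in X * _](ger0_norm (ltW h_gt0)) -sqrtr_sqr -sqrtrM ?sqr_ge0//.
rewrite ler_wsqrtr// (ipH1E HQ HQ (fun x => H1_wd x HQ) (fun x => H1_wd x HQ)).
have p y : 0 <= ip (comp Q y) (comp Q y) by apply: (ip_ge0 (ip2_ip A b)); exact: H1_L2c.
have p' y : 0 <= ip (wdc Q y) (wdc Q y) by apply: (ip_ge0 (ip2_ip A b)); apply: wd_L2c; exact: H1_wd.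
rewrite ler_wpM2l ?sqr_ge0// (bigD1 x)//= -addrA.
rewrite -[leLHS]add0r addrCA -[leLHS]addrC lerD// addr_ge0// sumr_ge0// => y _.
by rewrite addr_ge0.
Qed.

(** One-dimensional Sobolev embedding: as Q vanishes at A, its value at z is the integral of the
    weak derivative, which Cauchy-Schwarz bounds on an interval of length sigma. *)
Lemma H1_sup Q x z : H1_0 A sigma Q -> z \in `[A, b] ->
  `|comp Q x z| <= Num.sqrt sigma / h * normH1 A sigma h Q.
Proof.
move=> HQ zI; have [xi|xi] := boolP (innode x); last first.
  by rewrite comp_out// normr0 !mulr_ge0 ?sqrtr_ge0// invr_ge0 ltW.
have hw := wd_L2c (H1_wd x HQ).
have zI' : `[A, z] `<=` `[A, b].
  by apply: subset_itvl; rewrite bnd_simp; move: zI; rewrite in_itv/= => /andP[].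
have i1 := L2c_int hw.
have i2 : mu.-integrable `[A, z] (EFin \o wdc Q x) by exact: integrableS i1.
rewrite H1_prim//; apply: le_trans (le_normr_Rintegral _ i2) _ => //.
apply: (@le_trans _ _ (\int[mu]_(t in `[A, b]) `|wdc Q x t|)).
  rewrite (@Rint_split _ A b z)//; last by have := integrable_norm i1.
  by rewrite lerDl; apply: Rintegral_ge0.
apply: le_trans (L2_norm1 Ab hw) _.
rewrite (_ : b - A = sigma); last by ring.
by rewrite -mulrA ler_wpM2l ?sqrtr_ge0// nrm_wdc_H1.
Qed.

End WeakDerivative.

(** * Calculus of C^{1,1} functions with respect to a seminorm *)

Section C11.
Context {R : realType} {E : zmodType}.
Notation mu := (@lebesgue_measure R).
Variables (S H : set E).
Hypothesis SH : forall W W2, S W -> S W2 -> H (W2 - W).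
Implicit Types (n : E -> R) (C : R) (f g : E -> R) (df dg : E -> E -> R).

(* One constant for all the bounds makes the class stable under products, compositions and
   integration; the quadratic remainder is part of the definition, so that no segment
   between two points of [S] has to stay in [S]. *)
Definition C11 n C f df :=
  [/\ 0 <= C, forall W, S W -> `|f W| <= C,
    forall W V, S W -> H V -> `|df W V| <= C * n V
  & forall W W2, S W -> S W2 ->
    [/\ `|f W2 - f W| <= C * n (W2 - W),
        forall V, H V -> `|df W2 V - df W V| <= C * (n (W2 - W) * n V)
      & `|f W2 - f W - df W (W2 - W)| <= C * n (W2 - W) ^+ 2]].

Lemma C11_le n m C D f df : (forall V, H V -> 0 <= n V <= m V) -> C <= D ->
  C11 n C f df -> C11 m D f df.
Proof.
move=> nm CD [C0 h1 h2 h3].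
have n0 V : H V -> 0 <= n V by move=> /nm /andP[].
have nm' V : H V -> n V <= m V by move=> /nm /andP[].
have m0 V : H V -> 0 <= m V by move=> hV; exact: le_trans (n0 _ hV) (nm' _ hV).
split; first exact: le_trans CD.
- by move=> W SW; apply: le_trans (h1 _ SW) _.
- by move=> W V SW HV; apply: le_trans (h2 _ _ SW HV) _; rewrite ler_pM// ?n0 ?nm'.
move=> W W2 SW SW2; have [h4 h5 h6] := h3 _ _ SW SW2; have hd := SH SW SW2; split.
- by apply: le_trans h4 _; rewrite ler_pM// ?n0 ?nm'.
- move=> V HV; apply: le_trans (h5 _ HV) _.
  by rewrite ler_pM// ?mulr_ge0 ?n0// ler_pM// ?n0 ?nm'.
- by apply: le_trans h6 _; rewrite ler_pM// ?exprn_ge0 ?n0// lerXn2r ?nnegrE ?n0 ?m0 ?nm'.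
Qed.

Lemma C11_eq n C f df g dg : (forall W, S W -> f W = g W) ->
  (forall W V, S W -> H V -> df W V = dg W V) -> C11 n C f df -> C11 n C g dg.
Proof.
move=> fg fg' [C0 h1 h2 h3]; split => //.
- by move=> W SW; rewrite -fg//; exact: h1.
- by move=> W V SW HV; rewrite -fg'//; exact: h2.
- move=> W W2 SW SW2; have [h4 h5 h6] := h3 _ _ SW SW2; have hd := SH SW SW2.
  by split => [|V HV|]; rewrite -?fg -?fg'//; exact: h5.
Qed.

Section Norm.
Variable n : E -> R.
Hypothesis n_ge0 : forall V, H V -> 0 <= n V.

Lemma C11_lin C f (l : E -> R) : 0 <= C -> (forall W, S W -> `|f W| <= C) ->
  (forall V, H V -> `|l V| <= C * n V) ->
  (forall W W2, S W -> S W2 -> f W2 - f W = l (W2 - W)) ->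
  C11 n C f (fun=> l).
Proof.
move=> C0 hf hl e; split => //; first by move=> W V _; exact: hl.
move=> W W2 SW SW2; have hd := SH SW SW2; split.
- by rewrite e// hl.
- by move=> V HV; rewrite subrr normr0 !mulr_ge0// n_ge0.
- by rewrite e// subrr normr0 mulr_ge0// exprn_ge0// n_ge0.
Qed.

Lemma C11_cst c : C11 n `|c| (fun=> c) (fun=> fun=> 0).
Proof.
apply: C11_lin => //; first by move=> V HV; rewrite normr0 mulr_ge0// n_ge0.
by move=> W W2 _ _; rewrite subrr.
Qed.

Lemma C11_add C D f df g dg : C11 n C f df -> C11 n D g dg ->
  C11 n (C + D) (fun W => f W + g W) (fun W V => df W V + dg W V).
Proof.
move=> [C0 h1 h2 h3] [D0 k1 k2 k3]; split.
- exact: addr_ge0.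
- by move=> W SW; apply: le_trans (ler_normD _ _) _; rewrite lerD ?h1 ?k1.
- by move=> W V SW HV; apply: le_trans (ler_normD _ _) _; rewrite mulrDl lerD ?h2 ?k2.
move=> W W2 SW SW2; have [h4 h5 h6] := h3 _ _ SW SW2; have [k4 k5 k6] := k3 _ _ SW SW2; split.
- by rewrite opprD addrACA mulrDl; apply: le_trans (ler_normD _ _) _; rewrite lerD.
- move=> V HV; rewrite opprD addrACA mulrDl; apply: le_trans (ler_normD _ _) _.
  by rewrite lerD// ?h5 ?k5.
- rewrite (_ : _ - _ - _ = (f W2 - f W - df W (W2 - W)) + (g W2 - g W - dg W (W2 - W))); last by ring.
  by rewrite mulrDl; apply: le_trans (ler_normD _ _) _; rewrite lerD.
Qed.

Lemma C11_scale c C f df : C11 n C f df ->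
  C11 n (`|c| * C) (fun W => c * f W) (fun W V => c * df W V).
Proof.
move=> [C0 h1 h2 h3]; split.
- exact: mulr_ge0.
- by move=> W SW; rewrite normrM ler_wpM2l// h1.
- by move=> W V SW HV; rewrite normrM -mulrA ler_wpM2l// h2.
move=> W W2 SW SW2; have [h4 h5 h6] := h3 _ _ SW SW2; split.
- by rewrite -mulrBr normrM -mulrA ler_wpM2l.
- by move=> V HV; rewrite -mulrBr normrM -mulrA ler_wpM2l// h5.
- by rewrite -!mulrBr normrM -mulrA ler_wpM2l.
Qed.

Lemma C11_sum (I : Type) (s : seq I) (P : pred I) (C : I -> R) (f : I -> E -> R) (df : I -> E -> E -> R) :
  (forall i, P i -> C11 n (C i) (f i) (df i)) ->
  C11 n (\sum_(i <- s | P i) C i) (fun W => \sum_(i <- s | P i) f i W)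
    (fun W V => \sum_(i <- s | P i) df i W V).
Proof.
move=> h; elim: s => [|i s ih].
  rewrite big_nil -[X in C11 _ X](normr0 R); apply: C11_eq (C11_cst 0).
  - by move=> W _; rewrite big_nil.
  - by move=> W V _ _; rewrite big_nil.
rewrite big_cons; case Pi : (P i).
  apply: C11_eq (C11_add (h i Pi) ih).
  - by move=> W _; rewrite big_cons Pi.
  - by move=> W V _ _; rewrite big_cons Pi.
apply: C11_eq ih.
- by move=> W _; rewrite big_cons Pi.
- by move=> W V _ _; rewrite big_cons Pi.
Qed.

(** The factor 4 is reached in the Lipschitz bound of the derivative, whose increment splits into
    four products; the remainder splits into three. *)
Lemma C11_mul C D f df g dg : C11 n C f df -> C11 n D g dg ->
  C11 n (4 * (C * D)) (fun W => f W * g W) (fun W V => df W V * g W + f W * dg W V).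
Proof.
move=> [C0 h1 h2 h3] [D0 k1 k2 k3].
have CD0 := mulr_ge0 C0 D0.
have M (x y X Y : R) : `|x| <= X -> `|y| <= Y -> `|x * y| <= X * Y.
  by move=> ? ?; rewrite normrM ler_pM.
have A2 (x y X Y : R) : `|x| <= X -> `|y| <= Y -> `|x + y| <= X + Y.
  by move=> ? ?; apply: le_trans (ler_normD _ _) _; rewrite lerD.
split.
- by rewrite mulr_ge0.
- by move=> W SW; apply: le_trans (M _ _ _ _ (h1 _ SW) (k1 _ SW)) _; lra.
- move=> W V SW HV; have nV := mulr_ge0 CD0 (n_ge0 HV).
  apply: le_trans (A2 _ _ _ _ (M _ _ _ _ (h2 _ _ SW HV) (k1 _ SW)) (M _ _ _ _ (h1 _ SW) (k2 _ _ SW HV))) _.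
  by nra.
move=> W W2 SW SW2; have [h4 h5 h6] := h3 _ _ SW SW2; have [k4 k5 k6] := k3 _ _ SW SW2.
have hd := SH SW SW2; have nd := mulr_ge0 CD0 (n_ge0 hd).
set d := n (W2 - W) in nd h4 h5 h6 k4 k5 k6 *; split.
- rewrite (_ : _ - _ = (f W2 - f W) * g W2 + f W * (g W2 - g W)); last by ring.
  apply: le_trans (A2 _ _ _ _ (M _ _ _ _ h4 (k1 _ SW2)) (M _ _ _ _ (h1 _ SW) k4)) _.
  by nra.
- move=> V HV; have nV := mulr_ge0 nd (n_ge0 HV).
  rewrite (_ : _ - _ = ((df W2 V - df W V) * g W2 + df W V * (g W2 - g W)) +
     ((f W2 - f W) * dg W2 V + f W * (dg W2 V - dg W V))); last by ring.
  apply: le_trans (A2 _ _ _ _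
     (A2 _ _ _ _ (M _ _ _ _ (h5 _ HV) (k1 _ SW2)) (M _ _ _ _ (h2 _ _ SW HV) k4))
     (A2 _ _ _ _ (M _ _ _ _ h4 (k2 _ _ SW2 HV)) (M _ _ _ _ (h1 _ SW) (k5 _ HV)))) _.
  by rewrite le_eqVlt; apply/orP; left; apply/eqP; ring.
- have dd : 0 <= C * D * d ^+ 2 by rewrite mulr_ge0// sqr_ge0.
  rewrite (_ : _ - _ - _ = (f W2 - f W - df W (W2 - W)) * g W +
     (f W * (g W2 - g W - dg W (W2 - W)) + (f W2 - f W) * (g W2 - g W))); last by ring.
  apply: le_trans (A2 _ _ _ _ (M _ _ _ _ h6 (k1 _ SW))
     (A2 _ _ _ _ (M _ _ _ _ (h1 _ SW) k6) (M _ _ _ _ h4 k4))) _.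
  by rewrite -subr_ge0 (_ : _ - _ = C * D * d ^+ 2)//; ring.
Qed.

(** [psi] is controlled through increments between points of U only, so U can be any set containing
    the values of f. In the constant, K C^2 comes from the Lipschitz bound and the remainder of
    [psi] at increments of f, and K C from those of f itself. *)
Lemma C11_comp (U : set R) (psi psi' : R -> R) (K C : R) f df : 0 <= K ->
  (forall s, U s -> `|psi s| <= K /\ `|psi' s| <= K) ->
  (forall s t, U s -> U t -> [/\ `|psi t - psi s| <= K * `|t - s|,
     `|psi' t - psi' s| <= K * `|t - s| &
     `|psi t - psi s - psi' s * (t - s)| <= K * `|t - s| ^+ 2]) ->
  (forall W, S W -> U (f W)) ->
  C11 n C f df ->
  C11 n (K * (1 + C + C ^+ 2)) (fun W => psi (f W)) (fun W V => psi' (f W) * df W V).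
Proof.
move=> K0 p1 p2 SU [C0 h1 h2 h3].
have C2 : 0 <= C ^+ 2 by rewrite sqr_ge0.
have KC := mulr_ge0 K0 C0; have KC2 := mulr_ge0 K0 C2.
have M (x y X Y : R) : `|x| <= X -> `|y| <= Y -> `|x * y| <= X * Y.
  by move=> ? ?; rewrite normrM ler_pM.
have A2 (x y X Y : R) : `|x| <= X -> `|y| <= Y -> `|x + y| <= X + Y.
  by move=> ? ?; apply: le_trans (ler_normD _ _) _; rewrite lerD.
split.
- by rewrite mulr_ge0// !addr_ge0.
- by move=> W SW; apply: le_trans (p1 _ (SU _ SW)).1 _; nra.
- move=> W V SW HV; have nV := n_ge0 HV.
  apply: le_trans (M _ _ _ _ (p1 _ (SU _ SW)).2 (h2 _ _ SW HV)) _.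
  rewrite mulrA ler_wpM2r//; nra.
move=> W W2 SW SW2; have [h4 h5 h6] := h3 _ _ SW SW2.
have [q1 q2 q3] := p2 _ _ (SU _ SW) (SU _ SW2).
have hd := SH SW SW2; have d0 := n_ge0 hd.
set d := n (W2 - W) in d0 h4 h5 h6 *.
have q1' X : X * `|f W2 - f W| <= X * (C * d) \/ X < 0.
  by have [x0|x0] := leP 0 X; [left; rewrite ler_wpM2l|right].
have f1 : K * `|f W2 - f W| <= K * (C * d) by rewrite ler_wpM2l.
have f2 : K * `|f W2 - f W| ^+ 2 <= K * (C * d) ^+ 2.
  by rewrite ler_wpM2l// lerXn2r ?nnegrE// mulr_ge0.
split.
- apply: le_trans q1 (le_trans f1 _); rewrite mulrA ler_wpM2r//; nra.
- move=> V HV; have nV := n_ge0 HV; have dV := mulr_ge0 d0 nV.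
  rewrite (_ : _ - _ = (psi' (f W2) - psi' (f W)) * df W2 V + psi' (f W) * (df W2 V - df W V)); last by ring.
  apply: le_trans (A2 _ _ _ _ (M _ _ _ _ (le_trans q2 f1) (h2 _ _ SW2 HV)) (M _ _ _ _ (p1 _ (SU _ SW)).2 (h5 _ HV))) _.
  rewrite -subr_ge0 (_ : _ - _ = K * (d * n V)); last by ring.
  exact: mulr_ge0.
- rewrite (_ : _ - _ - _ = (psi (f W2) - psi (f W) - psi' (f W) * (f W2 - f W)) +
    psi' (f W) * (f W2 - f W - df W (W2 - W))); last by ring.
  apply: le_trans (A2 _ _ _ _ (le_trans q3 f2) (M _ _ _ _ (p1 _ (SU _ SW)).2 h6)) _.
  rewrite -subr_ge0 (_ : _ - _ = K * d ^+ 2); last by ring.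
  by rewrite mulr_ge0// sqr_ge0.
Qed.

End Norm.

(** The seminorm may change under integration: bounds in [ptnorm t] at each t integrate to bounds in
    n as soon as n dominates the integral of [ptnorm] and, for the Lipschitz bound and the quadratic
    remainder, the integral of a product of two of them. This is how L_2 norms arise from pointwise
    values. *)
Lemma C11_int (c d K C : R) (ptnorm : R -> E -> R) (n : E -> R) (f : R -> E -> R) (df : R -> E -> E -> R) :
  c <= d -> d - c <= K ->
  (forall V, H V -> 0 <= n V) ->
  (forall t V, t \in `[c, d] -> H V -> 0 <= ptnorm t V) ->
  (forall V, H V -> mu.-integrable `[c, d] (EFin \o (fun t => ptnorm t V)) /\
     \int[mu]_(t in `[c, d]) ptnorm t V <= K * n V) ->
  (forall V V2, H V -> H V2 -> mu.-integrable `[c, d] (EFin \o (fun t => ptnorm t V * ptnorm t V2)) /\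
     \int[mu]_(t in `[c, d]) (ptnorm t V * ptnorm t V2) <= K * (n V * n V2)) ->
  (forall W, S W -> mu.-integrable `[c, d] (EFin \o (fun t => f t W))) ->
  (forall W V, S W -> H V -> mu.-integrable `[c, d] (EFin \o (fun t => df t W V))) ->
  (forall t, t \in `[c, d] -> C11 (ptnorm t) C (f t) (df t)) ->
  C11 n (C * K) (fun W => \int[mu]_(t in `[c, d]) f t W)
    (fun W V => \int[mu]_(t in `[c, d]) df t W V).
Proof.
move=> cd K0 n0 nt0 i1 i2 if_ if' h.
have C0 : 0 <= C by have [] := h c _; rewrite // in_itv/= lexx.
have bnd (X Y : R -> R) (k : R) : mu.-integrable `[c, d] (EFin \o X) -> mu.-integrable `[c, d] (EFin \o Y) ->
   (forall t, t \in `[c, d] -> `|X t| <= C * Y t) -> \int[mu]_(t in `[c, d]) Y t <= k ->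
   `|\int[mu]_(t in `[c, d]) X t| <= C * k.
  move=> iX iY XY Yk; apply: le_trans (le_normr_Rintegral _ iX) _ => //.
  apply: le_trans (ler_wpM2l C0 Yk); rewrite -RintegralZl//.
  apply: le_Rintegral => //; [by have := integrable_norm iX|exact: itgZ].
have KK : \int[mu]_(t in `[c, d]) (cst 1 t) <= K.
  by rewrite Rintegral_cst// mul1r fine_mu_itv.
split.
- by rewrite mulr_ge0// (le_trans _ K0)// subr_ge0.
- move=> W SW; apply: (bnd _ (cst 1)) => //; [exact: if_|exact: itg_cst|].
  by move=> t tI; rewrite mulr1; have [_ h1 _ _] := h t tI; exact: h1.
- move=> W V SW HV; have [j1 j2] := i1 _ HV; rewrite -mulrA.
  apply: bnd j1 _ j2; first exact: if'.
  by move=> t tI; have [_ _ h1 _] := h t tI; exact: h1.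
move=> W W2 SW SW2; have hd := SH SW SW2; have [j1 j2] := i1 _ hd.
have fd := itgB (if_ _ SW2) (if_ _ SW).
split.
- rewrite -mulrA -RintegralB//; [|exact: if_..].
  apply: bnd fd j1 _ j2.
  by move=> t tI; have [_ _ _ h1] := h t tI; have [] := h1 _ _ SW SW2.
- move=> V HV; have [j3 j4] := i2 _ _ hd HV.
  rewrite -mulrA -RintegralB//; [|exact: if'..].
  apply: bnd _ j3 _ j4; first by apply: itgB; exact: if'.
  by move=> t tI; have [_ _ _ h1] := h t tI; have [_ + _] := h1 _ _ SW SW2; exact.
- have [j3 j4] := i2 _ _ hd hd.
  rewrite -RintegralB//; [|exact: if_..].
  rewrite -RintegralB//; [|exact: if'].
  rewrite -mulrA expr2; apply: bnd _ j3 _ j4; first by apply: itgB => //; exact: if'.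
  by move=> t tI; have [_ _ _ h1] := h t tI; have [_ _] := h1 _ _ SW SW2; rewrite expr2.
Qed.

End C11.

(** * C^{1,1} bounds for the inverse square root away from zero *)

Section InverseSqrt.
Context {R : realType}.

(* [rsq] is the derivative of the square root, the nonlinearity of [flux]. *)
Definition rsq (q : R) : R := (2 * Num.sqrt q)^-1.
(** The derivative of [rsq], written as a power of [rsq] so that its continuity follows from that of
    [rsq]. *)
Definition drsq (q : R) : R := - 2 * rsq q ^+ 3.

(** With u and v the square roots of s and t one has t - s = v^2 - u^2, and the three differences
    factor exactly through t - s or its square. The coefficients are products of 1 / u, 1 / v and 1
    / (u + v), each at most k = 1 / sqrt c, and of u / (u + v) <= 1; whence the powers k, k^3 and
    k^5. *)
Lemma rsq_C11 (c : R) : 0 < c -> exists2 K, 0 <= K &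
  (forall s, c <= s -> `|rsq s| <= K /\ `|drsq s| <= K) /\
  (forall s t, c <= s -> c <= t -> [/\ `|rsq t - rsq s| <= K * `|t - s|,
     `|drsq t - drsq s| <= K * `|t - s| &
     `|rsq t - rsq s - drsq s * (t - s)| <= K * `|t - s| ^+ 2]).
Proof.
move=> c0; pose k := (Num.sqrt c)^-1.
have k0 : 0 < k by rewrite invr_gt0 sqrtr_gt0.
have k3 : 0 < k ^+ 3 by rewrite exprn_gt0.
have k5 : 0 < k ^+ 5 by rewrite exprn_gt0.
have a0 s : c <= s -> 0 < Num.sqrt s by move=> cs; rewrite sqrtr_gt0 (lt_le_trans c0).
have p0 s : c <= s -> 0 < (Num.sqrt s)^-1 by move=> cs; rewrite invr_gt0 a0.
have pk s : c <= s -> (Num.sqrt s)^-1 <= k.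
  by move=> cs; rewrite lef_pV2 ?posrE ?a0// ler_wsqrtr.
have rE s : rsq s = (Num.sqrt s)^-1 / 2 by rewrite /rsq invfM mulrC.
have dE s : drsq s = - (Num.sqrt s)^-1 ^+ 3 / 4 by rewrite /drsq rE; move: (Num.sqrt s)^-1 => p; field.
have M3 x y z : 0 <= x <= k -> 0 <= y <= k -> 0 <= z <= k -> x * y * z <= k ^+ 3.
  move=> /andP[x0 xk] /andP[y0 yk] /andP[z0 zk].
  by rewrite (_ : k ^+ 3 = k * k * k) ?exprS ?expr0 ?mulr1 ?mulrA// !ler_pM ?mulr_ge0.
have M2 x y : 0 <= x <= k -> 0 <= y <= k -> x * y <= k ^+ 2.
  by move=> /andP[x0 xk] /andP[y0 yk]; rewrite expr2 ler_pM.
exists (k + k ^+ 3 + k ^+ 5); first by rewrite !addr_ge0// ltW.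
split=> [s cs|s t cs ct].
  have x0 := p0 _ cs; have xk := pk _ cs.
  split.
    rewrite rE ger0_norm ?divr_ge0 ?ltW//; lra.
  rewrite dE mulNr normrN ger0_norm ?divr_ge0 ?exprn_ge0 ?ltW//.
  have : (Num.sqrt s)^-1 ^+ 3 <= k ^+ 3 by rewrite lerXn2r ?nnegrE// ltW.
  have : 0 <= (Num.sqrt s)^-1 ^+ 3 by rewrite exprn_ge0// ltW.
  by lra.
have x0 := p0 _ cs; have xk := pk _ cs; have y0 := p0 _ ct; have yk := pk _ ct.
have ts : t - s = Num.sqrt t ^+ 2 - Num.sqrt s ^+ 2.
  by rewrite !sqr_sqrtr// ltW// (lt_le_trans c0).
rewrite !rE !dE.
have u0 := a0 _ cs; have v0 := a0 _ ct.
set u := Num.sqrt s in x0 xk u0 ts *; set v := Num.sqrt t in y0 yk v0 ts *.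
clearbody u v.
pose e := (u + v)^-1.
have e0 : 0 < e by rewrite invr_gt0 addr_gt0.
have ek : e <= k.
  apply: le_trans xk; rewrite lef_pV2 ?posrE ?addr_gt0// lerDl ltW//.
have un : u != 0 by rewrite gt_eqF.
have vn : v != 0 by rewrite gt_eqF.
have uvn : u + v != 0 by rewrite gt_eqF// addr_gt0.
have xb : 0 <= u^-1 <= k by rewrite xk ltW.
have yb : 0 <= v^-1 <= k by rewrite yk ltW.
have eb : 0 <= e <= k by rewrite ek ltW.
have h3 := M3 _ _ _ xb yb eb.
have h30 : 0 <= u^-1 * v^-1 * e by rewrite !mulr_ge0// ltW.
split.
- rewrite (_ : v^-1 / 2 - u^-1 / 2 = - ((u^-1 * v^-1 * e / 2) * (t - s))); last by rewrite ts /e; field; do ?[apply/andP; split]; rewrite ?gt_eqF ?addr_gt0.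
  rewrite normrN normrM ler_wpM2r// ger0_norm; last by rewrite divr_ge0.
  by lra.
- rewrite (_ : - v^-1 ^+ 3 / 4 - - u^-1 ^+ 3 / 4 = (u^-1 * v^-1 * e) * ((u^-1 * u^-1 + u^-1 * v^-1 + v^-1 * v^-1) / 4) * (t - s)); last first.
    by rewrite ts /e; field; do ?[apply/andP; split]; rewrite ?gt_eqF ?addr_gt0.
  have q1 := M2 _ _ xb xb; have q2 := M2 _ _ xb yb; have q3 := M2 _ _ yb yb.
  have z1 : 0 <= u^-1 * u^-1 + u^-1 * v^-1 + v^-1 * v^-1 by rewrite !addr_ge0// mulr_ge0// ltW.
  rewrite normrM ler_wpM2r// ger0_norm; last by apply: mulr_ge0 => //; exact: divr_ge0.
  apply: (@le_trans _ _ (k ^+ 3 * k ^+ 2)).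
    by apply: ler_pM => //; [exact: divr_ge0|lra].
  by rewrite -exprD; lra.
- rewrite (_ : v^-1 / 2 - u^-1 / 2 - - u^-1 ^+ 3 / 4 * (t - s) =
    (u^-1 * v^-1 * e) * (u^-1 * u^-1) * ((1 + u * e) / 4) * (t - s) ^+ 2); last first.
    by rewrite ts /e; field; do ?[apply/andP; split]; rewrite ?gt_eqF ?addr_gt0.
  have q1 := M2 _ _ xb xb.
  have z1 : 0 <= u^-1 * u^-1 by rewrite mulr_ge0// ltW.
  have z2 : 0 <= u * e <= 1.
    apply/andP; split; first by apply: mulr_ge0; exact: ltW.
    by rewrite /e ler_pdivrMr ?addr_gt0// mul1r lerDl ltW.
  rewrite normrM [X in _ * X]normrX ler_wpM2r ?exprn_ge0// ger0_norm; last first.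
    by apply: mulr_ge0; [exact: mulr_ge0|apply: divr_ge0 => //; lra].
  apply: (@le_trans _ _ (k ^+ 3 * k ^+ 2 * 1)).
    apply: ler_pM => //; [exact: mulr_ge0|apply: divr_ge0 => //; lra|exact: ler_pM|lra].
  by rewrite mulr1 -exprD; lra.
Qed.

End InverseSqrt.

(** * Integrands at a given height and a given alpha *)

Section Pointwise.
Context {R : realType}.
Notation mu := (@lebesgue_measure R).
Variables (A sigma : R) (N B : nat).
Hypothesis sigma_gt0 : 0 < sigma.
Local Notation b := (A + sigma).
Local Notation E := (semidiscrete R N B).
Local Notation node := (node N B).
Local Notation H1 := (@H1_0 R A sigma N B).
Variables (M MG : R) (S : E -> set E).
Hypotheses (M_ge0 : 0 <= M) (MG_ge0 : 0 <= MG).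
Hypothesis S_H1 : forall G W, S G W -> H1 W.
Hypothesis S_M : forall G W x t, S G W -> t \in `[A, b] -> `|comp W x t| <= M.

Let Ab : A < b. Proof. by rewrite ltrDl. Qed.
Let Ab' : A <= b. Proof. exact: ltW. Qed.

(** Constants may depend on G through [MG] only, because the bound on the step size has to be common
    to all data of given norms. *)
Definition admissible (G : E) := (forall x, {within `[A, b], continuous (comp G x)}) /\
  forall x t, t \in `[A, b] -> `|comp G x t| <= MG.

Definition ptnorm (t : R) (V : E) := \sum_(k : node) `|comp V k t|.

(** The height is clamped, alpha is not: derivatives in alpha at 0 and 1 are two-sided, so alpha has
    to range over a set X that may reach beyond [0, 1]. *)
Definition LCont (X : set R) (f : R -> R -> R) := forall t x, X x ->
  {for (t, x), continuous (fun p : R * R => f (clamp A b p.1) p.2)}.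

Definition LRep (X : set R) (l : R -> R -> E -> R) :=
  exists2 coef : node -> R -> R -> R, forall k, LCont X (coef k) &
    forall t x V, l t x V = \sum_k coef k t x * comp V k t.

(* Integrands: they depend on W only through its values at height t, hence the seminorm
   [ptnorm t]. *)
Definition C11_tx (X : E -> E -> set R) (f : E -> R -> R -> E -> R) (df : E -> R -> R -> E -> E -> R) :=
  (exists C, forall G t x, admissible G -> t \in `[A, b] -> x \in `[0, 1] ->
     C11 (S G) H1 (ptnorm t) C (f G t x) (df G t x)) /\
  forall G W, admissible G -> S G W ->
     LCont (X G W) (fun t x => f G t x W) /\ LRep (X G W) (fun t x => df G t x W).

Lemma S_sub G W W2 : S G W -> S G W2 -> H1 (W2 - W).
Proof. by move=> h1 h2; apply: (subspB (ipL2_ip A 1 N B sigma_gt0)); [exact: S_H1 h2|exact: S_H1 h1]. Qed.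

Lemma ptnorm_ge0 t V : 0 <= ptnorm t V.
Proof. exact: sumr_ge0. Qed.

Lemma LCont_add X f g : LCont X f -> LCont X g -> LCont X (fun t x => f t x + g t x).
Proof. by move=> cf cg t x Xx; apply: cvgD; [exact: cf|exact: cg]. Qed.

Lemma LCont_mul X f g : LCont X f -> LCont X g -> LCont X (fun t x => f t x * g t x).
Proof. by move=> cf cg t x Xx; apply: cvgM; [exact: cf|exact: cg]. Qed.

Lemma LCont_x X (v : R -> R) : continuous v -> LCont X (fun t x => v x).
Proof. by move=> cv t x _; exact: (continuous_snd_comp cv). Qed.

Lemma LCont_t X (v : R -> R) : {within `[A, b], continuous v} -> LCont X (fun t x => v t).
Proof. by move=> /(within_clamp Ab') cv t x _; exact: (continuous_fst_comp cv). Qed.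

Lemma LCont_sum X (I : Type) (s : seq I) (P : pred I) (f : I -> R -> R -> R) :
  (forall i, LCont X (f i)) -> LCont X (fun t x => \sum_(i <- s | P i) f i t x).
Proof.
move=> cf; elim: s => [|i s ih].
  rewrite [X in LCont _ X](_ : _ = fun=> fun=> 0).
    by apply: (@LCont_x X (cst 0)) => x; exact: cvg_cst.
  by apply/funext => t; apply/funext => x; rewrite big_nil.
case Pi : (P i).
  rewrite [X in LCont _ X](_ : _ = fun t x => f i t x + \sum_(i <- s | P i) f i t x).
    exact: LCont_add.
  by apply/funext => t; apply/funext => x; rewrite big_cons Pi.
rewrite [X in LCont _ X](_ : _ = fun t x => \sum_(i <- s | P i) f i t x)//.
by apply/funext => t; apply/funext => x; rewrite big_cons Pi.
Qed.

Lemma continuous_rsq (q : R) : 0 < q -> {for q, continuous (@rsq R)}.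
Proof.
move=> q0; apply: cvgV; first by rewrite mulf_neq0// gt_eqF// sqrtr_gt0.
by apply: cvgM; [exact: cvg_cst|exact: sqrt_continuous].
Qed.

Lemma LCont_rsq X q : LCont X q -> (forall x t, X x -> t \in `[A, b] -> 0 < q t x) ->
  LCont X (fun t x => rsq (q t x)).
Proof.
move=> cq q0 t x Xx.
apply: (@continuous_comp _ _ _ (fun p : R * R => q (clamp A b p.1) p.2) (@rsq R)).
  exact: cq.
by apply: continuous_rsq; apply: q0 => //; exact: clamp_in.
Qed.

Lemma LRep_add X l m : LRep X l -> LRep X m -> LRep X (fun t x V => l t x V + m t x V).
Proof.
move=> [c cc lc] [d cd md]; exists (fun k t x => c k t x + d k t x).
  by move=> k; exact: LCont_add.
by move=> t x V; rewrite lc md -big_split; apply: eq_bigr => k _; rewrite mulrDl.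
Qed.

Lemma LRep_mul X f l : LCont X f -> LRep X l -> LRep X (fun t x V => f t x * l t x V).
Proof.
move=> cf [c cc lc]; exists (fun k t x => f t x * c k t x).
  by move=> k; exact: LCont_mul.
by move=> t x V; rewrite lc mulr_sumr; apply: eq_bigr => k _; rewrite mulrA.
Qed.

Lemma continuous_bounded (u v : R) (f : R -> R) : {within `[u, v], continuous f} ->
  exists2 C, 0 <= C & forall x, x \in `[u, v] -> `|f x| <= C.
Proof.
move=> cf; have /compact_bounded[K [_ HK]] : compact (f @` `[u, v]).
  by apply: continuous_compact => //; exact: segment_compact.
exists (`|K| + 1) => [|x xI]; first by rewrite addr_ge0.
by apply: (HK (`|K| + 1)); [rewrite (le_lt_trans (ler_norm _))// ltrDl|exists x].
Qed.

Lemma continuous_bounded_fin (T : finType) (u v : R) (f : T -> R -> R) : (forall k, continuous (f k)) ->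
  exists2 C, 0 <= C & forall k x, x \in `[u, v] -> `|f k x| <= C.
Proof.
move=> cf; have /choice[C HC] : forall k, exists C, 0 <= C /\ forall x, x \in `[u, v] -> `|f k x| <= C.
  move=> k; have [|C C0 HC] := @continuous_bounded u v (f k); last by exists C.
  exact: continuous_subspaceT.
exists (\sum_k C k); first by apply: sumr_ge0 => k _; have [] := HC k.
move=> k x xI; apply: le_trans ((HC k).2 x xI) _.
by rewrite (bigD1 k)//= lerDl sumr_ge0// => i _; have [] := HC i.
Qed.

(** The common shape of u, of its central differences and of their alpha-derivatives at a node: v
    comes from u_0 and the coefficients [be] from the basis functions. *)
Definition affine_form (v : R -> R) (be : node -> R -> R) (G : E) (t x : R) (W : E) :=
  v x + \sum_k be k x * (comp W k t + comp G k t).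
Definition linear_form (be : node -> R -> R) (t x : R) (V : E) := \sum_k be k x * comp V k t.

Lemma C11_tx_affine X v be : continuous v -> (forall k, continuous (be k)) ->
  C11_tx X (affine_form v be) (fun G t x W => linear_form be t x).
Proof.
move=> cv cb; split; last first.
  move=> G W gG SW; split; last first.
    by exists (fun k t x => be k x) => // k; exact: LCont_x.
  apply: LCont_add; first exact: LCont_x.
  apply: LCont_sum => k; apply: LCont_mul; first exact: LCont_x.
  apply: LCont_add; apply: LCont_t; last by have [] := gG.
  exact: (H1_cont sigma_gt0 (S_H1 SW)).
have [C1 C10 HC1] := @continuous_bounded 0 1 v (continuous_subspaceT cv).
have [C2 C20 HC2] := @continuous_bounded_fin _ 0 1 be cb.
have K0 : 0 <= \sum_(k : node) C2 * (M + MG).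
  by apply: sumr_ge0 => k _; rewrite mulr_ge0// addr_ge0.
exists (C1 + \sum_(k : node) C2 * (M + MG) + C2) => G t x gG tI xI.
apply: C11_lin.
- exact: S_sub.
- by move=> V _; exact: ptnorm_ge0.
- by rewrite !addr_ge0.
- move=> W SW; apply: le_trans (_ : _ <= C1 + \sum_(k : node) C2 * (M + MG)) _; last by rewrite lerDl.
  apply: le_trans (ler_normD _ _) _; rewrite lerD ?HC1//.
  apply: le_trans (ler_norm_sum _ _ _) _; apply: ler_sum => k _.
  rewrite normrM ler_pM ?HC2//; apply: le_trans (ler_normD _ _) _.
  by rewrite lerD ?(S_M _ SW)//; have [_] := gG; exact.
- move=> V _; apply: le_trans (ler_norm_sum _ _ _) _.
  apply: (@le_trans _ _ (C2 * ptnorm t V)); last by rewrite ler_wpM2r ?ptnorm_ge0// lerDr addr_ge0.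
  by rewrite /ptnorm mulr_sumr; apply: ler_sum => k _; rewrite normrM ler_wpM2r// HC2.
- move=> W W2 _ _; rewrite /affine_form /linear_form opprD addrACA subrr add0r -sumrB.
  apply: eq_bigr => k _; rewrite -mulrBr; congr (_ * _).
  by rewrite opprD addrACA subrr addr0 /comp !fctE !mxE.
Qed.

Lemma C11_tx_add X f df g dg : C11_tx X f df -> C11_tx X g dg ->
  C11_tx X (fun G t x W => f G t x W + g G t x W) (fun G t x W V => df G t x W V + dg G t x W V).
Proof.
move=> [[C hC] hf] [[D hD] hg]; split.
  exists (C + D) => G t x gG tI xI.
  by apply: C11_add; [exact: hC|exact: hD].
move=> G W gG SW; have [h1 h2] := hf _ _ gG SW; have [k1 k2] := hg _ _ gG SW; split.
- exact: LCont_add.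
- exact: LRep_add.
Qed.

Lemma C11_tx_mul X f df g dg : C11_tx X f df -> C11_tx X g dg ->
  C11_tx X (fun G t x W => f G t x W * g G t x W)
    (fun G t x W V => df G t x W V * g G t x W + f G t x W * dg G t x W V).
Proof.
move=> [[C hC] hf] [[D hD] hg]; split.
  exists (4 * (C * D)) => G t x gG tI xI.
  apply: C11_mul; [exact: S_sub|by move=> V _; exact: ptnorm_ge0|exact: hC|exact: hD].
move=> G W gG SW; have [h1 h2] := hf _ _ gG SW; have [k1 k2] := hg _ _ gG SW; split.
- exact: LCont_mul.
- apply: LRep_add; last exact: LRep_mul.
  have := LRep_mul k1 h2; congr LRep; apply/funext => t; apply/funext => x; apply/funext => V.
  by rewrite mulrC.
Qed.

Lemma C11_tx_scale X c f df : C11_tx X f df ->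
  C11_tx X (fun G t x W => c * f G t x W) (fun G t x W V => c * df G t x W V).
Proof.
move=> [[C hC] hf]; split.
  by exists (`|c| * C) => G t x gG tI xI; apply: C11_scale; exact: hC.
have cc Y : LCont Y (fun _ _ => c) by apply: (@LCont_x Y (cst c)) => x; exact: cvg_cst.
move=> G W gG SW; have [h1 h2] := hf _ _ gG SW; split.
- exact: LCont_mul.
- exact: LRep_mul.
Qed.

(** The lower bound c on [0, 1] yields the uniform constants, while positivity on the set X yields
    continuity there. *)
Lemma C11_tx_rsq X c q dq : 0 < c -> C11_tx X q dq ->
  (forall G W t x, S G W -> t \in `[A, b] -> x \in `[0, 1] -> c <= q G t x W) ->
  (forall G W t x, S G W -> X G W x -> t \in `[A, b] -> 0 < q G t x W) ->
  C11_tx X (fun G t x W => rsq (q G t x W)) (fun G t x W V => drsq (q G t x W) * dq G t x W V).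
Proof.
move=> c0 [[C hC] hq] qc q0; split.
  have [K K0 [k1 k2]] := rsq_C11 c0.
  exists (K * (1 + C + C ^+ 2)) => G t x gG tI xI.
  apply: (C11_comp _ _ K0 k1 k2) => //.
  - exact: S_sub.
  - by move=> V _; exact: ptnorm_ge0.
  - by move=> W SW; exact: qc.
  - exact: hC.
move=> G W gG SW; have [h1 h2] := hq _ _ gG SW.
have cr : LCont (X G W) (fun t x => rsq (q G t x W)).
  by apply: LCont_rsq => // x t Xx tI; exact: q0.
split => //; apply: LRep_mul => //; rewrite /drsq.
apply: LCont_mul; first by apply: (@LCont_x _ (cst (- 2))) => x; exact: cvg_cst.
have := LCont_mul cr (LCont_mul cr cr).
by congr LCont; apply/funext => t; apply/funext => x; rewrite !exprS expr0 mulr1.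
Qed.

End Pointwise.

(** * Bounds by the L_2 norm, and linear forms depending on height and alpha *)

Section Rectangle.
Context {R : realType}.
Notation mu := (@lebesgue_measure R).
Variables (A sigma h : R) (N B : nat).
Hypotheses (sigma_gt0 : 0 < sigma) (h_gt0 : 0 < h).
Local Notation b := (A + sigma).
Local Notation E := (semidiscrete R N B).
Local Notation node := (node N B).
Local Notation H1 := (@H1_0 R A sigma N B).
Local Notation nL2 := (@normL2 R A sigma h N B).
Local Notation cl := (clamp A b).
Local Notation cl1 := (clamp (0 : R) 1).

Let Ab : A < b. Proof. by rewrite ltrDl. Qed.
Let Ab' : A <= b. Proof. exact: ltW. Qed.

Lemma nL2_ge0 V : 0 <= nL2 V. Proof. exact: sqrtr_ge0. Qed.

Lemma sub_zb z : z \in `[A, b] -> `[z, b] `<=` `[A, b].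
Proof. by rewrite in_itv/= => /andP[Az _]; apply: subset_itvr; rewrite bnd_simp. Qed.

Lemma itg_sub z f : z \in `[A, b] -> mu.-integrable `[A, b] (EFin \o f) ->
  mu.-integrable `[z, b] (EFin \o f).
Proof. by move=> zI fi; apply: integrableS fi => //; exact: sub_zb. Qed.

Lemma Rint_sub z (f : R -> R) : z \in `[A, b] -> mu.-integrable `[A, b] (EFin \o f) ->
  (forall t, 0 <= f t) -> \int[mu]_(t in `[z, b]) f t <= \int[mu]_(t in `[A, b]) f t.
Proof.
move=> zI fi f0; rewrite (Rint_split zI fi) lerDr.
by apply: Rintegral_ge0.
Qed.

Lemma ptnorm_itg V z : H1 V -> z \in `[A, b] -> mu.-integrable `[z, b] (EFin \o (fun t => ptnorm t V)).
Proof.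
move=> HV zI; apply: itg_sub => //; apply: itg_sum => k _.
by apply: L2c_int; apply: L2c_norm; exact: (H1_L2c sigma_gt0).
Qed.

Lemma ptnorm2_itg V V2 z : H1 V -> H1 V2 -> z \in `[A, b] ->
  mu.-integrable `[z, b] (EFin \o (fun t => ptnorm t V * ptnorm t V2)).
Proof.
move=> HV HV2 zI; apply: itg_sub => //.
apply: (@itg_eq _ _ _ (fun t => \sum_k \sum_l `|comp V k t| * `|comp V2 l t|)).
  by move=> t _; rewrite /ptnorm big_distrlr.
apply: itg_sum => k _; apply: itg_sum => l _.
by apply: L2c_mul; apply: L2c_norm; exact: (H1_L2c sigma_gt0).
Qed.

(** One constant for the three size conditions of [C11_int]: the length of the interval, the
    integral of [ptnorm], and the integral of a product of two such seminorms. *)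
Definition Knorm : R := sigma + (\sum_(k : node) Num.sqrt sigma * h^-1) + (\sum_(k : node) \sum_(l : node) h^-1 * h^-1).

Lemma Knorm_parts : [/\ 0 <= Knorm, sigma <= Knorm, (\sum_(k : node) Num.sqrt sigma * h^-1) <= Knorm &
  (\sum_(k : node) \sum_(l : node) h^-1 * h^-1) <= Knorm].
Proof.
have h0 : 0 <= h^-1 by rewrite invr_ge0 ltW.
have a0 : 0 <= \sum_(k : node) Num.sqrt sigma * h^-1.
  by apply: sumr_ge0 => k _; rewrite mulr_ge0// sqrtr_ge0.
have b0 : 0 <= \sum_(k : node) \sum_(l : node) h^-1 * h^-1.
  by apply: sumr_ge0 => k _; apply: sumr_ge0 => l _; rewrite mulr_ge0.
have s0 := ltW sigma_gt0.
by rewrite /Knorm; split; lra.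
Qed.

(** A tail integral of a nonnegative function is at most the full one, so Cauchy-Schwarz at each
    node gives a bound uniform in z. *)
Lemma ptnorm_int V z : H1 V -> z \in `[A, b] -> \int[mu]_(t in `[z, b]) ptnorm t V <= Knorm * nL2 V.
Proof.
move=> HV zI; have [_ _ k2 _] := Knorm_parts.
have AI : A \in `[A, b] by rewrite in_itv/= lexx.
apply: le_trans (Rint_sub zI (ptnorm_itg HV AI) (fun t => ptnorm_ge0 _ _)) _.
have i1 k : L2c A b (comp V k) by exact: (H1_L2c sigma_gt0).
rewrite Rint_sum; last by move=> k _; apply: L2c_int; exact: L2c_norm.
apply: le_trans (ler_wpM2r (nL2_ge0 V) k2); rewrite mulr_suml; apply: ler_sum => k _.
apply: le_trans (L2_norm1 Ab (i1 k)) _.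
rewrite (_ : b - A = sigma); last by ring.
by rewrite -mulrA ler_wpM2l ?sqrtr_ge0// (nrm_comp_L2 sigma_gt0 h_gt0).
Qed.

Lemma ptnorm2_int V V2 z : H1 V -> H1 V2 -> z \in `[A, b] ->
  \int[mu]_(t in `[z, b]) (ptnorm t V * ptnorm t V2) <= Knorm * (nL2 V * nL2 V2).
Proof.
move=> HV HV2 zI; have [_ _ _ k2] := Knorm_parts.
have AI : A \in `[A, b] by rewrite in_itv/= lexx.
apply: le_trans (Rint_sub zI (ptnorm2_itg HV HV2 AI) (fun t => _)) _.
  by move=> t; rewrite mulr_ge0 ?ptnorm_ge0.
have i1 U k : H1 U -> L2c A b (comp U k) by move=> HU; exact: (H1_L2c sigma_gt0).
have -> : \int[mu]_(t in `[A, b]) (ptnorm t V * ptnorm t V2) =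
   \int[mu]_(t in `[A, b]) (\sum_k \sum_l `|comp V k t| * `|comp V2 l t|).
  by apply: eq_Rintegral => t _; rewrite /ptnorm big_distrlr.
have ii k l : mu.-integrable `[A, b] (EFin \o (fun t => `|comp V k t| * `|comp V2 l t|)).
  by apply: L2c_mul; apply: L2c_norm; exact: i1.
rewrite Rint_sum; last by move=> k _; apply: itg_sum => l _; exact: ii.
apply: le_trans (ler_wpM2r (mulr_ge0 (nL2_ge0 V) (nL2_ge0 V2)) k2).
rewrite mulr_suml; apply: ler_sum => k _.
rewrite Rint_sum; last by move=> l _; exact: ii.
rewrite mulr_suml; apply: ler_sum => l _.
apply: le_trans (L2_norm2 (i1 _ k HV) (i1 _ l HV2)) _.
by rewrite mulrACA ler_pM ?(nrm_comp_L2 sigma_gt0 h_gt0) ?sqrtr_ge0.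
Qed.

(* Continuity on the rectangle [A, A + sigma] x [0, 1]: composing with [clamp] makes the values
   outside of it irrelevant. *)
Definition CR2 (f : R -> R -> R) := continuous (fun p : R * R => f (cl p.1) (cl1 p.2)).

Lemma clI t : cl t \in `[A, b]. Proof. exact: clamp_in. Qed.
Lemma cl1I x : cl1 x \in `[0, 1]. Proof. exact: clamp_in. Qed.

Lemma CR2_eq f g : (forall z x, z \in `[A, b] -> x \in `[0, 1] -> f z x = g z x) -> CR2 f -> CR2 g.
Proof.
move=> fg; rewrite /CR2 (_ : (fun p : R * R => f (cl p.1) (cl1 p.2)) = (fun p : R * R => g (cl p.1) (cl1 p.2)))//.
by apply/funext => p; rewrite fg// ?clI ?cl1I.
Qed.

Lemma CR2_add f g : CR2 f -> CR2 g -> CR2 (fun z x => f z x + g z x).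
Proof. by move=> cf cg p; apply: cvgD; [exact: cf|exact: cg]. Qed.

Lemma CR2_mul f g : CR2 f -> CR2 g -> CR2 (fun z x => f z x * g z x).
Proof. by move=> cf cg p; apply: cvgM; [exact: cf|exact: cg]. Qed.

Lemma CR2_z (f : R -> R) : continuous (f \o cl) -> CR2 (fun z _ => f z).
Proof. by move=> cf; exact: (continuous_fst_comp cf). Qed.

Lemma CR2_x (f : R -> R) : continuous f -> CR2 (fun _ x => f x).
Proof.
move=> cf; apply: (continuous_snd_comp (f := f \o cl1)) => x.
by apply: continuous_comp; [exact: continuous_clamp|exact: cf].
Qed.

Lemma CR2_cst (c : R) : CR2 (fun _ _ => c).
Proof. by move=> p; exact: cvg_cst. Qed.

Lemma CR2_contz f (x : R) : CR2 f -> x \in `[0, 1] -> continuous (fun z : R => f (cl z) x).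
Proof. by move=> cf xI; have := continuous_fst_snd (x := x) cf; rewrite /= (clamp_id xI). Qed.

Lemma CR2_contx f (z : R) : CR2 f -> z \in `[A, b] -> continuous (fun x : R => f z (cl1 x)).
Proof. by move=> cf zI; have := continuous_snd_fst (x := z) cf; rewrite /= (clamp_id zI). Qed.

Lemma CR2_itgz f (x : R) : CR2 f -> x \in `[0, 1] -> mu.-integrable `[A, b] (EFin \o (fun z => f z x)).
Proof.
move=> cf xI; apply: (@itg_eq _ _ _ (fun z => f (cl z) x)).
  by move=> z zI; rewrite (clamp_id zI).
exact: continuous_integrable (CR2_contz cf xI).
Qed.

Lemma CR2_itgx f (z : R) : CR2 f -> z \in `[A, b] -> mu.-integrable `[0, 1] (EFin \o (fun x => f z x)).
Proof.
move=> cf zI; apply: (@itg_eq _ _ _ (fun x => f z (cl1 x))).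
  by move=> x xI; rewrite (clamp_id xI).
exact: continuous_integrable (CR2_contx cf zI).
Qed.

Lemma CR2_int01 f : CR2 f -> continuous ((fun z => \int[mu]_(x in `[0, 1]) f z x) \o cl).
Proof.
move=> cf; have := cont_int_full ler01 (continuous_swap cf).
set g := (X in continuous X -> _); suff -> : g = ((fun z => \int[mu]_(x in `[0, 1]) f z x) \o cl) by [].
apply/funext => z /=; apply: eq_Rintegral => x; rewrite inE => xI /=.
by rewrite (clamp_id xI).
Qed.

Lemma H1_clcont V k : H1 V -> continuous (comp V k \o cl).
Proof. by move=> HV; apply: within_clamp => //; exact: (H1_cont sigma_gt0). Qed.

Lemma CR2_intzb f : CR2 f -> CR2 (fun z x => \int[mu]_(t in `[z, b]) f t x).
Proof.
move=> cf; have H p : \int[mu]_(t in `[cl p.1, b]) f t (cl1 p.2) =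
   \int[mu]_(t in `[cl p.1, b]) f (cl t) (cl1 p.2).
  apply: eq_Rintegral => t; rewrite inE => /(sub_zb (clI _)) tI.
  by rewrite (clamp_id tI).
rewrite /CR2; under eq_fun do rewrite H.
exact: (cont_int_r Ab' cf).
Qed.

Lemma CR2_intAz f : CR2 f -> CR2 (fun z x => \int[mu]_(t in `[A, z]) f t x).
Proof.
move=> cf; have H p : \int[mu]_(t in `[A, cl p.1]) f t (cl1 p.2) =
   \int[mu]_(t in `[A, cl p.1]) f (cl t) (cl1 p.2).
  apply: eq_Rintegral => t; rewrite inE/= in_itv/= => /andP[At tz].
  have tI : t \in `[A, b].
    by rewrite in_itv/= At (le_trans tz)//; have := clI p.1; rewrite in_itv/= => /andP[].
  by rewrite (clamp_id tI).
rewrite /CR2; under eq_fun do rewrite H.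
exact: (cont_int_l Ab' cf).
Qed.

(* Keeping derivatives as sums of integrals against continuous kernels is what allows [riesz]
   to represent them without the completeness of H^1_0. *)
Inductive GRep : (R -> R -> E -> R) -> Prop :=
| GRep_base k c q : CR2 c -> CR2 q ->
    GRep (fun z x V => c z x * \int[mu]_(t in `[z, b]) (q t x * comp V k t))
| GRep0 : GRep (fun _ _ _ => 0)
| GRepD l m : GRep l -> GRep m -> GRep (fun z x V => l z x V + m z x V)
| GRep_eq l m : (forall z x V, z \in `[A, b] -> x \in `[0, 1] -> H1 V -> l z x V = m z x V) ->
    GRep l -> GRep m.

Lemma GRep_mul f l : CR2 f -> GRep l -> GRep (fun z x V => f z x * l z x V).
Proof.
move=> cf; elim=> [k c q cc cq| |{}l m _ ihl _ ihm|{}l m lm _ ih].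
- apply: (@GRep_eq (fun z x V => (f z x * c z x) * \int[mu]_(t in `[z, b]) (q t x * comp V k t))).
    by move=> *; rewrite mulrA.
  by apply: GRep_base => //; exact: CR2_mul.
- by apply: GRep_eq GRep0 => *; rewrite mulr0.
- by apply: GRep_eq (GRepD ihl ihm) => *; rewrite mulrDr.
- by apply: GRep_eq ih => z x V zI xI HV; rewrite lm.
Qed.

Lemma GRep_sum (I : Type) (s : seq I) (l : I -> R -> R -> E -> R) :
  (forall i, GRep (l i)) -> GRep (fun z x V => \sum_(i <- s) l i z x V).
Proof.
move=> hl; elim: s => [|i s ih].
  by apply: GRep_eq GRep0 => *; rewrite big_nil.
by apply: GRep_eq (GRepD (hl i) ih) => *; rewrite big_cons.
Qed.

Lemma GRep_cont l V : H1 V -> GRep l -> CR2 (fun z x => l z x V).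
Proof.
move=> HV; elim=> [k c q cc cq| |{}l m _ ihl _ ihm|{}l m lm _ ih].
- apply: CR2_mul => //; apply: CR2_intzb; apply: CR2_mul => //.
  by apply: CR2_z; exact: H1_clcont.
- exact: CR2_cst.
- exact: CR2_add.
- by apply: CR2_eq ih => z x zI xI; rewrite lm.
Qed.

End Rectangle.

(** * Linear functionals with continuous kernels *)

Section Representation.
Context {R : realType}.
Notation mu := (@lebesgue_measure R).
Variables (A sigma h : R) (N B : nat).
Hypotheses (sigma_gt0 : 0 < sigma) (h_gt0 : 0 < h).
Local Notation b := (A + sigma).
Local Notation E := (semidiscrete R N B).
Local Notation node := (node N B).
Local Notation H1 := (@H1_0 R A sigma N B).
Local Notation nL2 := (@normL2 R A sigma h N B).
Local Notation cl := (clamp A b).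
Local Notation cl1 := (clamp (0 : R) 1).
Local Notation CR2 := (@CR2 R A sigma).
Local Notation GRep := (@GRep R A sigma N B).
Local Notation clI := (@clI R A sigma sigma_gt0).

Let Ab : A < b. Proof. by rewrite ltrDl. Qed.
Let Ab' : A <= b. Proof. exact: ltW. Qed.

(** An L_2 pairing with continuous kernels, the right-hand sides that [green_function] accepts. *)
Definition FRep (l : E -> R) := exists2 p : node -> R -> R, forall k, continuous (p k) &
  forall V, H1 V -> l V = \sum_k \int[mu]_(t in `[A, b]) (p k t * comp V k t).

Lemma cont_cl (f : R -> R) : continuous (f \o cl) -> mu.-integrable `[A, b] (EFin \o f).
Proof.
move=> cf; apply: (@itg_eq _ _ _ (f \o cl)); last exact: continuous_integrable.
by move=> t tI; rewrite /= (clamp_id tI).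
Qed.

Lemma pV_itg (p : R -> R) V k : continuous p -> H1 V -> mu.-integrable `[A, b] (EFin \o (fun t => p t * comp V k t)).
Proof.
move=> cp HV; apply: cont_cl => t; apply: cvgM; last exact: (H1_clcont sigma_gt0).
by apply: (@continuous_comp _ _ _ cl p); [exact: continuous_clamp|exact: cp].
Qed.

Lemma FRep_eq l m : (forall V, H1 V -> l V = m V) -> FRep l -> FRep m.
Proof. by move=> lm [p cp lp]; exists p => // V HV; rewrite -lm// lp. Qed.

Lemma FRep0 : FRep (fun=> 0).
Proof.
exists (fun=> cst 0) => [k x|V HV]; first exact: cvg_cst.
rewrite big1// => k _; under eq_Rintegral do rewrite mul0r.
by rewrite Rintegral_cst// mul0r.
Qed.

Lemma FRep_add l m : FRep l -> FRep m -> FRep (fun V => l V + m V).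
Proof.
move=> [p cp lp] [q cq lq]; exists (fun k t => p k t + q k t).
  by move=> k t; apply: cvgD; [exact: cp|exact: cq].
move=> V HV; rewrite lp// lq// -big_split; apply: eq_bigr => k _.
rewrite /= -RintegralD//; [|exact: pV_itg..].
by apply: eq_Rintegral => t _; rewrite mulrDl.
Qed.

Lemma FRep_scale c l : FRep l -> FRep (fun V => c * l V).
Proof.
move=> [p cp lp]; exists (fun k t => c * p k t).
  by move=> k t; apply: cvgM; [exact: cvg_cst|exact: cp].
move=> V HV; rewrite lp// mulr_sumr; apply: eq_bigr => k _.
rewrite -RintegralZl//; last exact: pV_itg.
by apply: eq_Rintegral => t _; rewrite mulrA.
Qed.

Lemma FRep_sum (I : Type) (s : seq I) (P : pred I) (l : I -> E -> R) :
  (forall i, P i -> FRep (l i)) -> FRep (fun V => \sum_(i <- s | P i) l i V).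
Proof.
move=> hl; elim: s => [|i s ih].
  by apply: FRep_eq FRep0 => V _; rewrite big_nil.
case Pi : (P i); last by apply: FRep_eq ih => V _; rewrite big_cons Pi.
by apply: FRep_eq (FRep_add (hl i Pi) ih) => V _; rewrite big_cons Pi.
Qed.

Lemma FRep_comp k (e : R -> R) : continuous e ->
  FRep (fun V => \int[mu]_(t in `[A, b]) (e t * comp V k t)).
Proof.
move=> ce; exists (fun l => if l == k then e else cst 0).
  by move=> l; case: ifP => // _ x; exact: cvg_cst.
move=> V HV; rewrite (bigD1 k)//= eqxx big1 ?addr0// => l lk.
rewrite (negPf lk); under eq_Rintegral do rewrite mul0r.
by rewrite Rintegral_cst// mul0r.
Qed.

Lemma CR2_fubini f : CR2 f ->
  \int[mu]_(z in `[A, b]) \int[mu]_(x in `[0, 1]) f z x =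
  \int[mu]_(x in `[0, 1]) \int[mu]_(z in `[A, b]) f z x.
Proof.
move=> cf; have := Rfubini_cont Ab' ler01 cf => /= e.
transitivity (\int[mu]_(x in `[A, b]) \int[mu]_(y in `[0, 1]) f (cl x) (cl1 y)).
  apply: eq_Rintegral => z; rewrite inE => zI; apply: eq_Rintegral => x; rewrite inE => xI.
  by rewrite (clamp_id xI) (clamp_id zI).
rewrite e; apply: eq_Rintegral => z; rewrite inE => zI; apply: eq_Rintegral => x; rewrite inE => xI.
by rewrite (clamp_id xI) (clamp_id zI).
Qed.

(** Exchanging z with x, then z with t over the triangle z <= t, then x with t, puts the test
    function outermost. Its kernel is the integral over x of q times [K], where [K t x] collects the
    weights e c over the heights z <= t. *)
Lemma FRep_triple k (e : R -> R) c q : continuous e -> CR2 c -> CR2 q ->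
  FRep (fun V => \int[mu]_(z in `[A, b]) (e z *
     \int[mu]_(x in `[0, 1]) (c z x * \int[mu]_(t in `[z, b]) (q t x * comp V k t)))).
Proof.
move=> ce cc cq.
have cecl : continuous (e \o cl).
  by move=> t; apply: continuous_comp; [exact: continuous_clamp|exact: ce].
pose ec z x := e z * c z x.
have cec : CR2 ec by apply: CR2_mul => //; exact: CR2_z.
pose K t x := \int[mu]_(z in `[A, t]) ec z x.
have cK : CR2 K by exact: CR2_intAz.
have cqK : CR2 (fun t x => q t x * K t x) by exact: CR2_mul.
apply: FRep_eq (@FRep_comp k ((fun t => \int[mu]_(x in `[0, 1]) (q t x * K t x)) \o cl) (CR2_int01 cqK)).
move=> V HV; apply/esym.
pose v := comp V k.
have cv : CR2 (fun t _ => v t) by apply: CR2_z; exact: (H1_clcont sigma_gt0).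
pose Q z x := \int[mu]_(t in `[z, b]) (q t x * v t).
have cQ : CR2 Q by apply: (CR2_intzb sigma_gt0); exact: CR2_mul.
transitivity (\int[mu]_(z in `[A, b]) \int[mu]_(x in `[0, 1]) (ec z x * Q z x)).
  apply: eq_Rintegral => z; rewrite inE => zI.
  rewrite -RintegralZl//; first by apply: eq_Rintegral => x _; rewrite mulrA.
  by apply: (@CR2_itgx _ A sigma (fun z x => c z x * Q z x) z _ zI); exact: CR2_mul.
rewrite CR2_fubini; last exact: CR2_mul.
transitivity (\int[mu]_(x in `[0, 1]) \int[mu]_(t in `[A, b]) (q t x * K t x * v t)).
  apply: eq_Rintegral => x; rewrite inE => xI.
  have c1 : continuous (fun z => ec (cl z) x) := CR2_contz cec xI.
  have c2 : continuous (fun t => q (cl t) x * v (cl t)) := CR2_contz (CR2_mul cq cv) xI.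
  have := Rfubini_triangle Ab' (continuous_measurable_fun c1) (continuous_measurable_fun c2)
    (continuous_integrable A b c1) (continuous_integrable A b c2) => T.
  transitivity (\int[mu]_(z in `[A, b]) (ec (cl z) x * \int[mu]_(s in `[z, b]) (q (cl s) x * v (cl s)))).
    apply: eq_Rintegral => z; rewrite inE => zI; rewrite (clamp_id zI); congr (_ * _).
    apply: eq_Rintegral => t; rewrite inE => /(sub_zb zI) tI.
    by rewrite (clamp_id tI).
  rewrite T; apply: eq_Rintegral => t; rewrite inE => tI; rewrite (clamp_id tI).
  rewrite mulrAC; congr (_ * _ * _); apply: eq_Rintegral => z; rewrite inE/= in_itv/= => /andP[Az zt].
  have zI : z \in `[A, b].
    by rewrite in_itv/= Az (le_trans zt)//; move: tI; rewrite /= in_itv/= => /andP[].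
  by rewrite (clamp_id zI).
rewrite -CR2_fubini; last exact: CR2_mul.
apply: eq_Rintegral => t; rewrite inE => tI; rewrite /= (clamp_id tI) RintegralZr//.
exact: (CR2_itgx cqK tI).
Qed.

(** The derivative of the residual at height z involves V at that height, an evaluation without a
    kernel; a pairing appears only after integration against a continuous weight e. In the
    functional this weight is twice the residual times the square of the exponential. *)
Definition ZRep (l : R -> E -> R) :=
  (forall V, H1 V -> continuous ((fun z => l z V) \o cl)) /\
  forall e : R -> R, continuous e -> FRep (fun V => \int[mu]_(z in `[A, b]) (e z * l z V)).

Lemma e_itg (e f : R -> R) : continuous e -> continuous (f \o cl) ->
  mu.-integrable `[A, b] (EFin \o (fun z => e z * f z)).
Proof.
move=> ce cf; apply: cont_cl => t; apply: cvgM; last exact: cf.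
by apply: (@continuous_comp _ _ _ cl e); [exact: continuous_clamp|exact: ce].
Qed.

Lemma ZRep_add l m : ZRep l -> ZRep m -> ZRep (fun z V => l z V + m z V).
Proof.
move=> [cl_ rl] [cm rm]; split.
  by move=> V HV t; apply: cvgD; [exact: cl_|exact: cm].
move=> e ce; apply: FRep_eq (FRep_add (rl e ce) (rm e ce)) => V HV.
rewrite -RintegralD//.
- by apply: eq_Rintegral => z _; rewrite mulrDr.
- by apply: e_itg => //; exact: cl_.
- by apply: e_itg => //; exact: cm.
Qed.

Lemma ZRep_scale c l : ZRep l -> ZRep (fun z V => c * l z V).
Proof.
move=> [cl_ rl]; split.
  by move=> V HV t; apply: cvgM; [exact: cvg_cst|exact: cl_].
move=> e ce; apply: FRep_eq (FRep_scale c (rl e ce)) => V HV.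
rewrite -RintegralZl//; first by apply: eq_Rintegral => z _; rewrite mulrCA.
by apply: e_itg => //; exact: cl_.
Qed.

Lemma ZRep_comp k : ZRep (fun z V => comp V k z).
Proof.
split; first by move=> V HV; exact: (H1_clcont sigma_gt0).
by move=> e ce; exact: FRep_comp.
Qed.

Lemma GRep_ZRep l : GRep l -> ZRep (fun z V => \int[mu]_(x in `[0, 1]) l z x V).
Proof.
move=> gl; split; first by move=> V HV; apply: CR2_int01; exact: (GRep_cont sigma_gt0 HV gl).
move=> e ce; elim: gl => [k c q cc cq| |{}l m gl ihl gm ihm|{}l m lm gl ih].
- exact: FRep_triple.
- apply: FRep_eq FRep0 => V _; apply/esym.
  under eq_Rintegral do rewrite Rintegral_cst// mul0r mulr0.
  by rewrite Rintegral_cst// mul0r.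
- apply: FRep_eq (FRep_add ihl ihm) => V HV.
  have cl_ := GRep_cont sigma_gt0 HV gl; have cm := GRep_cont sigma_gt0 HV gm.
  rewrite -RintegralD//; [|by apply: e_itg => //; exact: CR2_int01..].
  apply: eq_Rintegral => z; rewrite inE => zI; rewrite -mulrDr RintegralD//.
  + exact: (CR2_itgx cl_ zI).
  + exact: (CR2_itgx cm zI).
- apply: FRep_eq ih => V HV; apply: eq_Rintegral => z; rewrite inE => zI; congr (_ * _).
  by apply: eq_Rintegral => x; rewrite inE => xI; exact: lm.
Qed.

End Representation.

(** * From integrands to the functional: bounds after each integration *)

Section Nonlocal.
Context {R : realType}.
Notation mu := (@lebesgue_measure R).
Variables (A sigma h : R) (N B : nat).
Hypotheses (sigma_gt0 : 0 < sigma) (h_gt0 : 0 < h).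
Local Notation b := (A + sigma).
Local Notation E := (semidiscrete R N B).
Local Notation node := (node N B).
Local Notation H1 := (@H1_0 R A sigma N B).
Local Notation nL2 := (@normL2 R A sigma h N B).
Local Notation cl := (clamp A b).
Local Notation cl1 := (clamp (0 : R) 1).
Local Notation CR2 := (@CR2 R A sigma).
Local Notation GRep := (@GRep R A sigma N B).
Local Notation ZRep := (@ZRep R A sigma N B).
Local Notation FRep := (@FRep R A sigma N B).
Local Notation clI := (@clI R A sigma sigma_gt0).
Variables (M MG MF : R) (S : E -> set E).
Hypotheses (MF_ge0 : 0 <= MF).
Hypothesis S_H1 : forall G W, S G W -> H1 W.
Hypothesis S_M : forall G W x t, S G W -> t \in `[A, b] -> `|comp W x t| <= M.
Local Notation admissible := (@admissible R A sigma N B MG).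
Implicit Types (F : grid_vec R N B).

Let Ab : A < b. Proof. by rewrite ltrDl. Qed.
Let Ab' : A <= b. Proof. exact: ltW. Qed.
Let SS G := @S_sub R A sigma N B sigma_gt0 S S_H1 G.
Let nL2_0 V : H1 V -> 0 <= nL2 V. Proof. by move=> _; exact: nL2_ge0. Qed.

Definition admissibleF F := forall k : node, `|F k.1 k.2.1 k.2.2| <= MF.

(** The first clause holds the bounds uniform in z, alpha and the data; the second holds the
    qualitative continuity and representation at fixed data and fixed W. *)
Definition C11_zx (f : E -> grid_vec R N B -> R -> R -> E -> R)
    (df : E -> grid_vec R N B -> R -> R -> E -> E -> R) :=
  (exists C, forall G F z x, admissible G -> admissibleF F -> z \in `[A, b] -> x \in `[0, 1] ->
     C11 (S G) H1 nL2 C (f G F z x) (df G F z x)) /\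
  forall G F W, admissible G -> admissibleF F -> S G W ->
     CR2 (fun z x => f G F z x W) /\ GRep (fun z x => df G F z x W).

Lemma C11_zx_add f df g dg : C11_zx f df -> C11_zx g dg ->
  C11_zx (fun G F z x W => f G F z x W + g G F z x W) (fun G F z x W V => df G F z x W V + dg G F z x W V).
Proof.
move=> [[C hC] hf] [[D hD] hg]; split.
  exists (C + D) => G F z x gG gF zI xI.
  by apply: C11_add; [exact: hC|exact: hD].
move=> G F W gG gF SW; have [h1 h2] := hf _ _ _ gG gF SW; have [k1 k2] := hg _ _ _ gG gF SW; split.
- exact: CR2_add.
- exact: GRepD.
Qed.

Lemma C11_zx_mul f df g dg : C11_zx f df -> C11_zx g dg ->
  C11_zx (fun G F z x W => f G F z x W * g G F z x W)
    (fun G F z x W V => df G F z x W V * g G F z x W + f G F z x W * dg G F z x W V).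
Proof.
move=> [[C hC] hf] [[D hD] hg]; split.
  exists (4 * (C * D)) => G F z x gG gF zI xI.
  by apply: C11_mul; [exact: SS|exact: nL2_0|exact: hC|exact: hD].
move=> G F W gG gF SW; have [h1 h2] := hf _ _ _ gG gF SW; have [k1 k2] := hg _ _ _ gG gF SW; split.
- exact: CR2_mul.
- apply: GRepD; last exact: GRep_mul.
  by apply: GRep_eq (GRep_mul k1 h2) => *; rewrite mulrC.
Qed.

Lemma C11_zx_const (f : grid_vec R N B -> R -> R) C :
  (forall F x, admissibleF F -> x \in `[0, 1] -> `|f F x| <= C) -> (forall F, continuous (f F)) ->
  C11_zx (fun G F z x W => f F x) (fun G F z x W V => 0).
Proof.
move=> fC cf; split.
  exists C => G F z x gG gF zI xI.
  apply: (C11_le (@SS G) _ (fC F x gF xI)); last exact: C11_cst (@SS G) _ nL2_0 _.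
  by move=> V HV; rewrite lexx nL2_0.
move=> G F W gG gF SW; split; first exact: CR2_x.
exact: GRep0.
Qed.

Lemma C11_zx_fun (w : R -> R) : continuous w ->
  C11_zx (fun G F z x W => w x) (fun G F z x W V => 0).
Proof.
move=> cw; have [C _ HC] := @continuous_bounded R 0 1 w (continuous_subspaceT cw).
by apply: (@C11_zx_const (fun _ x => w x) C) => // F x _; exact: HC.
Qed.

Lemma continuous_sumr (I : Type) (s : seq I) (f : I -> R -> R) :
  (forall i, continuous (f i)) -> continuous (fun x => \sum_(i <- s) f i x).
Proof.
move=> cf; elim: s => [|i s ih].
  by under eq_fun do rewrite big_nil; move=> x; exact: cvg_cst.
by under eq_fun do rewrite big_cons; move=> x; apply: cvgD; [exact: cf|exact: ih].
Qed.

Lemma C11_zx_F (be : node -> R -> R) : (forall k, continuous (be k)) ->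
  C11_zx (fun G F z x W => \sum_(k : node) be k x * F k.1 k.2.1 k.2.2) (fun G F z x W V => 0).
Proof.
move=> cb; have [C C0 HC] := @continuous_bounded_fin R _ 0 1 be cb.
apply: (@C11_zx_const (fun F x => \sum_(k : node) be k x * F k.1 k.2.1 k.2.2) (\sum_(k : node) C * MF)).
  move=> F x gF xI; apply: le_trans (ler_norm_sum _ _ _) _; apply: ler_sum => k _.
  by rewrite normrM ler_pM ?HC.
move=> F; apply: continuous_sumr => k x; apply: cvgM; [exact: cb|exact: cvg_cst].
Qed.

Lemma LCont_CR2 X f : LCont A sigma X f -> (forall x, x \in `[0, 1] -> X x) -> CR2 f.
Proof.
move=> cf X01 p.
apply: (@continuous_comp _ _ _ (fun p : R * R => (p.1, cl1 p.2)) (fun p : R * R => f (cl p.1) p.2)).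
  apply: (@continuous_pair _ _ _ (fun p : R * R => p.1) (fun p : R * R => cl1 p.2) p).
    exact: cvg_fst.
  exact: (continuous_snd_comp (@continuous_clamp _ 0 1)).
by apply: cf; apply: X01; exact: cl1I.
Qed.

(** Tail integration replaces [ptnorm t] by the L_2 norm, at the cost of the factor [Knorm] for
    every z; the continuous coefficients of the integrand become the base terms of [GRep]. *)
Lemma C11_zx_int X phi dphi : C11_tx A sigma MG S X phi dphi ->
  (forall G W x, S G W -> x \in `[0, 1] -> X G W x) ->
  C11_zx (fun G F z x W => \int[mu]_(t in `[z, b]) phi G t x W)
    (fun G F z x W V => \int[mu]_(t in `[z, b]) dphi G t x W V).
Proof.
move=> [[C hC] hl] X01.
have cphi G W : admissible G -> S G W -> CR2 (fun t x => phi G t x W).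
  by move=> gG SW; have [+ _] := hl _ _ gG SW; move=> /LCont_CR2; apply => x; exact: X01.
have rphi G W : admissible G -> S G W -> exists2 coef : node -> R -> R -> R, forall k, CR2 (coef k) &
    forall t x V, dphi G t x W V = \sum_k coef k t x * comp V k t.
  move=> gG SW; have [_ [coef cc ce]] := hl _ _ gG SW; exists coef => // k.
  by apply: LCont_CR2 (cc k) _ => x; exact: X01.
have [K0 K1 _ _] := Knorm_parts N B sigma_gt0 h_gt0.
split.
  exists (C * Knorm sigma h N B) => G F z x gG gF zI xI.
  have zb : z <= b by move: zI; rewrite in_itv/= => /andP[].
  have Az : A <= z by move: zI; rewrite in_itv/= => /andP[].
  apply: (C11_int (@SS G) (ptnorm := @ptnorm R N B)) => //.
  - by apply: le_trans K1; rewrite lerBlDr addrC lerD.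
  - by move=> t V _ _; exact: ptnorm_ge0.
  - move=> V HV; split; first exact: (ptnorm_itg sigma_gt0).
    exact: (ptnorm_int sigma_gt0 h_gt0).
  - move=> V V2 HV HV2; split; first exact: (ptnorm2_itg sigma_gt0).
    exact: (ptnorm2_int sigma_gt0 h_gt0).
  - move=> W SW; apply: itg_sub => //.
    exact: (CR2_itgz (cphi _ _ gG SW) xI).
  - move=> W V SW HV; apply: itg_sub => //.
    have [coef cc ce] := rphi _ _ gG SW.
    apply: (@itg_eq _ _ _ (fun t => \sum_k coef k t x * comp V k t)); first by move=> t _; rewrite ce.
    apply: itg_sum => k _.
    apply: (@CR2_itgz _ A sigma (fun t x => coef k t x * comp V k t) x _ xI).
    by apply: CR2_mul => //; apply: CR2_z; exact: (H1_clcont sigma_gt0).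
  - by move=> t tzb; apply: hC => //; exact: (sub_zb zI).
move=> G F W gG gF SW; split; first exact: (CR2_intzb sigma_gt0 (cphi _ _ gG SW)).
have [coef cc ce] := rphi _ _ gG SW.
apply: (@GRep_eq _ _ _ _ _ (fun z x V => \sum_k 1 * \int[mu]_(t in `[z, b]) (coef k t x * comp V k t))).
  move=> z x V zI xI HV; under [RHS]eq_Rintegral do rewrite ce.
  rewrite Rint_sum; first by apply: eq_bigr => k _; rewrite mul1r.
  move=> k _; apply: itg_sub => //.
  apply: (@CR2_itgz _ A sigma (fun t x => coef k t x * comp V k t) x _ xI).
  by apply: CR2_mul => //; apply: CR2_z; exact: (H1_clcont sigma_gt0).
apply: (@GRep_sum _ _ _ _ _ _ _ (fun k z x V => 1 * \int[mu]_(t in `[z, b]) (coef k t x * comp V k t))) => k.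
by apply: (@GRep_base _ _ _ _ _ k (fun _ _ => 1)) => //; exact: CR2_cst.
Qed.

(** The residual adds W(z), controlled by [ptnorm z], to an operator controlled by the L_2 norm. *)
Definition mixnorm z V := ptnorm z V + nL2 V.

Lemma mixnorm_ge0 z V : 0 <= mixnorm z V.
Proof. by rewrite addr_ge0 ?ptnorm_ge0 ?nL2_ge0. Qed.

Definition C11_z (f : E -> grid_vec R N B -> R -> E -> R)
    (df : E -> grid_vec R N B -> R -> E -> E -> R) :=
  (exists C, forall G F z, admissible G -> admissibleF F -> z \in `[A, b] ->
     C11 (S G) H1 (mixnorm z) C (f G F z) (df G F z)) /\
  forall G F W, admissible G -> admissibleF F -> S G W ->
     continuous ((fun z => f G F z W) \o cl) /\ ZRep (fun z => df G F z W).

Lemma C11_z_add f df g dg : C11_z f df -> C11_z g dg ->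
  C11_z (fun G F z W => f G F z W + g G F z W) (fun G F z W V => df G F z W V + dg G F z W V).
Proof.
move=> [[C hC] hf] [[D hD] hg]; split.
  exists (C + D) => G F z gG gF zI.
  by apply: C11_add; [exact: hC|exact: hD].
move=> G F W gG gF SW; have [h1 h2] := hf _ _ _ gG gF SW; have [k1 k2] := hg _ _ _ gG gF SW; split.
- by move=> z; apply: cvgD; [exact: h1|exact: k1].
- exact: ZRep_add.
Qed.

Lemma C11_z_scale c f df : C11_z f df ->
  C11_z (fun G F z W => c * f G F z W) (fun G F z W V => c * df G F z W V).
Proof.
move=> [[C hC] hf]; split.
  by exists (`|c| * C) => G F z gG gF zI; apply: C11_scale; exact: hC.
move=> G F W gG gF SW; have [h1 h2] := hf _ _ _ gG gF SW; split.
- by move=> z; apply: cvgM; [exact: cvg_cst|exact: h1].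
- exact: ZRep_scale.
Qed.

Lemma C11_z_int g dg : C11_zx g dg ->
  C11_z (fun G F z W => \int[mu]_(x in `[0, 1]) g G F z x W)
    (fun G F z W V => \int[mu]_(x in `[0, 1]) dg G F z x W V).
Proof.
move=> [[C hC] hg]; split.
  exists (C * 1) => G F z gG gF zI.
  apply: (@C11_le _ _ _ _ (@SS G) nL2 _ (C * 1)) => //.
    by move=> V HV; rewrite nL2_ge0 lerDr ptnorm_ge0.
  apply: (C11_int (@SS G) (ptnorm := fun _ => nL2)) => //.
  - by move=> t V _; exact: nL2_0.
  - by move=> V HV; split; [exact: itg_cst|rewrite Rintegral_cst// mul1r fine_mu_itv// subr0 mulr1].
  - by move=> V V2 HV HV2; split; [exact: itg_cst|rewrite Rintegral_cst// mul1r fine_mu_itv// subr0 mulr1].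
  - by move=> W SW; have [h1 _] := hg _ _ _ gG gF SW; exact: (CR2_itgx h1 zI).
  - move=> W V SW HV; have [_ h2] := hg _ _ _ gG gF SW.
    exact: (CR2_itgx (GRep_cont sigma_gt0 HV h2) zI).
  - by move=> x xI; exact: hC.
move=> G F W gG gF SW; have [h1 h2] := hg _ _ _ gG gF SW; split; first exact: CR2_int01.
exact: (GRep_ZRep sigma_gt0).
Qed.

Lemma C11_z_comp k : C11_z (fun G F z W => comp W k z) (fun G F z W V => comp V k z).
Proof.
split.
  exists (`|M| + 1) => G F z gG gF zI; apply: C11_lin.
  - exact: (@SS G).
  - by move=> V _; exact: mixnorm_ge0.
  - by rewrite addr_ge0.
  - by move=> W SW; apply: le_trans (S_M k SW zI) _; rewrite (le_trans (ler_norm _))// lerDl.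
  - move=> V HV; apply: (@le_trans _ _ (mixnorm z V)); last by rewrite ler_peMl ?mixnorm_ge0// lerDr.
    by rewrite /mixnorm /ptnorm (bigD1 k)//= -addrA lerDl addr_ge0 ?nL2_ge0// sumr_ge0.
  - by move=> W W2 SW SW2; rewrite /comp !fctE !mxE.
move=> G F W gG gF SW; split; first exact: (H1_clcont sigma_gt0 (S_H1 SW)).
exact: ZRep_comp.
Qed.

Lemma C11_z_sum (I : Type) (s : seq I) (f : I -> _) df : (forall i, C11_z (f i) (df i)) ->
  C11_z (fun G F z W => \sum_(i <- s) f i G F z W) (fun G F z W V => \sum_(i <- s) df i G F z W V).
Proof.
move=> hf; elim: s => [|i s ih].
  have c0 : C11_z (fun G F z W => 0) (fun G F z W V => 0).
    split.
      exists `|0 : R| => G F z gG gF zI; apply: C11_cst; first exact: (@SS G).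
      by move=> V _; exact: mixnorm_ge0.
    move=> G F W gG gF SW; split; first by move=> z; exact: cvg_cst.
    by split=> [V HV z|e ce]; [exact: cvg_cst|apply: FRep_eq (FRep0 _ _ _ _) => V _; under [RHS]eq_Rintegral do rewrite mulr0; rewrite Rintegral_cst// mul0r].
  have -> : (fun G F z W => \sum_(i <- [::]) f i G F z W) = (fun G F z W => 0).
    by apply/funext => G; apply/funext => F; apply/funext => z; apply/funext => W; rewrite big_nil.
  have -> // : (fun G F z W V => \sum_(i <- [::]) df i G F z W V) = (fun G F z W V => 0).
  by apply/funext => G; apply/funext => F; apply/funext => z; apply/funext => W; apply/funext => V; rewrite big_nil.
have -> : (fun G F z W => \sum_(i <- i :: s) f i G F z W) = (fun G F z W => f i G F z W + \sum_(i <- s) f i G F z W).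
  by apply/funext => G; apply/funext => F; apply/funext => z; apply/funext => W; rewrite big_cons.
have -> : (fun G F z W V => \sum_(i <- i :: s) df i G F z W V) = (fun G F z W V => df i G F z W V + \sum_(i <- s) df i G F z W V).
  by apply/funext => G; apply/funext => F; apply/funext => z; apply/funext => W; apply/funext => V; rewrite big_cons.
exact: C11_z_add.
Qed.

Definition C11_Omega (f : E -> grid_vec R N B -> E -> R) (df : E -> grid_vec R N B -> E -> E -> R) :=
  (exists C, forall G F, admissible G -> admissibleF F -> C11 (S G) H1 nL2 C (f G F) (df G F)) /\
  forall G F W, admissible G -> admissibleF F -> S G W -> FRep (df G F W).

Lemma mixnorm_int V : H1 V -> mu.-integrable `[A, b] (EFin \o (fun z => mixnorm z V)) /\
  \int[mu]_(z in `[A, b]) mixnorm z V <= (3 * Knorm sigma h N B + sigma) * nL2 V.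
Proof.
move=> HV; have AI : A \in `[A, b] by rewrite in_itv/= lexx.
have [K0 K1 _ _] := Knorm_parts N B sigma_gt0 h_gt0.
have i1 := ptnorm_itg sigma_gt0 HV AI.
split; first by apply: itgD => //; exact: itg_cst.
rewrite RintegralD//; last exact: itg_cst.
rewrite Rintegral_cst// fine_mu_itv// (_ : b - A = sigma); last by ring.
have := ptnorm_int sigma_gt0 h_gt0 HV AI; have := mulr_ge0 K0 (nL2_ge0 A sigma h V).
by nra.
Qed.

(** In the expanded product the term quadratic in [ptnorm] and the two cross terms contribute
    [Knorm] each, and the term free of [ptnorm] contributes sigma. *)
Lemma mixnorm2_int V V2 : H1 V -> H1 V2 ->
  mu.-integrable `[A, b] (EFin \o (fun z => mixnorm z V * mixnorm z V2)) /\
  \int[mu]_(z in `[A, b]) (mixnorm z V * mixnorm z V2) <= (3 * Knorm sigma h N B + sigma) * (nL2 V * nL2 V2).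
Proof.
move=> HV HV2; have AI : A \in `[A, b] by rewrite in_itv/= lexx.
have [K0 K1 _ _] := Knorm_parts N B sigma_gt0 h_gt0.
have i1 := ptnorm_itg sigma_gt0 HV AI; have i2 := ptnorm_itg sigma_gt0 HV2 AI.
have i12 := ptnorm2_itg sigma_gt0 HV HV2 AI.
have j1 := itgZ (nL2 V2) i1; have j2 := itgZ (nL2 V) i2.
have e z : mixnorm z V * mixnorm z V2 = ptnorm z V * ptnorm z V2 + (nL2 V2 * ptnorm z V + (nL2 V * ptnorm z V2 + nL2 V * nL2 V2)).
  by rewrite /mixnorm; ring.
have jc := itg_cst A b (nL2 V * nL2 V2).
have j3 := itgD j2 jc; have j4 := itgD j1 j3.
split; first by apply: itg_eq (itgD i12 j4) => z _; rewrite e.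
under eq_Rintegral do rewrite e.
rewrite RintegralD// RintegralD// RintegralD//.
rewrite [X in _ + (_ + (_ + X))]Rintegral_cst// fine_mu_itv// (_ : b - A = sigma); last by ring.
rewrite !RintegralZl//.
have := ptnorm_int sigma_gt0 h_gt0 HV AI; have := ptnorm_int sigma_gt0 h_gt0 HV2 AI.
have := ptnorm2_int sigma_gt0 h_gt0 HV HV2 AI.
have n1 := nL2_ge0 A sigma h V; have n2 := nL2_ge0 A sigma h V2 => a1 a2 a3.
have := ler_wpM2l n2 a3; have := ler_wpM2l n1 a2.
by lra.
Qed.

(** Integrating the square in z absorbs the pointwise part of [mixnorm], so the derivative of the
    functional is Lipschitz for the L_2 norm alone. Its kernels come from [ZRep], applied with the
    continuous weight 2 w^2 f. *)
Lemma C11_Omega_sqr f df (w : R -> R) : C11_z f df -> continuous w ->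
  C11_Omega (fun G F W => \int[mu]_(z in `[A, b]) (w z * f G F z W) ^+ 2)
    (fun G F W V => \int[mu]_(z in `[A, b]) (w z ^+ 2 * (2 * f G F z W) * df G F z W V)).
Proof.
move=> [[C hC] hf] cw.
have [Cw Cw0 HCw] := @continuous_bounded R A b w (continuous_subspaceT cw).
have [K0 K1 _ _] := Knorm_parts N B sigma_gt0 h_gt0.
have cwc : continuous (w \o cl).
  by move=> z; apply: continuous_comp; [exact: continuous_clamp|exact: cw].
have ce G F W : admissible G -> admissibleF F -> S G W -> continuous ((fun z => w z ^+ 2 * (2 * f G F z W)) \o cl).
  move=> gG gF SW; have [h1 _] := hf _ _ _ gG gF SW.
  move=> z; apply: cvgM; first by under [X in X @ _]eq_fun do rewrite /= expr2; apply: cvgM; exact: cwc.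
  by apply: cvgM; [exact: cvg_cst|exact: h1].
split; last first.
  move=> G F W gG gF SW; have [h1 [h2 h3]] := hf _ _ _ gG gF SW.
  apply: FRep_eq (h3 _ (ce _ _ _ gG gF SW)) => V HV.
  by apply: eq_Rintegral => z; rewrite inE => zI; rewrite /= (clamp_id zI).
exists (Cw ^+ 2 * (4 * (C * C)) * (3 * Knorm sigma h N B + sigma)) => G F gG gF.
apply: (C11_int (@SS G) (ptnorm := mixnorm)) => //.
- by rewrite (_ : b - A = sigma); [lra|ring].
- by move=> t V _ _; exact: mixnorm_ge0.
- exact: mixnorm_int.
- exact: mixnorm2_int.
- move=> W SW; have [h1 _] := hf _ _ _ gG gF SW; apply: (cont_cl (sigma := sigma)) => z.
  apply: (@continuous_comp _ _ _ (fun z => w (cl z) * f G F (cl z) W) (fun y : R => y ^+ 2)); last exact: exprn_continuous.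
  by apply: cvgM; [exact: cwc|exact: h1].
- move=> W V SW HV; have [h1 [h2 _]] := hf _ _ _ gG gF SW.
  by apply: (cont_cl (sigma := sigma)) => z; apply: cvgM; [exact: ce|exact: h2].
- move=> z zI; have h1 := hC _ _ _ gG gF zI.
  have h2 := C11_mul (@SS G) (fun V _ => mixnorm_ge0 z V) h1 h1.
  have h3 := C11_scale (w z ^+ 2) h2.
  have h4 : C11 (S G) H1 (mixnorm z) (`|w z ^+ 2| * (4 * (C * C))) (fun W => (w z * f G F z W) ^+ 2)
     (fun W V => w z ^+ 2 * (2 * f G F z W) * df G F z W V).
    apply: C11_eq h3 => //; first exact: (@SS G).
      by move=> W _; ring.
    by move=> W V _ _; ring.
  apply: C11_le h4; first exact: (@SS G).
    by move=> V HV; rewrite lexx mixnorm_ge0.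
  have [C0 _ _ _] := h1.
  rewrite ler_wpM2r ?mulr_ge0// normrX lerXn2r ?nnegrE//.
  exact: HCw.
Qed.

Lemma C11_Omega_sum (I : Type) (s : seq I) (P : pred I) (f : I -> _) df : (forall i, C11_Omega (f i) (df i)) ->
  C11_Omega (fun G F W => \sum_(i <- s | P i) f i G F W) (fun G F W V => \sum_(i <- s | P i) df i G F W V).
Proof.
move=> hf; split.
  have /choice[C HC] : forall i, exists C, forall G F, admissible G -> admissibleF F -> C11 (S G) H1 nL2 C (f i G F) (df i G F).
    by move=> i; have [] := hf i.
  exists (\sum_(i <- s | P i) C i) => G F gG gF.
  apply: (C11_sum (@SS G)); first exact: nL2_0.
  by move=> i _; exact: HC.
move=> G F W gG gF SW; apply: (FRep_sum sigma_gt0) => i _.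
by have [_ +] := hf i; apply.
Qed.

Lemma C11_Omega_scale c f df : C11_Omega f df ->
  C11_Omega (fun G F W => c * f G F W) (fun G F W V => c * df G F W V).
Proof.
move=> [[C hC] hf]; split.
  by exists (`|c| * C) => G F gG gF; apply: C11_scale; exact: hC.
move=> G F W gG gF SW; apply: (FRep_scale sigma_gt0); exact: hf.
Qed.

End Nonlocal.

(** * A two-point boundary value problem on a segment *)

Section Green.
Context {R : realType}.
Notation mu := (@lebesgue_measure R).

Lemma FTC2_Rint (a b : R) (F f : R -> R) : a <= b ->
  (forall z, z \in `[a, b] -> is_derive z (1 : R) F (f z)) -> {within `[a, b], continuous f} ->
  \int[mu]_(t in `[a, b]) f t = F b - F a.
Proof.
rewrite le_eqVlt => /predU1P[<- _ _|ab dF cf].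
  by rewrite set_itv1 Rintegral_set1 subrr.
have h : derivable_oo_LRcontinuous F a b.
  have cF z : z \in `[a, b] -> {for z, continuous F}.
    by move=> zI; apply: differentiable_continuous; apply/derivable1_diffP; have [] := dF z zI.
  split.
  - by move=> z zI; have [] := dF z (subset_itv_oo_cc zI).
  - apply: cvg_at_right_filter; apply: cF; by rewrite in_itv/= lexx ltW.
  - apply: cvg_at_left_filter; apply: cF; by rewrite in_itv/= lexx ltW.
have h2 : {in `]a, b[, F^`()%classic =1 f}.
  by move=> z zI; rewrite derive1E; have [_ ->] := dF z (subset_itv_oo_cc zI).
by rewrite /Rintegral (continuous_FTC2 ab cf h h2).
Qed.

Lemma is_derive_prim (a z : R) (f : R -> R) : continuous f -> a < z ->
  is_derive z (1 : R) (fun y => \int[mu]_(t in `[a, y]) f t) (f z).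
Proof.
move=> cf az.
have zz : z < z + 1 by rewrite ltrDl.
have [d e] := continuous_FTC1_closed zz (continuous_integrable a (z + 1) cf) az (cf z).
by apply: DeriveDef => //; rewrite -derive1E.
Qed.

(* Variation of constants for - y'' + y = P with y(a) = 0 and y'(b) = 0, the conditions dual to
   vanishing on B_A only. *)
Lemma green_function (a b : R) (P : R -> R) : a < b -> continuous P ->
  exists g g1 : R -> R, [/\ {within `[a, b], continuous g}, {within `[a, b], continuous g1}, g a = 0,
    (forall z, z \in `[a, b] -> g z = \int[mu]_(t in `[a, z]) g1 t) &
    (forall z, z \in `[a, b] -> g1 z = \int[mu]_(t in `[z, b]) (P t - g t))].
Proof.
move=> ab cP.
have cexp : continuous (@expR R) by exact: continuous_expR.
have cexpN : continuous (fun s : R => expR (- s)).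
  by move=> s; apply: continuous_comp; [exact: opp_continuous|exact: cexp].
(* Primitives starting at a - 1 are differentiable at a as well, since [is_derive_prim] concerns
   points strictly to the right of the lower end. *)
pose Ph z := \int[mu]_(t in `[a - 1, z]) (expR (- t) * P t).
pose Ps z := \int[mu]_(t in `[a - 1, z]) (expR t * P t).
have dPh z : a <= z -> is_derive z (1 : R) Ph (expR (- z) * P z).
  move=> az; apply: (@is_derive_prim (a - 1) z (fun t => expR (- t) * P t)).
    by move=> s; apply: cvgM; [exact: cexpN|exact: cP].
  by rewrite (lt_le_trans _ az)// ltrBlDr ltrDl.
have dPs z : a <= z -> is_derive z (1 : R) Ps (expR z * P z).
  move=> az; apply: (@is_derive_prim (a - 1) z (fun t => expR t * P t)).
    by move=> s; apply: cvgM; [exact: cexp|exact: cP].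
  by rewrite (lt_le_trans _ az)// ltrBlDr ltrDl.
pose u := expR a; pose w := expR b.
have u0 : 0 < u by exact: expR_gt0.
have w0 : 0 < w by exact: expR_gt0.
(* The functions p1 and p2 below satisfy p1' = p1 - P and p2' = - p2 + P, so that g = (p1 + p2) / 2
   has derivative g1 and g1 has derivative g - P. The constants k1 and k2 solve the linear system
   expressing g a = 0 and g1 b = 0. *)
pose k1 := (w ^+ 2 * Ph b + u ^+ 2 * Ph a - Ps a + Ps b) / (w ^+ 2 + u ^+ 2).
pose k2 := - u ^+ 2 * (k1 - Ph a) - Ps a.
pose p1 z := expR z * (k1 - Ph z).
pose p2 z := expR (- z) * (k2 + Ps z).
have dexpN z : is_derive z (1 : R) (fun s : R => expR (- s)) (- expR (- z)).
  by apply: is_derive_eq; rewrite mulrN1.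
have dp1 z : a <= z -> is_derive z (1 : R) p1 (p1 z - P z).
  move=> az; have d := dPh z az; rewrite /p1; apply: is_derive_eq.
  by rewrite /GRing.scale/= expRN; field; rewrite gt_eqF// expR_gt0.
have dp2 z : a <= z -> is_derive z (1 : R) p2 (- p2 z + P z).
  move=> az; have d := dPs z az; have d2 := dexpN z; rewrite /p2; apply: is_derive_eq.
  by rewrite /GRing.scale/= expRN; field; rewrite gt_eqF// expR_gt0.
pose g z := (p1 z + p2 z) / 2; pose g1 z := (p1 z - p2 z) / 2.
have dg z : a <= z -> is_derive z (1 : R) g (g1 z).
  move=> az; have d1 := dp1 z az; have d2 := dp2 z az; rewrite /g; apply: is_derive_eq.
  by rewrite /GRing.scale/= /g1; ring.
have dg1 z : a <= z -> is_derive z (1 : R) g1 (g z - P z).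
  move=> az; have d1 := dp1 z az; have d2 := dp2 z az; rewrite /g1; apply: is_derive_eq.
  by rewrite /GRing.scale/= /g; field.
have cd (f df : R -> R) : (forall z, a <= z -> is_derive z (1 : R) f (df z)) -> {within `[a, b], continuous f}.
  move=> d; apply: derivable_within_continuous => z; rewrite in_itv/= => /andP[az _].
  by have [] := d z az.
have cg := cd _ _ dg; have cg1 := cd _ _ dg1.
have ga : g a = 0.
  rewrite /g /p1 /p2 /k2 expRN -/u; field; by rewrite gt_eqF.
have g1b : g1 b = 0.
  rewrite /g1 /p1 /p2 /k2 /k1 expRN -/w; field.
  by rewrite !gt_eqF// addr_gt0// exprn_gt0.
clearbody g g1.
exists g, g1; split => // z zI; have := zI; rewrite in_itv/= => /andP[az zb].
  have -> : \int[mu]_(t in `[a, z]) g1 t = g z - g a.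
    apply: FTC2_Rint => //.
    - by move=> t; rewrite in_itv/= => /andP[at_ _]; exact: dg.
    - by apply: continuous_subspaceW cg1; apply: subset_itvl; rewrite bnd_simp.
  by rewrite ga subr0.
have -> : \int[mu]_(t in `[z, b]) (P t - g t) = - g1 b - - g1 z; last by rewrite g1b oppr0 sub0r opprK.
apply: (@FTC2_Rint z b (fun t => - g1 t) (fun t => P t - g t)).
- exact: zb.
- move=> t; rewrite in_itv/= => /andP[zt _]; have d := dg1 t (le_trans az zt).
  rewrite -[P t - g t]opprB; exact: is_deriveN.
- apply: (@continuous_subspaceW _ _ _ `[a, b]); first by apply: subset_itvr; rewrite bnd_simp.
  move=> t; apply: cvgB; last exact: cg.
  exact: (continuous_subspaceT cP).
Qed.

End Green.

(** * Riesz representation in H^1_0 *)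

Section Riesz.
Context {R : realType}.
Notation mu := (@lebesgue_measure R).
Variables (A sigma h : R) (N B : nat).
Hypotheses (sigma_gt0 : 0 < sigma) (h_gt0 : 0 < h).
Local Notation b := (A + sigma).
Local Notation E := (semidiscrete R N B).
Local Notation node := (node N B).
Local Notation H1 := (@H1_0 R A sigma N B).
Local Notation cl := (clamp A b).

Let Ab : A < b. Proof. by rewrite ltrDl. Qed.
Let Ab' : A <= b. Proof. exact: ltW. Qed.

(** Integration by parts: V vanishes at A and the tail integral of y vanishes at A + sigma, so no
    boundary term remains. Writing V as the primitive of its weak derivative reduces it to
    [Rfubini_triangle]. *)
Lemma parts_H1 (y : R -> R) V k : continuous y -> H1 V ->
  \int[mu]_(z in `[A, b]) ((\int[mu]_(s in `[z, b]) y s) * wdc A sigma V k z) =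
  \int[mu]_(s in `[A, b]) (y s * comp V k s).
Proof.
move=> cy HV.
have iv := L2c_int (wd_L2c (H1_wd k HV)).
have mv : measurable_fun setT (wdc A sigma V k \_ `[A, b]).
  by apply: (measurable_restrictT _ _).1 => //; have /integrableP[/measurable_EFinP] := iv.
have iv' : mu.-integrable `[A, b] (EFin \o (wdc A sigma V k \_ `[A, b])).
  by apply: itg_eq iv => z zI; rewrite patchE mem_set.
have T := Rfubini_triangle Ab' mv (continuous_measurable_fun cy) iv' (continuous_integrable A b cy).
transitivity (\int[mu]_(z in `[A, b]) ((wdc A sigma V k \_ `[A, b]) z * \int[mu]_(s in `[z, b]) y s)).
  by apply: eq_Rintegral => z zI; rewrite patchE zI mulrC.
rewrite T; apply: eq_Rintegral => s; rewrite inE => sI; congr (_ * _).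
rewrite (H1_prim k HV sI); apply: eq_Rintegral => t; rewrite inE/= in_itv/= => /andP[At ts].
by rewrite patchE mem_set//= in_itv/= At (le_trans ts)//; move: sI; rewrite /= in_itv/= => /andP[].
Qed.

(** At each interior node the representer g solves the problem of [green_function] with right-hand
    side p / h^2, where h^2 is the weight of the inner product. By [parts_H1] the pairing of the
    derivatives of g and V is that of p / h^2 - g with V, and adding the pairing of g with V leaves
    p / h^2. At the other nodes g is zero, as V is. *)
Lemma riesz l : @FRep R A sigma N B l -> exists2 g, H1 g & forall V, H1 V -> ipH1 A sigma h g V = l V.
Proof.
move=> [p cp lp].
have cP k : continuous (fun t => p k t / h ^+ 2) by move=> t; apply: cvgM; [exact: cp|exact: cvg_cst].
have /choice[g /choice[g1 Hg]] := fun k => green_function Ab (cP k).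
pose gg : E := fun z k => \matrix_(i, j) (if (z \in `[A, b]) && innode (k, (i, j)) then g (k, (i, j)) z else 0).
have cgg k z : z \in `[A, b] -> comp gg k z = if innode k then g k z else 0.
  by move=> zI; rewrite /comp /gg mxE zI/=; case: k => k [i j].
pose q k : R -> R := if innode k then g1 k else cst 0.
have wg k : is_weak_derivative A sigma (comp gg k) (q k).
  have c1 : {within `[A, b], continuous (q k)}.
    rewrite /q; case: ifP => _; first by have [] := Hg k.
    by apply: continuous_subspaceT => x; exact: cvg_cst.
  have [m i] := L2c_within sigma_gt0 c1.
  have AI : A \in `[A, b] by rewrite in_itv/= lexx.
  split => // z zI; rewrite !cgg// /q; case: ifP => ki.
    by have [_ _ -> -> //] := Hg k; rewrite add0r.
  by rewrite Rintegral_cst// mul0r addr0.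
have Hgg : H1 gg.
  split.
  - move=> z zI; apply/funext => k; apply/matrixP => i j; rewrite !mxE (negPf zI)//.
  - by move=> k i j; exists (q (k, (i, j))); exact: (wg (k, (i, j))).
  - by move=> z k i j ij; rewrite mxE /innode/= (negPf ij) andbF.
  - apply/funext => k; apply/matrixP => i j; rewrite !mxE.
    by case: ifP => // _; have [_ _ -> _ _] := Hg (k, (i, j)).
exists gg => // V HV.
rewrite (ipH1E h sigma_gt0 Hgg HV wg (fun k => H1_wd k HV)) lp// mulr_sumr.
rewrite [RHS](bigID (@innode N B))/= [X in _ = _ + X]big1 ?addr0; last first.
  move=> k ki; rewrite (_ : comp V k = cst 0).
    by under eq_Rintegral do rewrite mulr0; rewrite Rintegral_cst// mul0r.
  by apply/funext => t; rewrite (comp_out t HV ki).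
apply: eq_bigr => k ki.
have [h1 h2 h3 h4 h5] := Hg k.
have cgk : continuous (g k \o cl) by exact: within_clamp.
have cV : continuous (comp V k \o cl) by exact: (H1_clcont sigma_gt0).
pose y t := p k t / h ^+ 2 - g k (cl t).
have cy : continuous y by move=> t; apply: cvgB; [exact: cP|exact: cgk].
rewrite [X in _ + X](_ : _ = \int[mu]_(s in `[A, b]) (y s * comp V k s)); last first.
  rewrite -(parts_H1 k cy HV); apply: eq_Rintegral => z; rewrite inE => zI.
  rewrite /q ki h5//; congr (_ * _); apply: eq_Rintegral => t; rewrite inE => /(sub_zb zI) tI.
  by rewrite /y (clamp_id tI).
rewrite [X in X + _](_ : _ = \int[mu]_(s in `[A, b]) (g k (cl s) * comp V k s)); last first.
  apply: eq_Rintegral => z; rewrite inE => zI.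
  by rewrite cgg// ki (clamp_id zI).
have i1 : mu.-integrable `[A, b] (EFin \o (fun s => g k (cl s) * comp V k s)).
  by apply: (pV_itg sigma_gt0 k _ HV).
have i2 : mu.-integrable `[A, b] (EFin \o (fun s => y s * comp V k s)).
  by apply: (pV_itg sigma_gt0 k cy HV).
rewrite -RintegralD// -RintegralZl//; last first.
  exact: itgD.
apply: eq_Rintegral => s _; rewrite /y -mulrDl subrKC mulrA; congr (_ * _).
by field; rewrite gt_eqF.
Qed.

End Riesz.

(** * Smoothness in alpha of the basis and of u_0 *)

Section Smooth.
Context {R : realType}.
Implicit Types f g : R -> R.

Definition is_C1 f := exists2 df : R -> R, continuous df & forall x, is_derive x (1 : R) f (df x).

Lemma is_derive_conv f g (x d e : R) : is_derive x (1 : R) f d -> f =1 g -> d = e -> is_derive x (1 : R) g e.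
Proof. by move=> + /funext <- <-. Qed.

Lemma C1_derive1 f : is_C1 f -> continuous (derive1 f) /\ forall x, is_derive x (1 : R) f (derive1 f x).
Proof.
move=> [df cdf d]; have e : derive1 f = df.
  by apply/funext => x; rewrite derive1E; have [_ ->] := d x.
by rewrite e.
Qed.

Lemma C1_cont f : is_C1 f -> continuous f.
Proof.
move=> [df _ d] x; apply: differentiable_continuous; apply/derivable1_diffP.
by have [] := d x.
Qed.

Lemma C1_cst (c : R) : is_C1 (fun=> c).
Proof. by exists (fun=> 0) => x; [exact: cvg_cst|exact: is_derive_cst]. Qed.

Lemma C1_id : is_C1 (fun x => x).
Proof. by exists (fun=> 1) => x; [exact: cvg_cst|exact: is_derive_id]. Qed.

Lemma C1_add f g : is_C1 f -> is_C1 g -> is_C1 (fun x => f x + g x).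
Proof.
move=> [df cf hf] [dg cg hg]; exists (fun x => df x + dg x).
  by move=> x; apply: cvgD; [exact: cf|exact: cg].
by move=> x; exact: is_deriveD.
Qed.

Lemma C1_mul f g : is_C1 f -> is_C1 g -> is_C1 (fun x => f x * g x).
Proof.
move=> sf sg; have Cf := C1_cont sf; have Cg := C1_cont sg; move: sf sg.
move=> [df cf hf] [dg cg hg]; exists (fun x => f x * dg x + g x * df x).
  by move=> x; apply: cvgD; apply: cvgM; [exact: Cf|exact: cg|exact: Cg|exact: cf].
by move=> x; exact: is_deriveM.
Qed.

Lemma C1_eq f g : f =1 g -> is_C1 f -> is_C1 g.
Proof. by move=> /funext ->. Qed.

Lemma C1_scale c f : is_C1 f -> is_C1 (fun x => c * f x).
Proof. by move=> sf; apply: C1_mul => //; exact: C1_cst. Qed.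

Lemma C1_sub f g : is_C1 f -> is_C1 g -> is_C1 (fun x => f x - g x).
Proof.
move=> sf sg; apply: (@C1_eq (fun x => f x + (-1) * g x)); first by move=> x; rewrite mulN1r.
by apply: C1_add => //; exact: C1_scale.
Qed.

Lemma C1_sum (I : Type) (s : seq I) (F : I -> R -> R) : (forall i, is_C1 (F i)) ->
  is_C1 (fun x => \sum_(i <- s) F i x).
Proof.
move=> hF; elim: s => [|i s ih].
  by apply: C1_eq (C1_cst 0) => x; rewrite big_nil.
by apply: C1_eq (C1_add (hF i) ih) => x; rewrite big_cons.
Qed.

Lemma C1_exp n f : is_C1 f -> is_C1 (fun x => f x ^+ n).
Proof.
move=> sf; elim: n => [|n ih]; first by apply: C1_eq (C1_cst 1).
by apply: C1_eq (C1_mul sf ih) => x; rewrite exprS.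
Qed.

Lemma C1_inv f : is_C1 f -> (forall x, f x != 0) -> is_C1 (fun x => (f x)^-1).
Proof.
move=> sf f0; have Cf := C1_cont sf; move: sf => [df cf hf].
exists (fun x => - f x ^- 2 * df x).
  move=> x; apply: cvgM; last exact: cf.
  apply: cvgN; apply: cvgV; first by rewrite expf_neq0.
  by apply: (@continuous_comp _ _ _ f (fun y => y ^+ 2)); [exact: Cf|exact: exprn_continuous].
by move=> x; exact: is_deriveV.
Qed.

Variable a : R.

Lemma C1_xi n : is_C1 (xi a n).
Proof.
apply: C1_mul; last by exists expR; [exact: continuous_expR|move=> x; exact: is_derive_expR].
by apply: C1_exp; apply: C1_add; [exact: C1_id|exact: C1_cst].
Qed.

Lemma C1_gram_schmidt n i : is_C1 (nth (fun=> 0) (gram_schmidt a n) i).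
Proof.
elim: n i => [|n ih] i; first by rewrite nth_nil; exact: C1_cst.
rewrite /= nth_rcons; case: ifP => _; first exact: ih.
case: ifP => _; last exact: C1_cst.
set c := (Num.sqrt _)^-1.
apply: (@C1_eq (fun x => c * (xi a n x - \sum_(p <- gram_schmidt a n) L2_01 (xi a n) p * p x))).
  by move=> x; rewrite mulrC.
apply: C1_scale; apply: C1_sub; first exact: C1_xi.
apply: (@C1_eq (fun x => \sum_(0 <= j < size (gram_schmidt a n)) L2_01 (xi a n) (nth (fun=> 0) (gram_schmidt a n) j) * nth (fun=> 0) (gram_schmidt a n) j x)).
  by move=> x; rewrite (big_nth (fun=> 0)).
by apply: C1_sum => j; exact: C1_scale.
Qed.

Lemma C1_Psi n : is_C1 (Psi a n).
Proof. exact: C1_gram_schmidt. Qed.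

Variables (A h : R) (B : nat).
Hypothesis A_gt0 : 0 < A.

Lemma u0_den (i j : 'I_B.+1) (x : R) : 0 < (i%:R * h - x) ^+ 2 + (j%:R * h - 2^-1) ^+ 2 + A ^+ 2.
Proof. by rewrite ltr_wpDl ?exprn_gt0// addr_ge0 ?sqr_ge0. Qed.

Lemma C1_u0 (i j : 'I_B.+1) : is_C1 (fun x => u0 A h x i j).
Proof.
apply: (@C1_eq (fun x => A ^+ 2 * ((i%:R * h - x) ^+ 2 + (j%:R * h - 2^-1) ^+ 2 + A ^+ 2)^-1)).
  by move=> x; rewrite /u0 mxE.
apply: C1_scale; apply: C1_inv; last by move=> x; rewrite gt_eqF// u0_den.
apply: C1_add; last exact: C1_cst.
apply: C1_add; last exact: C1_cst.
apply: C1_exp; apply: C1_sub; [exact: C1_cst|exact: C1_id].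
Qed.

End Smooth.

(** * The flux at one node in one direction, and its alpha-derivative *)

Section Channel.
Context {R : realType}.
Notation mu := (@lebesgue_measure R).
Variables (A sigma h : R) (N B : nat).
Hypotheses (sigma_gt0 : 0 < sigma) (h_gt0 : 0 < h).
Local Notation b := (A + sigma).
Local Notation E := (semidiscrete R N B).
Local Notation node := (node N B).
Local Notation H1 := (@H1_0 R A sigma N B).
Local Notation cl := (clamp A b).
Variables (M MG MF : R) (S : E -> set E).
Hypotheses (M_ge0 : 0 <= M) (MG_ge0 : 0 <= MG) (MF_ge0 : 0 <= MF).
Hypothesis S_H1 : forall G W, S G W -> H1 W.
Hypothesis S_M : forall G W x t, S G W -> t \in `[A, b] -> `|comp W x t| <= M.
Local Notation admissible := (@admissible R A sigma N B MG).
Local Notation C11_tx := (@C11_tx R A sigma N B MG S).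
Implicit Types (F : grid_vec R N B).

Variables (vq vp : R -> R) (bq bp : node -> R -> R) (c : R).
Hypotheses (svq : is_C1 vq) (svp : is_C1 vp) (sbq : forall k, is_C1 (bq k)) (sbp : forall k, is_C1 (bp k)).
Hypothesis c_gt0 : 0 < c.
Hypothesis qc : forall G W t x, S G W -> t \in `[A, b] -> x \in `[0, 1] -> c <= affine_form vq bq G t x W.

Let Ab : A < b. Proof. by rewrite ltrDl. Qed.
Let Ab' : A <= b. Proof. exact: ltW. Qed.

Definition derive_coef (be : node -> R -> R) k : R -> R := derive1 (be k).

(** [vq] and [bq] describe u at a node, [vp] and [bp] a central difference there, so this is u_x /
    (2 sqrt u) or u_y / (2 sqrt u). *)
Definition phi (G : E) t x W := affine_form vp bp G t x W * rsq (affine_form vq bq G t x W).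
(** The alpha-derivative of [phi], expanded as a polynomial in affine forms and [rsq] so that the
    product rules for [C11_tx] apply. *)
Definition phix (G : E) t x W := affine_form (derive1 vp) (derive_coef bp) G t x W * rsq (affine_form vq bq G t x W) +
  (affine_form vp bp G t x W * affine_form (derive1 vq) (derive_coef bq) G t x W) *
  (- 2 * (rsq (affine_form vq bq G t x W) * (rsq (affine_form vq bq G t x W) * rsq (affine_form vq bq G t x W)))).

(** For W in the domain this contains [0, 1] and, by [Xnear], a neighbourhood of each of its points,
    as two-sided derivatives in alpha require. *)
Definition X (G W : E) := [set x : R | forall t, t \in `[A, b] -> 0 < affine_form vq bq G t x W].

Lemma X01 G W x : S G W -> x \in `[0, 1] -> X G W x.
Proof. by move=> SW xI t tI; apply: lt_le_trans c_gt0 (qc SW tI xI). Qed.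

(** The derivative in W stays existential: later steps use only its bounds and its representation,
    both recorded in [C11_tx]. *)
Lemma C11_tx_phi : exists dphi, C11_tx X phi dphi.
Proof.
have lq := C11_tx_affine sigma_gt0 M_ge0 MG_ge0 S_H1 S_M X (C1_cont svq) (fun k => C1_cont (sbq k)).
have lp := C11_tx_affine sigma_gt0 M_ge0 MG_ge0 S_H1 S_M X (C1_cont svp) (fun k => C1_cont (sbp k)).
have lr := C11_tx_rsq sigma_gt0 S_H1 c_gt0 lq qc (fun G W t x _ h tI => h t tI).
by eexists; exact: (C11_tx_mul sigma_gt0 S_H1 lp lr).
Qed.

Lemma C11_tx_phix : exists dphi, C11_tx X phix dphi.
Proof.
have lq := C11_tx_affine sigma_gt0 M_ge0 MG_ge0 S_H1 S_M X (C1_cont svq) (fun k => C1_cont (sbq k)).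
have lp := C11_tx_affine sigma_gt0 M_ge0 MG_ge0 S_H1 S_M X (C1_cont svp) (fun k => C1_cont (sbp k)).
have lqx := C11_tx_affine sigma_gt0 M_ge0 MG_ge0 S_H1 S_M X (C1_derive1 svq).1 (fun k => (C1_derive1 (sbq k)).1).
have lpx := C11_tx_affine sigma_gt0 M_ge0 MG_ge0 S_H1 S_M X (C1_derive1 svp).1 (fun k => (C1_derive1 (sbp k)).1).
have lr := C11_tx_rsq sigma_gt0 S_H1 c_gt0 lq qc (fun G W t x _ h tI => h t tI).
have mulL := fun f df g dg => @C11_tx_mul R A sigma N B sigma_gt0 MG S S_H1 X f df g dg.
eexists; apply: C11_tx_add; first exact: (mulL _ _ _ _ lpx lr).
apply: (mulL _ _ _ _ (mulL _ _ _ _ lp lqx)).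
by apply: C11_tx_scale => //; exact: (mulL _ _ _ _ lr (mulL _ _ _ _ lr lr)).
Qed.

Lemma is_derive_bigsum (I : Type) (s : seq I) (f df : I -> R -> R) x :
  (forall i, is_derive x (1 : R) (f i) (df i x)) ->
  is_derive x (1 : R) (fun y => \sum_(i <- s) f i y) (\sum_(i <- s) df i x).
Proof.
move=> d; elim: s => [|i s ih].
  rewrite big_nil (_ : (fun y => _) = cst 0); first exact: is_derive_cst.
  by apply/funext => y; rewrite big_nil.
rewrite big_cons (_ : (fun y => _) = (fun y => f i y + \sum_(j <- s) f j y)); first exact: is_deriveD.
by apply/funext => y; rewrite big_cons.
Qed.

Lemma is_derive_affine_form v be G W t x : is_C1 v -> (forall k, is_C1 (be k)) ->
  is_derive x (1 : R) (fun y => affine_form v be G t y W) (affine_form (derive1 v) (derive_coef be) G t x W).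
Proof.
move=> sv sb; apply: is_deriveD; first exact: (C1_derive1 sv).2.
apply: (@is_derive_bigsum _ _ (fun k y => be k y * (comp W k t + comp G k t)) (fun k x => derive_coef be k x * (comp W k t + comp G k t)) x) => k.
have d := (C1_derive1 (sb k)).2 x.
by apply: is_derive_eq; rewrite /GRing.scale/=; rewrite mulr0 add0r mulrC.
Qed.

Lemma is_derive_rsq (q : R -> R) dq x : 0 < q x -> is_derive x (1 : R) q dq ->
  is_derive x (1 : R) (fun y => rsq (q y)) (drsq (q x) * dq).
Proof.
move=> q0 d.
have ds := @is_derive1_sqrt R (q x) q0.
have s0 : 0 < Num.sqrt (q x) by rewrite sqrtr_gt0.
have d1 := is_derive1_comp ds d.
have d2 : is_derive x (1 : R) (fun y => 2 * Num.sqrt (q y)) (2 * ((2 * Num.sqrt (q x))^-1 * dq)).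
  exact: (is_deriveZ 2 d1).
have n0 : 2 * Num.sqrt (q x) != 0 by rewrite mulf_neq0// gt_eqF.
apply: (is_derive_conv (@is_deriveV R (fun y => 2 * Num.sqrt (q y)) x _ 1 n0 d2)) => //.
by rewrite /GRing.scale/= /drsq /rsq; field; rewrite gt_eqF.
Qed.

Lemma is_derive_phi G W t x : S G W -> X G W x -> t \in `[A, b] ->
  is_derive x (1 : R) (fun y => phi G t y W) (phix G t x W).
Proof.
move=> SW Xx tI.
have dq := is_derive_affine_form G W t x svq sbq; have dp := is_derive_affine_form G W t x svp sbp.
have dr := @is_derive_rsq (fun y => affine_form vq bq G t y W) _ x (Xx _ tI) dq.
apply: (is_derive_conv (@is_deriveM R R (fun y => affine_form vp bp G t y W) (fun y => rsq (affine_form vq bq G t y W)) x 1 _ _ dp dr)) => //.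
rewrite /GRing.scale/= /phix /drsq; ring.
Qed.

Lemma LCont_contt Y f x : LCont A sigma Y f -> Y x -> continuous (fun t => f (cl t) x).
Proof.
move=> cf Yx t; apply: (@continuous_comp _ _ _ (fun t => (t, x)) (fun p : R * R => f (cl p.1) p.2)); last exact: cf.
by apply: continuous_pair; [exact: cvg_id|exact: cvg_cst].
Qed.

(** At x the affine form is at least c for all heights, and its continuity in alpha is uniform in
    the height. *)
Lemma Xnear G W (x : R) : admissible G -> S G W -> x \in `[0, 1] -> \forall y \near x, X G W y.
Proof.
move=> gG SW xI.
have [_ lq] := C11_tx_affine sigma_gt0 M_ge0 MG_ge0 S_H1 S_M (fun _ _ => setT) (C1_cont svq) (fun k => C1_cont (sbq k)).
have [cq _] := lq _ _ gG SW.
have := @uniform_near_slice R R A b (fun t y => affine_form vq bq G (cl t) y W) x c c_gt0 (fun t _ => cq t x I).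
apply: filterS => y hy t tI; have := hy t tI; rewrite (clamp_id tI).
have := qc SW tI xI; rewrite ltr_norml => h1 /andP[h2 _].
by lra.
Qed.

(** Differentiation under the integral sign: near x the function [phix] stays within 1 of its value
    at x, uniformly in t, so the absolute value at x plus 1 is an integrable majorant. The interval
    around x may leave [0, 1]. *)
Lemma int_phi_derive G W (z x : R) : admissible G -> S G W -> z \in `[A, b] -> x \in `[0, 1] ->
  is_derive x (1 : R) (fun y => \int[mu]_(t in `[z, b]) phi G t y W) (\int[mu]_(t in `[z, b]) phix G t x W).
Proof.
move=> gG SW zI xI.
have [dphi [_ lphi]] := C11_tx_phi; have [dphix [_ lphix]] := C11_tx_phix.
have [cphi _] := lphi _ _ gG SW; have [cphix _] := lphix _ _ gG SW.
have n1 := Xnear gG SW xI.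
have n2 := @uniform_near_slice R R A b (fun t y => phix G (cl t) y W) x 1 ltr01 (fun t _ => cphix t x (X01 SW xI)).
have n12 : nbhs x (fun y => X G W y /\ forall t, t \in `[A, b] -> `|phix G (cl t) y W - phix G (cl t) x W| < 1) by exact: filterI n1 n2.
move: n12 => /nbhs_ballP[e /= e0 He].
pose u := x - e; pose v := x + e.
have Hb y : y \in `]u, v[ -> X G W y /\ forall t, t \in `[A, b] -> `|phix G (cl t) y W - phix G (cl t) x W| < 1.
  by move=> yI; apply: He; rewrite -ball_normE /= ltr_distlC; move: yI; rewrite in_itv.
have xuv : `]u, v[%classic x by rewrite /= in_itv/= /u /v ltrDl ltrBlDr ltrDl e0.
have i1 f y : LCont A sigma (X G W) f -> X G W y -> mu.-integrable `[z, b] (EFin \o (fun t => f t y)).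
  move=> cf Xy; apply: itg_sub => //; apply: (cont_cl (sigma := sigma)).
  exact: LCont_contt cf Xy.
pose f y t := phi G t y W.
have intf y : `]u, v[%classic y -> mu.-integrable `[z, b] (EFin \o f y).
  by move=> yI; apply: (i1 (fun t x => phi G t x W)) => //; have [] := Hb y yI.
have dphi_ y t : `]u, v[%classic y -> `[z, b]%classic t -> is_derive y (1 : R) (fun y => phi G t y W) (phix G t y W).
  by move=> yI /(sub_zb zI) tI; apply: is_derive_phi => //; have [] := Hb y yI.
have derf1 y t : `]u, v[%classic y -> `[z, b]%classic t -> derivable (f ^~ t) y 1.
  by move=> yI tI; have [] := dphi_ y t yI tI.
have pe y t : `]u, v[%classic y -> `[z, b]%classic t -> partial1of2 f y t = phix G t y W.
  by move=> yI tI; rewrite partial1of2E; have [_ ->] := dphi_ y t yI tI.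
pose K t := `|phix G t x W| + 1.
have K0 t : 0 <= K t by rewrite addr_ge0.
have iK : mu.-integrable `[z, b] (EFin \o K).
  apply: itgD; last exact: itg_cst.
  have := i1 (fun t x => phix G t x W) x cphix (X01 SW xI) => i.
  by have := integrable_norm i.
have Kub y t : `]u, v[%classic y -> `[z, b]%classic t -> `|partial1of2 f y t| <= K t.
  move=> yI tI; rewrite pe//; have [_ /(_ t (sub_zb zI tI))] := Hb y yI.
  rewrite (clamp_id (sub_zb zI tI)) /K => h1.
  rewrite -(subrK (phix G t x W) (phix G t y W)); apply: le_trans (ler_normD _ _) _.
  by rewrite addrC lerD2l ltW.
have d1 := @derivable_under_integral R _ _ mu f `[z, b]%classic (measurable_itv _) x u v xuv intf derf1 K K0 iK Kub.
have d2 := @differentiation_under_integral R _ _ mu f `[z, b]%classic (measurable_itv _) x u v xuv intf derf1 K K0 iK Kub.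
apply: DeriveDef; first exact: d1.
rewrite -derive1E; apply: eq_trans d2 _.
by apply: eq_Rintegral => t; rewrite inE => tI; exact: pe.
Qed.

Definition chflux (G : E) (F : grid_vec R N B) z x W :=
  - (\int[mu]_(t in `[z, b]) phi G t x W) + \sum_(k : node) bp k x * F k.1 k.2.1 k.2.2.
Definition chfluxx (G : E) (F : grid_vec R N B) z x W :=
  - (\int[mu]_(t in `[z, b]) phix G t x W) + \sum_(k : node) derive_coef bp k x * F k.1 k.2.1 k.2.2.

Lemma chflux_derive1 G F W z x : admissible G -> S G W -> z \in `[A, b] -> x \in `[0, 1] ->
  derive1 (fun y => chflux G F z y W ^+ 2) x = 2 * (chflux G F z x W * chfluxx G F z x W).
Proof.
move=> gG SW zI xI.
have d1 := @is_deriveN R R R (fun y => \int[mu]_(t in `[z, b]) phi G t y W) x 1 _ (int_phi_derive gG SW zI xI).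
have d2 : is_derive x (1 : R) (fun y => \sum_(k : node) bp k y * F k.1 k.2.1 k.2.2)
   (\sum_(k : node) derive_coef bp k x * F k.1 k.2.1 k.2.2).
  apply: (@is_derive_bigsum _ _ (fun k y => bp k y * F k.1 k.2.1 k.2.2) (fun k x => derive_coef bp k x * F k.1 k.2.1 k.2.2) x) => k.
  have d := (C1_derive1 (sbp k)).2 x.
  by apply: is_derive_eq; rewrite /GRing.scale/=; rewrite mulr0 add0r mulrC.
have d3 : is_derive x (1 : R) (fun y => chflux G F z y W) (chfluxx G F z x W).
  have d4 := @is_deriveD R R R _ (fun y => \sum_(k : node) bp k y * F k.1 k.2.1 k.2.2) x 1 _ _ d1 d2.
  exact: (is_derive_conv d4).
rewrite derive1E; have -> : (fun y => chflux G F z y W ^+ 2) = (fun y => chflux G F z y W * chflux G F z y W).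
  by apply/funext => y; rewrite expr2.
have [_ ->] := @is_deriveM R R (fun y => chflux G F z y W) (fun y => chflux G F z y W) x 1 _ _ d3 d3.
by rewrite /GRing.scale/=; ring.
Qed.

Lemma C11_z_channel (psi : R -> R) : continuous psi -> exists df,
  @C11_z R A sigma h N B MG MF S (fun G F z W =>
    \int[mu]_(x in `[0, 1]) (psi x * (2 * (chflux G F z x W * chfluxx G F z x W)))) df.
Proof.
move=> cpsi.
have [dphi lphi] := C11_tx_phi; have [dphix lphix] := C11_tx_phix.
have X1 G W x : S G W -> x \in `[0, 1] -> X G W x by exact: X01.
have g1 := C11_zx_int sigma_gt0 h_gt0 MF S_H1 lphi X1.
have g2 := C11_zx_int sigma_gt0 h_gt0 MF S_H1 lphix X1.
have gf := @C11_zx_fun R A sigma h N B sigma_gt0 MG MF S S_H1.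
have mulg := fun f df g dg => @C11_zx_mul R A sigma h N B sigma_gt0 MG MF S S_H1 f df g dg.
have c1 : continuous (fun _ : R => - 1 : R) by move=> x; exact: cvg_cst.
have c2 : continuous (fun _ : R => 2 : R) by move=> x; exact: cvg_cst.
have f1 := C11_zx_add (mulg _ _ _ _ (gf _ c1) g1) (C11_zx_F h sigma_gt0 MG MF S_H1 (fun k => C1_cont (sbp k))).
have f2 := C11_zx_add (mulg _ _ _ _ (gf _ c1) g2) (C11_zx_F h sigma_gt0 MG MF S_H1 (fun k => (C1_derive1 (sbp k)).1)).
have f3 := mulg _ _ _ _ (gf _ cpsi) (mulg _ _ _ _ (gf _ c2) (mulg _ _ _ _ f1 f2)).
eexists.
have := C11_z_int sigma_gt0 S_H1 f3.
congr C11_z; apply/funext => G; apply/funext => F; apply/funext => z; apply/funext => W.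
by apply: eq_Rintegral => x _; rewrite /chflux /chfluxx /derive_coef !mulN1r.
Qed.

End Channel.

(** * Point values and central differences as linear forms *)

Section Stencil.
Context {R : realType} (N B : nat) (A a h : R).
Local Notation E := (semidiscrete R N B).
Local Notation pt := ('I_B.+1 * 'I_B.+1)%type.
Implicit Types (M : 'M[R]_B.+1) (cf : pt -> R).

(* Point evaluations and central differences are both of this form, so that u, u_x and u_y are
   affine forms of the same kind. *)
Definition stencil cf M := \sum_(p : pt) cf p * M p.1 p.2.

Definition at_pt (q p : pt) : R := (p == q)%:R.
Definition x_diff (q p : pt) : R :=
  (2 * h)^-1 * (at_pt (inord q.1.+1, q.2) p - at_pt (inord q.1.-1, q.2) p).
Definition y_diff (q p : pt) : R :=
  (2 * h)^-1 * (at_pt (q.1, inord q.2.+1) p - at_pt (q.1, inord q.2.-1) p).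

Lemma stencil_at q M : stencil (at_pt q) M = M q.1 q.2.
Proof.
rewrite /stencil (bigD1 q)//= /at_pt eqxx mul1r big1 ?addr0// => p /negbTE ->.
by rewrite mul0r.
Qed.

Lemma stencil_diff k q1 q2 M :
  stencil (fun p => k * (at_pt q1 p - at_pt q2 p)) M = (M q1.1 q1.2 - M q2.1 q2.2) * k.
Proof.
rewrite -(stencil_at q1) -(stencil_at q2) /stencil -sumrB mulr_suml.
by apply: eq_bigr => p _; ring.
Qed.

Lemma stencil_x q M : stencil (x_diff q) M = Dx h M q.1 q.2.
Proof. by rewrite stencil_diff mxE. Qed.

Lemma stencil_y q M : stencil (y_diff q) M = Dy h M q.1 q.2.
Proof. by rewrite stencil_diff mxE. Qed.

Lemma stencil_add cf M1 M2 : stencil cf (M1 + M2) = stencil cf M1 + stencil cf M2.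
Proof. by rewrite /stencil -big_split; apply: eq_bigr => p _; rewrite mxE mulrDr. Qed.

Definition coefu cf (k : node N B) (x : R) := cf k.2 * Psi a k.1 x.

Lemma stencil_expand cf (c : grid_vec R N B) x :
  stencil cf (Defs.expand a c x) = \sum_k coefu cf k x * c k.1 k.2.1 k.2.2.
Proof.
rewrite /stencil -(pair_bigA _ (fun n p => coefu cf (n, p) x * c n p.1 p.2))/= exchange_big.
apply: eq_bigr => p _; rewrite /Defs.expand summxE mulr_sumr; apply: eq_bigr => n _.
by rewrite mxE /coefu mulrA.
Qed.

Lemma stencil_u cf (G W : E) t x :
  stencil cf (u A a h G W t x) = affine_form (fun x => stencil cf (u0 A h x)) (coefu cf) G t x W.
Proof.
rewrite /u !stencil_add !stencil_expand /affine_form -addrA -big_split; congr (_ + _).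
by apply: eq_bigr => k _; rewrite /= -mulrDr.
Qed.

Lemma C1_coefu cf k : is_C1 (coefu cf k).
Proof. by apply: C1_scale; exact: C1_Psi. Qed.

Lemma C1_stencil_u0 cf : 0 < A -> is_C1 (fun x => stencil cf (u0 A h x)).
Proof. by move=> A0; apply: C1_sum => p; apply: C1_scale; exact: C1_u0. Qed.

End Stencil.

(** * The residual and the functional *)

Section Operator.
Context {R : realType}.
Notation mu := (@lebesgue_measure R).
Variables (A sigma a h : R) (N B : nat).
Hypotheses (A_gt0 : 0 < A) (sigma_gt0 : 0 < sigma) (h_gt0 : 0 < h).
Local Notation b := (A + sigma).
Local Notation E := (semidiscrete R N B).
Local Notation node := (node N B).
Local Notation pt := ('I_B.+1 * 'I_B.+1)%type.
Variables (M MG MF c : R).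
Hypotheses (M_ge0 : 0 <= M) (MG_ge0 : 0 <= MG) (MF_ge0 : 0 <= MF) (c_gt0 : 0 < c).

(** A lower bound on u replaces the positivity of w + g. For suitable M and c this set contains a
    uniform neighbourhood of the closure of K^h(R), as Frechet derivatives at its points require. *)
Definition dom (G : E) : set E := [set W : E | [/\ H1_0 A sigma W,
  forall k t, t \in `[A, b] -> `|comp W k t| <= M
  & forall t x i j, t \in `[A, b] -> x \in `[0, 1] -> c <= u A a h G W t x i j]].

Let Ab : A < b. Proof. by rewrite ltrDl. Qed.

Let dom_H1 G W : dom G W -> H1_0 A sigma W. Proof. by case. Qed.
Let dom_M G W x t : dom G W -> t \in `[A, b] -> `|comp W x t| <= M.
Proof. by case=> _ h1 _; exact: h1. Qed.

Local Notation v0 cf := (fun x => stencil cf (u0 A h x)).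
Local Notation be cf := (@coefu R N B a cf).

Definition node_flux (q : pt) cf := @chflux R A sigma N B (v0 (at_pt q)) (v0 cf) (be (at_pt q)) (be cf).
Definition node_fluxx (q : pt) cf := @chfluxx R A sigma N B (v0 (at_pt q)) (v0 cf) (be (at_pt q)) (be cf).

Let dom_c q G W t x : dom G W -> t \in `[A, b] -> x \in `[0, 1] ->
  c <= affine_form (v0 (at_pt q)) (be (at_pt q)) G t x W.
Proof. by case=> _ _ h1 tI xI; rewrite -stencil_u stencil_at; exact: h1. Qed.

Lemma node_fluxE (D : 'M[R]_B.+1 -> 'M[R]_B.+1) q cf G F W z x : (forall M, D M q.1 q.2 = stencil cf M) ->
  flux A sigma a h G F D W z q.1 q.2 x = node_flux q cf G F z x W.
Proof.
move=> DE; rewrite /flux /node_flux /chflux DE stencil_expand; congr (- _ + _).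
apply: eq_Rintegral => t _; rewrite DE /phi /rsq -!stencil_u; congr (_ / (2 * Num.sqrt _)).
by rewrite stencil_at.
Qed.

Definition node_P n q cf G F z W := \int[mu]_(x in `[0, 1]) (Psi a n x * (2 * (node_flux q cf G F z x W * node_fluxx q cf G F z x W))).

Lemma node_PE (D : 'M[R]_B.+1 -> 'M[R]_B.+1) q cf n G F W z : admissible A sigma MG G -> dom G W -> z \in `[A, b] ->
  (forall M, D M q.1 q.2 = stencil cf M) ->
  \int[mu]_(x in `[0, 1]) (Psi a n x * derive1 (fun y => flux A sigma a h G F D W z q.1 q.2 y ^+ 2) x) =
  node_P n q cf G F z W.
Proof.
move=> gG SW zI DE; apply: eq_Rintegral => x; rewrite inE => xI; congr (_ * _).
have -> : (fun y => flux A sigma a h G F D W z q.1 q.2 y ^+ 2) = (fun y => node_flux q cf G F z y W ^+ 2).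
  by apply/funext => y; rewrite (node_fluxE _ _ _ _ _ DE).
apply: (chflux_derive1 sigma_gt0 M_ge0 MG_ge0 dom_H1 dom_M _ _ _ _ c_gt0 (@dom_c q) F gG SW zI xI).
- exact: C1_stencil_u0.
- exact: C1_stencil_u0.
- by move=> k; exact: C1_coefu.
- by move=> k; exact: C1_coefu.
Qed.

Lemma C11_z_node_P n q cf : exists df, C11_z A sigma h MG MF dom (node_P n q cf) df.
Proof.
apply: (C11_z_channel sigma_gt0 h_gt0 MF M_ge0 MG_ge0 dom_H1 dom_M _ _ _ _ c_gt0 (@dom_c q)).
- exact: C1_stencil_u0.
- exact: C1_stencil_u0.
- by move=> k; exact: C1_coefu.
- by move=> k; exact: C1_coefu.
- by apply: C1_cont; exact: C1_Psi.
Qed.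

(** One scalar component of W - M_N^{-1} P in which the alpha-derivative inside P has already been
    computed. *)
Definition residual (k : node) G F z W := comp W k z +
  \sum_(m < N) - invmx (MN a N) k.1 m * (node_P m k.2 (x_diff h k.2) G F z W + node_P m k.2 (y_diff h k.2) G F z W).

Lemma residualE k G F z W : admissible A sigma MG G -> dom G W -> z \in `[A, b] ->
  comp (fun z n => W z n - MinvP A sigma a h G F W z n) k z = residual k G F z W.
Proof.
move=> gG SW zI; rewrite /comp mxE /residual; congr (_ + _).
rewrite mxE summxE -sumrN; apply: eq_bigr => m _; rewrite !mxE mulNr; congr (- (_ * _)).
by rewrite (node_PE _ F gG SW zI (fun M => esym (stencil_x h k.2 M))) (node_PE _ F gG SW zI (fun M => esym (stencil_y h k.2 M))).
Qed.

Lemma C11_z_residual k : exists df, C11_z A sigma h MG MF dom (residual k) df.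
Proof.
have /choice[df Hdf] : forall m, exists df, C11_z A sigma h MG MF dom
    (fun G F z W => - invmx (MN a N) k.1 m * (node_P m k.2 (x_diff h k.2) G F z W + node_P m k.2 (y_diff h k.2) G F z W)) df.
  move=> m.
  have [d1 h1] := C11_z_node_P m k.2 (x_diff h k.2); have [d2 h2] := C11_z_node_P m k.2 (y_diff h k.2).
  by eexists; exact: (C11_z_scale sigma_gt0 _ (C11_z_add sigma_gt0 h1 h2)).
by eexists; exact: (C11_z_add sigma_gt0 (C11_z_comp h sigma_gt0 MG MF dom_H1 dom_M k) (C11_z_sum sigma_gt0 dom_H1 _ Hdf)).
Qed.

Definition J0 lambda G F W := expR (- 2 * lambda * A) * (h ^+ 2 *
  \sum_(k : node | innode k) \int[mu]_(z in `[A, b]) (expR (lambda * z) * residual k G F z W) ^+ 2).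

Lemma continuous_weight lambda : continuous (fun z : R => expR (lambda * z)).
Proof.
move=> z; apply: (@continuous_comp _ _ _ (fun z => lambda * z) expR); last exact: continuous_expR.
by apply: cvgM; [exact: cvg_cst|exact: cvg_id].
Qed.

Lemma C11_Omega_J0 lambda : exists dJ, C11_Omega A sigma h MG MF dom (J0 lambda) dJ.
Proof.
have /choice[df Hdf] := C11_z_residual.
have h1 k := C11_Omega_sqr sigma_gt0 h_gt0 dom_H1 (Hdf k) (@continuous_weight lambda).
have h2 := C11_Omega_sum sigma_gt0 dom_H1 (index_enum _) (@innode N B) h1.
by eexists; exact: (C11_Omega_scale sigma_gt0 _ (C11_Omega_scale sigma_gt0 _ h2)).
Qed.

Lemma ipL2_ge0 (Q : E) : 0 <= ipL2 A sigma h Q Q.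
Proof.
apply: Rintegral_ge0 => z _; rewrite mulr_ge0 ?sqr_ge0//.
by apply: sumr_ge0 => k _; apply: sumr_ge0 => i _; apply: sumr_ge0 => j _; rewrite -expr2 sqr_ge0.
Qed.

(** On [dom] the [derive1] inside P has its explicit value. Continuity of the residual then supplies
    the square integrability under which the weighted norm becomes a sum over interior nodes. *)
Lemma J_J0 lambda gamma G F W : admissible A sigma MG G -> admissibleF MF F -> dom G W ->
  J A sigma a h G F lambda gamma W = J0 lambda G F W + gamma * normH1 A sigma h W ^+ 2.
Proof.
move=> gG gF SW; rewrite /J /J0; congr (_ * _ + _).
rewrite /normL2 sqr_sqrtr ?ipL2_ge0//.
set Q : E := fun z n => _.
have QE k z : z \in `[A, b] -> comp Q k z = expR (lambda * z) * residual k G F z W.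
  by move=> zI; rewrite -residualE// /comp /Q mxE.
have L2Q k : innode k -> L2c A b (comp Q k).
  move=> _; have [df [_ /(_ _ _ _ gG gF SW)[cr _]]] := C11_z_residual k.
  have cw : continuous ((fun z => expR (lambda * z) * residual k G F z W) \o clamp A b).
    move=> z; apply: cvgM; last exact: cr.
    by apply: (@continuous_comp _ _ _ (clamp A b) (fun z => expR (lambda * z))); [exact: continuous_clamp|exact: continuous_weight].
  apply: L2c_eq (L2c_cont A b cw) => z zI.
  rewrite (QE k z zI).
  change (expR (lambda * clamp A b z) * residual k G F (clamp A b z) W = expR (lambda * z) * residual k G F z W).
  by rewrite (clamp_id zI).
rewrite (ipL2E h L2Q L2Q); congr (_ * _); apply: eq_bigr => k ki.
by apply: eq_Rintegral => z; rewrite inE => zI; rewrite (QE k z zI) -expr2.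
Qed.

End Operator.

(** * Gradients, variational inequalities and contraction in an abstract space *)

Section ProjectedGradient.
Context {R : realType} {E : lmodType R}.
Variables (H : set E) (ip : E -> E -> R).
Hypothesis Hip : is_ip H ip.
Local Notation n := (nrm ip).
Implicit Types (J : E -> R) (W V g : E) (K S : set E).

Definition grad J W g := H g /\ forall eps : R, 0 < eps -> exists2 delta : R, 0 < delta &
  forall V, H V -> n V < delta -> `|J (W + V) - J W - ip g V| <= eps * n V.

Lemma small_scale (delta : R) V : 0 < delta -> H V ->
  exists2 t0 : R, 0 < t0 & forall t : R, 0 < t <= t0 -> H (t *: V) /\ n (t *: V) < delta.
Proof.
move=> d0 HV; have p : 0 < n V + 1 by rewrite ltr_wpDl// nrm_ge0.
exists (delta / (n V + 1)); first exact: divr_gt0.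
move=> t /andP[t0 tt]; split; first exact: (subspZ Hip).
rewrite (nrmZ Hip)// gtr0_norm//; move: tt; rewrite ler_pdivlMr// mulrDr mulr1 => h1.
by apply: lt_le_trans h1; rewrite ltrDl.
Qed.

(** Compare the two expansions along t V for a small t > 0 and divide by t. *)
Lemma grad_uniq J W g1 g2 V : grad J W g1 -> grad J W g2 -> H V -> ip g1 V = ip g2 V.
Proof.
move=> [H1 G1] [H2 G2] HV; apply/eqP; rewrite -subr_eq0 -normr_le0; apply/ler_addgt0Pl => e e0.
have p : 0 < n V + 1 by rewrite ltr_wpDl// nrm_ge0.
(* With this precision the two errors at t V add up to at most t e; the +1 covers a V of norm
   zero. *)
have e1 : 0 < e / (2 * (n V + 1)) by rewrite divr_gt0// mulr_gt0.
have [d1 d10 D1] := G1 _ e1; have [d2 d20 D2] := G2 _ e1.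
have [t1 t10 T1] := small_scale d10 HV; have [t2 t20 T2] := small_scale d20 HV.
have tm : 0 < Num.min t1 t2 by rewrite lt_min t10.
set t := Num.min t1 t2 in tm.
have tm1 : 0 < t <= t1 by rewrite tm ge_min lexx.
have tm2 : 0 < t <= t2 by rewrite tm ge_min lexx orbT.
have [HtV nt1] := T1 t tm1; have [_ nt2] := T2 t tm2.
have := D1 _ HtV nt1; have := D2 _ HtV nt2.
rewrite !(ipZr Hip)// (nrmZ Hip)// (gtr0_norm tm) => h2 h1.
have nV := nrm_ge0 ip V.
have h3 : t * `|ip g1 V - ip g2 V| <= t * (e * (n V / (n V + 1))).
  rewrite -{1}(gtr0_norm tm) -normrM.
  rewrite (_ : t * (ip g1 V - ip g2 V) = (J (W + t *: V) - J W - t * ip g2 V) - (J (W + t *: V) - J W - t * ip g1 V)); last by ring.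
  apply: le_trans (ler_normB _ _) _; apply: le_trans (lerD h2 h1) _.
  by rewrite le_eqVlt; apply/orP; left; apply/eqP; field; rewrite gt_eqF.
move: h3; rewrite ler_pM2l// => h3; apply: le_trans h3 _.
by rewrite addr0; apply: ler_piMr; [exact: ltW|rewrite ler_pdivrMr// mul1r lerDl].
Qed.

Variables (n2 : E -> R) (K S : set E) (J f : E -> R) (df : E -> E -> R) (L gamma : R).
Hypothesis n2_ge0 : forall V, H V -> 0 <= n2 V.
Hypothesis n2_le : forall V, H V -> n2 V <= n V.
Hypothesis n2N : forall V, H V -> n2 (- V) = n2 V.
Hypothesis S_H : forall W, S W -> H W.
Hypothesis K_S : exists2 delta : R, 0 < delta & forall W V, K W -> H V -> n V < delta -> S (W + V).
Hypothesis K_convex : forall W1 W2 (t : R), K W1 -> K W2 -> 0 <= t <= 1 -> K (W1 + t *: (W2 - W1)).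
Hypothesis fC : C11 S H n2 L f df.
Hypothesis df_rep : forall W, S W -> exists2 g, H g & forall V, H V -> ip g V = df W V.
Hypothesis JE : forall W, S W -> J W = f W + gamma * n W ^+ 2.
Hypothesis gamma01 : 0 < gamma < 1.

Lemma KS W : K W -> S W.
Proof.
have [d d0 Hd] := K_S; have H0 : H 0 by have [[]] := Hip.
move=> KW; rewrite -[W]addr0; apply: Hd => //.
by rewrite /nrm -[X in ip X](scale0r (0 : E)) (ipZl Hip)// mul0r sqrtr0.
Qed.

Lemma KH W : K W -> H W.
Proof. by move=> /KS/S_H. Qed.

(** The quadratic remainder of f and the one left by the regularization add up to at most (L +
    gamma) |V|^2, hence to at most eps |V| once |V| < eps / (L + gamma). [K_S] lets V take all
    directions, even at boundary points of K. *)
Lemma grad_ex W : K W -> exists2 g, grad J W g & forall V, H V -> ip g V = df W V + 2 * gamma * ip W V.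
Proof.
move=> KW; have SW := KS KW; have HW := S_H SW; have /andP[g0 g1] := gamma01.
have [g Hg gE] := df_rep SW; have HgW := subspZ Hip (2 * gamma) HW.
have gE2 V : H V -> ip (g + (2 * gamma) *: W) V = df W V + 2 * gamma * ip W V.
  by move=> HV; rewrite (ipDl Hip)// gE// (ipZl Hip).
exists (g + (2 * gamma) *: W) => //; split; first exact: (subspD Hip).
move=> e e0; have [d d0 Hd] := K_S; have [L0 _ _ fL] := fC.
have p : 0 < L + gamma by rewrite ltr_wpDl.
exists (Num.min d (e / (L + gamma))); first by rewrite lt_min d0 divr_gt0.
move=> V HV; rewrite lt_min => /andP[nd ne].
have SV := Hd _ _ KW HV nd; have [_ _ rem] := fL _ _ SW SV.
have nV := nrm_ge0 ip V.
rewrite gE2// !JE// !(sqr_nrm Hip)//; last exact: (subspD Hip).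
rewrite (ipDl Hip) ?(ipDr Hip)//; [|exact: (subspD Hip)]; rewrite (ipC Hip HV HW).
have eWV : W + V - W = V by rewrite addrC addKr.
rewrite eWV in rem.
rewrite (_ : _ - _ = (f (W + V) - f W - df W V) + gamma * ip V V); last by ring.
apply: le_trans (ler_normD _ _) _; rewrite [X in _ + X]ger0_norm; last first.
  by rewrite mulr_ge0 ?(ltW g0)// (ip_ge0 Hip).
rewrite -(sqr_nrm Hip)//; apply: (@le_trans _ _ ((L + gamma) * n V * n V)).
  rewrite -mulrA -expr2 mulrDl lerD2r; apply: le_trans rem _.
  by rewrite ler_wpM2l// lerXn2r ?nnegrE ?n2_ge0// n2_le.
by rewrite ler_wpM2r// mulrC -ler_pdivlMr// ltW.
Qed.

Lemma grad_eq W g V : K W -> grad J W g -> H V -> ip g V = df W V + 2 * gamma * ip W V.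
Proof.
move=> KW Gg HV; have [g' Gg' gE] := grad_ex KW.
by rewrite (grad_uniq Gg Gg' HV) gE.
Qed.

Lemma le0_small (x y : R) : 0 <= y -> (forall t, 0 < t <= 1 -> x <= t * y) -> x <= 0.
Proof.
move=> y0 h; apply/ler_addgt0Pl => e e0; rewrite addr0.
have p : 0 < y + e + 1 by lra.
have q : y + e < y + e + 1 by rewrite ltrDl.
apply: le_trans (h (e / (y + e + 1)) _) _.
  by rewrite divr_gt0// ler_pdivrMr// mul1r; lra.
by rewrite mulrAC ler_pdivrMr// ler_pM2l//; lra.
Qed.

(** Comparing P with the points P + t (W - P) of the convex set and expanding the squares gives 2 ip
    (V - P) (W - P) <= t |W - P|^2 for all t in ]0, 1]. *)
Lemma projection_vi V P W : H V -> K P -> (forall W', K W' -> n (V - P) <= n (V - W')) ->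
  K W -> ip (V - P) (W - P) <= 0.
Proof.
move=> HV KP Pm KW; have HP := KH KP; have HW := KH KW.
have He := subspB Hip HW HP; have Hv := subspB Hip HV HP.
suff : 2 * ip (V - P) (W - P) <= 0 by lra.
apply: (@le0_small _ (ip (W - P) (W - P))); first exact: (ip_ge0 Hip).
move=> t /andP[t0 t1].
have t01 : 0 <= t <= 1 by rewrite (ltW t0).
have := Pm _ (K_convex KP KW t01).
have Hte := subspZ Hip t He.
have e : V - (P + t *: (W - P)) = (V - P) - t *: (W - P) by rewrite opprD addrA.
rewrite e; set v := V - P in Hv *; set w := W - P in He Hte *.
rewrite -(@ler_pXn2r _ 2)// ?nnegrE ?nrm_ge0//.
clearbody v w; have Hvw := subspB Hip Hv Hte.
rewrite !(sqr_nrm Hip)// (ipBl Hip Hv Hte Hvw) !(ipBr Hip)// !(ipZl Hip) ?(ipZr Hip)// (ipC Hip He Hv) => h.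
rewrite -(ler_pM2l t0); lra.
Qed.

(** The difference quotients of J along the segment from the minimizer to W are nonnegative and
    approach the derivative. *)
Lemma minimizer_vi g Wm W : K Wm -> grad J Wm g -> (forall W', K W' -> J Wm <= J W') ->
  K W -> 0 <= ip g (W - Wm).
Proof.
move=> KWm [Hg Gg] Jm KW; have HWm := KH KWm; have He := subspB Hip (KH KW) HWm.
rewrite -oppr_le0; apply/ler_addgt0Pl => e e0; rewrite addr0.
have p : 0 < n (W - Wm) + 1 by rewrite ltr_wpDl// nrm_ge0.
have [d d0 D] := Gg _ (divr_gt0 e0 p).
have [t0 t00 T] := small_scale d0 He.
have tm : 0 < Num.min t0 1 by rewrite lt_min t00 ltr01.
set t := Num.min t0 1 in tm.
have tm1 : 0 < t <= t0 by rewrite tm ge_min lexx.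
have [HtV nt1] := T t tm1.
have t01 : 0 <= t <= 1 by rewrite ltW//= ge_min lexx orbT.
have := D _ HtV nt1; have := Jm _ (K_convex KWm KW t01).
rewrite (ipZr Hip)// (nrmZ Hip)// (gtr0_norm tm) => h1 h2.
have h3 : e / (n (W - Wm) + 1) * n (W - Wm) <= e.
  by rewrite mulrAC ler_pdivrMr// ler_wpM2l ?ltW// ltrDl.
have h4 : - (t * ip g (W - Wm)) <= e / (n (W - Wm) + 1) * (t * n (W - Wm)).
  by apply: le_trans (le_trans (ler_norm _) h2); lra.
apply: le_trans h3; rewrite -(ler_pM2l tm); lra.
Qed.

Hypothesis J_strong : forall W1 W2 g, K W1 -> K W2 -> grad J W1 g ->
  8^-1 * n2 (W2 - W1) ^+ 2 + gamma * n (W2 - W1) ^+ 2 <= J W2 - J W1 - ip g (W2 - W1).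

(* Adding the two convexity inequalities, the gamma-terms cancel against the derivative of the
   regularization, which leaves the monotonicity of the derivative of the principal part. *)
Lemma df_monotone W1 W2 : K W1 -> K W2 ->
  4^-1 * n2 (W2 - W1) ^+ 2 <= df W2 (W2 - W1) - df W1 (W2 - W1).
Proof.
move=> K1 K2; have H1 := KH K1; have H2 := KH K2.
have Hd := subspB Hip H2 H1; have Hd' := subspB Hip H1 H2.
have [g1 G1 E1] := grad_ex K1; have [g2 G2 E2] := grad_ex K2.
have := J_strong K1 K2 G1; have := J_strong K2 K1 G2.
have [Hg1 _] := G1; have [Hg2 _] := G2.
have e : W1 - W2 = - (W2 - W1) by rewrite opprB.
rewrite e n2N// (nrmN Hip)// (ipNr Hip)// E1// E2//.
have := sqr_nrm Hip Hd; rewrite (ipBl Hip)// => ->.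
by lra.
Qed.

(* The derivative of the principal part is Lipschitz for the L_2 norm, so that its
   L_2-monotonicity absorbs the second-order term in rho; the regularization alone contracts. *)
Lemma gradient_step (rho : R) W Wm g gm : 0 < rho -> 4 * (L ^+ 2 + 1) * rho < 1 ->
  K W -> K Wm -> grad J W g -> grad J Wm gm ->
  n ((W - rho *: g) - (Wm - rho *: gm)) <= (1 - 2 * rho * gamma) * n (W - Wm).
Proof.
move=> r0 r1 KW KWm Gg Ggm; have /andP[g0 g1] := gamma01.
have HW := KH KW; have HWm := KH KWm; have [Hg _] := Gg; have [Hgm _] := Ggm.
have Hd := subspB Hip HW HWm; have [L0 _ _ fL] := fC.
(* q represents the increment of the derivative of f alone, the regularization contributing 2 gamma
   (W - Wm). *)
pose q := (g - gm) - (2 * gamma) *: (W - Wm).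
have Hgg := subspB Hip Hg Hgm; have Hgd := subspZ Hip (2 * gamma) Hd.
have Hq : H q by exact: (subspB Hip).
have qE V : H V -> ip q V = df W V - df Wm V.
  move=> HV; rewrite /q (ipBl Hip)// (ipBl Hip)// (ipZl Hip)// (ipBl Hip)//.
  by rewrite (grad_eq KW Gg HV) (grad_eq KWm Ggm HV); ring.
have [_ lip _] := fL _ _ (KS KWm) (KS KW).
have n2d := n2_ge0 Hd; have nq := nrm_ge0 ip q.
(* Testing the increment of [df] with q itself bounds |q| by the weaker norm of W - Wm, the very
   quantity that the monotonicity bound [q2] offers. *)
have q1 : ip q q <= (L * n2 (W - Wm)) ^+ 2.
  have h1 : n q * n q <= L * n2 (W - Wm) * n q.
    rewrite -expr2 (sqr_nrm Hip)// {1}qE//.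
    apply: le_trans (ler_norm _) _; apply: le_trans (lip _ Hq) _.
    by rewrite mulrA ler_wpM2l ?mulr_ge0// n2_le.
  have h2 : n q <= L * n2 (W - Wm).
    have [->|qn0] := eqVneq (n q) 0; first exact: mulr_ge0.
    by move: h1; rewrite ler_pM2r// lt_def qn0.
  by rewrite -(sqr_nrm Hip)// lerXn2r// nnegrE mulr_ge0.
have q2 : 4^-1 * n2 (W - Wm) ^+ 2 <= ip q (W - Wm) by rewrite qE//; exact: df_monotone.
set k := 1 - 2 * rho * gamma.
have rg : rho * gamma <= rho by rewrite ler_piMr// ltW.
have rL : 0 <= rho * L ^+ 2 by rewrite mulr_ge0 ?sqr_ge0// ltW.
(* From 4 (L^2 + 1) rho < 1 come rho < 1/4, hence k >= 1/2, and rho L^2 < 1/4; together they make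
   the term in ip q q at most the cross term in ip q d. *)
have k2 : 2^-1 <= k by rewrite /k; lra.
have k0 : 0 <= k by lra.
have HkW := subspZ Hip k Hd; have Hrq := subspZ Hip rho Hq.
have -> : (W - rho *: g) - (Wm - rho *: gm) = k *: (W - Wm) - rho *: q.
  rewrite /q (scalerBr rho) scalerA [in RHS]opprB [in RHS]addrA -scalerDl.
  rewrite (_ : k + _ = 1); last by rewrite /k; ring.
  by rewrite scale1r scalerBr !opprB (addrC (rho *: gm)) addrACA (addrC (- (rho *: g))).
rewrite -(@ler_pXn2r _ 2)// ?nnegrE ?nrm_ge0 ?mulr_ge0 ?nrm_ge0//.
clearbody q; set d := W - Wm in Hd n2d q1 q2 HkW *; clearbody d.
have Hkq := subspB Hip HkW Hrq.
rewrite exprMn !(sqr_nrm Hip)// (ipBl Hip HkW Hrq Hkq) !(ipBr Hip)// !(ipZl Hip) ?(ipZr Hip)// (ipC Hip Hd Hq).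
set D := n2 d ^+ 2 in q2 *.
have D0 : 0 <= D by exact: sqr_ge0.
have q1' : rho * (rho * ip q q) <= rho * (4^-1 * D).
  apply: (ler_wpM2l (ltW r0)); apply: le_trans (ler_wpM2l (ltW r0) q1) _.
  rewrite exprMn mulrA ler_wpM2r//; lra.
have q2' : rho * (2^-1 * (4^-1 * D)) <= rho * (k * ip q d).
  by apply: (ler_wpM2l (ltW r0)); rewrite ler_pM// mulr_ge0.
set X := ip _ _ in q2' *; set Y := ip q q in q1' *; set Z := ip _ _.
have -> : k * (k * Z) - k * (rho * X) - (rho * (k * X) - rho * (rho * Y)) =
  k ^+ 2 * Z - 2 * (rho * (k * X)) + rho * (rho * Y) by ring.
lra.
Qed.

(* The variational inequalities of the projection and of the minimizer replace the
   nonexpansiveness of the projection. *)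
Lemma projected_step (rho : R) W Wm W' g gm : 0 < rho -> 4 * (L ^+ 2 + 1) * rho < 1 ->
  K W -> K Wm -> grad J W g -> grad J Wm gm -> (forall V, K V -> J Wm <= J V) ->
  K W' -> (forall V, K V -> n (W - rho *: g - W') <= n (W - rho *: g - V)) ->
  n (W' - Wm) <= (1 - 2 * rho * gamma) * n (W - Wm).
Proof.
move=> r0 r1 KW KWm Gg Ggm Jm KW' Wp; apply: le_trans (gradient_step r0 r1 KW KWm Gg Ggm).
have HW := KH KW; have HWm := KH KWm; have HW' := KH KW'; have [Hg _] := Gg; have [Hgm _] := Ggm.
have Hr := subspZ Hip rho Hg; have Hrm := subspZ Hip rho Hgm.
have HX := subspB Hip HW Hr; have HY := subspB Hip HWm Hrm.
have He := subspB Hip HW' HWm; have HT := subspB Hip HX HY.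
have vp := projection_vi HX KW' Wp KWm; have vm := minimizer_vi KWm Ggm Jm KW'.
have h : n (W' - Wm) * n (W' - Wm) <= n ((W - rho *: g) - (Wm - rho *: gm)) * n (W' - Wm).
  apply: le_trans (le_trans (ler_norm _) (ip_CS Hip HT He)).
  rewrite -expr2 (sqr_nrm Hip)//; move: vp vm.
  have -> : Wm - W' = - (W' - Wm) by rewrite opprB.
  have HXW := subspB Hip HX HW'.
  rewrite (ipNr Hip)// (ipBl Hip HX HW' He).
  rewrite (ipBl Hip HX HY He) (ipBl Hip HWm Hrm He) (ipZl Hip)//.
  rewrite (ipBl Hip HW' HWm He).
  by move=> h1 h2; have := mulr_ge0 (ltW r0) h2; lra.
have [->|q0] := eqVneq (n (W' - Wm)) 0; first exact: nrm_ge0.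
by move: h; rewrite ler_pM2r// lt_def q0 nrm_ge0.
Qed.

End ProjectedGradient.

(** * The sets K^h(R) and the convergence theorem *)

Section Main.
Context {R : realType}.
Variables (A sigma a h r : R) (N B : nat).
Hypotheses (A_gt0 : 0 < A) (sigma_gt0 : 0 < sigma) (h_gt0 : 0 < h) (hB : h^-1 = B%:R) (r_gt0 : 0 < r).
Local Notation b := (A + sigma).
Local Notation E := (semidiscrete R N B).
Local Notation node := (node N B).
Local Notation H1 := (@H1_0 R A sigma N B).
Local Notation ipH := (@ipH1 R A sigma h N B).
Local Notation nH := (nrm (@ipH1 R A sigma h N B)).
Implicit Types (G W V Q : E) (F : grid_vec R N B).

Let Ab : A <= b. Proof. by rewrite lerDl ltW. Qed.
Let Hip : is_ip H1 ipH. Proof. exact: ipH1_ip. Qed.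

(** [sup] is meaningful for bounded sets only; continuity on the segment at each of the finitely
    many nodes supplies the bound. *)
Lemma normC_ub Q k z : continuous_z A sigma Q -> z \in `[A, b] -> `|comp Q k z| <= normC A sigma Q.
Proof.
move=> cQ zI; rewrite /normC; apply: ub_le_sup; last by exists z, k.1, k.2.1, k.2.2.
have /choice[C HC] : forall k : node, exists C, 0 <= C /\ forall x, x \in `[A, b] -> `|comp Q k x| <= C.
  by move=> l; have [C C0 HC] := continuous_bounded (cQ l.1 l.2.1 l.2.2); exists C.
exists (\sum_l C l) => _ [x [l1 [i [j [xI ->]]]]].
apply: le_trans ((HC (l1, (i, j))).2 x xI) _.
by rewrite (bigD1 (l1, (i, j)))//= lerDl sumr_ge0// => l _; have [] := HC l.
Qed.

Lemma admissible_normC G : continuous_z A sigma G -> admissible A sigma `|normC A sigma G| G.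
Proof.
move=> cG; split; first by move=> k; exact: cG.
by move=> k t tI; apply: le_trans (normC_ub _ cG tI) _; exact: ler_norm.
Qed.

Lemma admissibleF_normC F : admissibleF (normC A sigma (fun=> F)) F.
Proof.
move=> k; have AI : A \in `[A, b] by rewrite in_itv/= lexx.
by apply: (@normC_ub (fun=> F) k A _ AI) => k1 i j x; exact: cvg_cst.
Qed.

(* Both i h and x lie in [0, 1], and (j h - 1/2)^2 <= 1. *)
Definition u0_inf := A ^+ 2 / (2 + A ^+ 2).

Lemma u0_inf_gt0 : 0 < u0_inf.
Proof. by rewrite divr_gt0 ?exprn_gt0// ltr_wpDr ?sqr_ge0. Qed.

Lemma u0_ge (x : R) (i j : 'I_B.+1) : x \in `[0, 1] -> u0_inf <= u0 A h x i j.
Proof.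
rewrite in_itv/= => /andP[x0 x1].
have A2 : 0 < A ^+ 2 by rewrite exprn_gt0.
have ih (l : 'I_B.+1) : 0 <= l%:R * h <= 1.
  have e : B%:R * h = 1 by rewrite -hB mulVf// gt_eqF.
  have : l%:R * h <= B%:R * h by rewrite ler_pM2r// ler_nat -ltnS.
  by rewrite e mulr_ge0// ltW.
have /andP[i0 i1] := ih i; have /andP[j0 j1] := ih j.
rewrite /u0_inf /u0 mxE ler_pM2l// lef_pV2 ?posrE; last 2 first.
- by rewrite ltr_wpDl.
- by rewrite ltr_wpDl ?addr_ge0 ?sqr_ge0.
have hx : (i%:R * h - x) ^+ 2 <= 1 by rewrite -[leRHS](expr1n R 2) -ler_sqrt ?sqr_ge0 ?exprn_gt0// !sqrtr_sqr normr1 ler_norml; lra.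
have hy : (j%:R * h - 2^-1) ^+ 2 <= 1 by rewrite -[leRHS](expr1n R 2) -ler_sqrt ?sqr_ge0 ?exprn_gt0// !sqrtr_sqr normr1 ler_norml; lra.
by rewrite lerD2r; lra.
Qed.

(** The sup embedding of H^1_0 combined with the boundedness of the finitely many basis functions on
    [0, 1]. The constant is made positive because [KR_dom] divides by it. *)
Lemma expand_sup : exists2 C, 0 < C & forall V t x i j, H1 V -> t \in `[A, b] -> x \in `[0, 1] ->
  `|Defs.expand a (V t) x i j| <= C * nH V.
Proof.
have [C C0 HC] := @continuous_bounded_fin R 'I_N 0 1 (fun n => Psi a n) (fun n => C1_cont (C1_Psi a n)).
pose D := Num.sqrt sigma / h.
have D0 : 0 <= D by rewrite divr_ge0 ?sqrtr_ge0// ltW.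
exists (\sum_(n < N) C * D + 1); first by rewrite ltr_wpDl// sumr_ge0// => n _; rewrite mulr_ge0.
move=> V t x i j HV tI xI; have nV : 0 <= nH V by exact: sqrtr_ge0.
apply: (@le_trans _ _ ((\sum_(n < N) C * D) * nH V)); last by rewrite ler_wpM2r// lerDl.
rewrite /Defs.expand summxE mulr_suml; apply: le_trans (ler_norm_sum _ _ _) _.
apply: ler_sum => n _; rewrite mxE normrM -mulrA ler_pM//; first exact: HC.
exact: (H1_sup sigma_gt0 h_gt0 (n, (i, j)) HV tI).
Qed.

(** The sup embedding for elements of norm below r + 2: r for K^h(R) and 2 for the perturbations of
    [KR_dom]. *)
Definition sup_bound := Num.sqrt sigma / h * (r + 2).

Local Notation S := (@dom R A sigma a h N B sup_bound (u0_inf / 2)).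
Local Notation K := (fun G => KR A sigma a h G r).
Local Notation Kbar := (fun G => KRbar A sigma a h G r).

Lemma sup_bound_ge0 : 0 <= sup_bound.
Proof. by rewrite /sup_bound mulr_ge0 ?divr_ge0 ?sqrtr_ge0 ?(ltW h_gt0)// addr_ge0// ltW. Qed.

(** On K^h(R) one has u > u_0 >= [u0_inf], and a perturbation of norm below [u0_inf] / (2 C) moves u
    by less than half of that bound. The radius is written 2 d so that in [KRbar_dom] one d serves
    to approximate a point of the closure and the other to perturb it. *)
Lemma KR_dom : exists2 d : R, 0 < d & forall G V Q, K G V -> H1 Q -> nH Q < 2 * d -> S G (V + Q).
Proof.
have [C C0 HC] := expand_sup.
have p : 0 < u0_inf / (4 * C) by rewrite divr_gt0 ?u0_inf_gt0// mulr_gt0.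
exists (Num.min 1 (u0_inf / (4 * C))); first by rewrite lt_min ltr01.
move=> G V Q [HV nV pV] HQ nQ.
have q1 : nH Q < 2.
  by apply: lt_le_trans nQ _; rewrite -[leRHS]mulr1 ler_pM2l// ge_min lexx.
have q2 : nH Q < u0_inf / (2 * C).
  apply: lt_le_trans nQ _; apply: (@le_trans _ _ (2 * (u0_inf / (4 * C)))).
    by rewrite ler_pM2l// ge_min lexx orbT.
  by rewrite le_eqVlt; apply/orP; left; apply/eqP; field; rewrite gt_eqF.
have HVQ := subspD Hip HV HQ; change (is_true (nH V < r)) in nV; split => //.
- move=> k t tI; apply: le_trans (H1_sup sigma_gt0 h_gt0 k HVQ tI) _.
  rewrite /sup_bound; apply: ler_wpM2l; first by rewrite divr_ge0 ?sqrtr_ge0// ltW.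
  by apply: le_trans (nrmD Hip HV HQ) _; apply: ltW; apply: ltrD.
- move=> t x i j tI xI; rewrite /u.
  have -> : Defs.expand a ((V + Q) t) x = Defs.expand a (V t) x + Defs.expand a (Q t) x.
    rewrite /Defs.expand -big_split; apply: eq_bigr => n _.
    by rewrite /= -scalerDr.
  have h1 := u0_ge i j xI; have h2 := pV t x i j tI xI; have h3 := HC Q t x i j HQ tI xI.
  move: q2; rewrite ltr_pdivlMr ?mulr_gt0// => q2.
  have mD (X Y : 'M[R]_B.+1) : (X + Y) i j = X i j + Y i j by rewrite mxE.
  move: h2 h3; rewrite !mD ler_norml => h2 /andP[h3 _]; lra.
Qed.

Lemma KRbar_dom : exists2 d : R, 0 < d & forall G W V, Kbar G W -> H1 V -> nH V < d -> S G (W + V).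
Proof.
have [d d0 Hd] := KR_dom; exists d => // G W V [HW Wc] HV nV.
have [V0 KV0 n0] := Wc d d0; have [HV0 _ _] := KV0; change (is_true (nH (W - V0) < d)) in n0.
have HWV := subspB Hip HW HV0.
have -> : W + V = V0 + ((W - V0) + V) by rewrite !addrA [V0 + W]addrC addrK.
apply: Hd => //; first exact: (subspD Hip).
apply: le_lt_trans (nrmD Hip HWV HV) _.
have d2 : 2 * d = d + d by ring.
by rewrite d2; apply: (ltrD n0); exact: nV.
Qed.

Lemma lerp (V : lmodType R) (x y : V) (t : R) : x + t *: (y - x) = (1 - t) *: x + t *: y.
Proof. by rewrite scalerBr scalerBl scale1r addrA addrAC. Qed.

Lemma lerp_lt (x y e t : R) : 0 <= t <= 1 -> x < e -> y < e -> (1 - t) * x + t * y < e.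
Proof.
move=> /andP[t0 t1] xe ye; have [->|tn0] := eqVneq t 0; first by rewrite subr0 mul1r mul0r addr0.
have tp : 0 < t by rewrite lt_def tn0.
rewrite [ltRHS](_ : e = (1 - t) * e + t * e); last by ring.
by apply: ler_ltD; [rewrite ler_wpM2l ?subr_ge0// ltW|rewrite ltr_pM2l].
Qed.

Lemma KR_convex G V1 V2 (t : R) : K G V1 -> K G V2 -> 0 <= t <= 1 -> K G (V1 + t *: (V2 - V1)).
Proof.
move=> [H_1 n1 p1] [H_2 n2 p2] t01; have /andP[t0 t1] := t01.
have s0 : 0 <= 1 - t by rewrite subr_ge0.
rewrite lerp.
have Hs1 := subspZ Hip (1 - t) H_1; have Hs2 := subspZ Hip t H_2.
change (is_true (nH V1 < r)) in n1; change (is_true (nH V2 < r)) in n2; split.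
- exact: (subspD Hip).
- change (is_true (nH ((1 - t) *: V1 + t *: V2) < r)).
  apply: le_lt_trans (nrmD Hip Hs1 Hs2) _; rewrite !(nrmZ Hip)// !ger0_norm//.
  exact: lerp_lt t01 n1 n2.
- move=> z x i j zI xI; have h1 := p1 z x i j zI xI; have h2 := p2 z x i j zI xI.
  have -> : Defs.expand a (((1 - t) *: V1 + t *: V2) z) x =
      (1 - t) *: Defs.expand a (V1 z) x + t *: Defs.expand a (V2 z) x.
    rewrite /Defs.expand !scaler_sumr -big_split; apply: eq_bigr => n _ /=.
    by rewrite !fctE scalerDr !scalerA (mulrC (1 - t)) (mulrC t).
  move: h1 h2; rewrite !mxE; set x1 := Defs.expand _ _ _ _ _; set g := Defs.expand _ _ _ _ _; set x2 := Defs.expand _ _ _ _ _ => h1 h2.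
  rewrite (_ : _ + g = (1 - t) * (x1 + g) + t * (x2 + g)); last by ring.
  by rewrite -oppr_lt0 opprD -!mulrN; apply: lerp_lt; rewrite ?oppr_lt0// t0.
Qed.

Lemma KRbar_convex G W1 W2 (t : R) : Kbar G W1 -> Kbar G W2 -> 0 <= t <= 1 -> Kbar G (W1 + t *: (W2 - W1)).
Proof.
move=> [H_1 c1] [H_2 c2] t01; have /andP[t0 t1] := t01.
have s0 : 0 <= 1 - t by rewrite subr_ge0.
split; first by apply: (subspD Hip) => //; apply: (subspZ Hip); exact: (subspB Hip).
move=> e e0; have [V1 K1 n1] := c1 _ e0; have [V2 K2 n2] := c2 _ e0.
exists (V1 + t *: (V2 - V1)); first exact: KR_convex.
have [HV1 _ _] := K1; have [HV2 _ _] := K2.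
have D1 := subspB Hip H_1 HV1; have D2 := subspB Hip H_2 HV2.
have -> : W1 + t *: (W2 - W1) - (V1 + t *: (V2 - V1)) = (1 - t) *: (W1 - V1) + t *: (W2 - V2).
  by rewrite -lerp opprD addrACA -scalerBr; congr (_ + _ *: _); rewrite !opprD !opprK addrACA.
change (is_true (nH (W1 - V1) < e)) in n1; change (is_true (nH (W2 - V2) < e)) in n2.
match goal with |- is_true (normH1 _ _ _ ?X < _) => change (is_true (nH X < e)) end.
apply: le_lt_trans (nrmD Hip (subspZ Hip (1 - t) D1) (subspZ Hip t D2)) _; rewrite !(nrmZ Hip)// !ger0_norm//.
exact: lerp_lt t01 n1 n2.
Qed.

Lemma KR_KRbar G W : K G W -> Kbar G W.
Proof.
move=> KW; have [HW _ _] := KW; split=> // e e0; exists W => //.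
have n0 := nrmZ Hip 0 HW; rewrite scale0r normr0 mul0r in n0.
by rewrite subrr; change (nrm ipH 0 < e); rewrite n0.
Qed.

End Main.

Theorem theorem8p3 (R : realType) (A sigma a h0 h r : R) (N B : nat)
    (normG normF lambda0 : R)
    (A_gt0 : 0 < A) (sigma_gt0 : 0 < sigma) (a_gt0 : 0 < a) (N_gt0 : (0 < N)%N)
    (h0_01 : 0 < h0 < 1) (h_range : h0 <= h < 1) (hB : h^-1 = B%:R)
    (r_gt0 : 0 < r)
    (lambda0_gt1 : 1 < lambda0)
    (lambda0P : forall (G : semidiscrete R N B) (F : grid_vec R N B),
       continuous_z A sigma G ->
       normC A sigma G = normG -> normC A sigma (fun=> F) = normF ->
       forall lambda gamma : R, lambda0 <= lambda -> 0 < gamma < 1 ->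
       forall W1 W2 : semidiscrete R N B,
         KRbar A sigma a h G r W1 -> KRbar A sigma a h G r W2 ->
         J A sigma a h G F lambda gamma W2 - J A sigma a h G F lambda gamma W1
           - ipH1 A sigma h (J' A sigma a h G F lambda gamma W1) (W2 - W1)
         >= 8^-1 * normL2 A sigma h (W2 - W1) ^+ 2
            + gamma * normH1 A sigma h (W2 - W1) ^+ 2) :
  forall lambda : R, lambda0 <= lambda ->
  exists2 rho0 : R, 0 < rho0 < 1 &
  forall gamma : R, 0 < gamma < 1 ->
  forall (G : semidiscrete R N B) (F : grid_vec R N B),
    continuous_z A sigma G ->
    normC A sigma G = normG -> normC A sigma (fun=> F) = normF ->
  forall rho : R, 0 < rho < rho0 ->
  exists2 eta : R, 0 < eta < 1 &
  forall (Wmin : semidiscrete R N B) (W : nat -> semidiscrete R N B),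
    is_unique_minimizer (J A sigma a h G F lambda gamma)
      (KRbar A sigma a h G r) Wmin ->
    KR A sigma a h G r (W 0%N) ->
    (forall n, is_projection A sigma h (KRbar A sigma a h G r)
       (W n - rho *: J' A sigma a h G F lambda gamma (W n)) (W n.+1)) ->
    (normH1 A sigma h (W n - Wmin) @[n --> \oo] --> 0) /\
    (forall n, normH1 A sigma h (Wmin - W n)
               <= eta ^+ n * normH1 A sigma h (Wmin - W 0%N)).
Proof.
move=> lambda ll.
have h_gt0 : 0 < h by have /andP[p _] := h0_01; have /andP[q _] := h_range; exact: lt_le_trans q.
have Hip := @ipH1_ip R A sigma h N B sigma_gt0.
have L2ip := @ipL2_ip R A sigma h N B sigma_gt0.
have M0 := sup_bound_ge0 sigma h_gt0 r_gt0.
have cp : 0 < u0_inf A / 2 by rewrite divr_gt0 ?u0_inf_gt0.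
(* L is fixed here, before gamma, G and F are given, and depends on the data through [normG] and
   [normF] only. The absolute value makes the bound on G nonnegative while no G is at hand yet. *)
have [dJ [[L HL] Hrep]] := C11_Omega_J0 a N B A_gt0 sigma_gt0 h_gt0 normF M0 (normr_ge0 normG) cp lambda.
have L1 : 1 <= 4 * (L ^+ 2 + 1) by have := sqr_ge0 L; lra.
have Lp : 0 < 4 * (L ^+ 2 + 1) by exact: lt_le_trans L1.
(* Every rho below this bound satisfies the smallness condition of [gradient_step], whatever gamma
   in (0, 1). *)
exists ((4 * (L ^+ 2 + 1))^-1).
  by rewrite invr_gt0 Lp/= invf_lt1//; have := sqr_ge0 L; lra.
move=> gamma g01 G F cG nG nF rho /andP[r0 r1]; have /andP[g0 g1] := g01.
have rL : 4 * (L ^+ 2 + 1) * rho < 1 by move: r1; rewrite -(ltr_pM2l Lp) mulfV// gt_eqF.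
have rg : rho * gamma <= rho by rewrite ler_piMr// ltW.
have rg0 : 0 < rho * gamma by rewrite mulr_gt0.
have rl : 0 <= rho * L ^+ 2 by rewrite mulr_ge0 ?sqr_ge0// ltW.
exists (1 - 2 * rho * gamma); first by apply/andP; split; lra.
have e01 : 0 < 1 - 2 * rho * gamma < 1 by apply/andP; split; lra.
move=> Wmin W [KWmin Wm] KW0 Wp.
have gG : admissible A sigma `|normG| G by rewrite -nG; exact: admissible_normC.
have gF : admissibleF normF F by rewrite -nF; exact: admissibleF_normC.
have [d d0 Hd] := @KRbar_dom R A sigma a h r N B A_gt0 sigma_gt0 h_gt0 hB.
pose K : set (semidiscrete R N B) := KRbar A sigma a h G r.
pose S : set (semidiscrete R N B) := dom A sigma a h (sup_bound sigma h r) (u0_inf A / 2) G.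
pose JJ := J A sigma a h G F lambda gamma.
have n2_ge0 (V : semidiscrete R N B) : H1_0 A sigma V -> 0 <= normL2 A sigma h V by move=> _; exact: sqrtr_ge0.
have n2_le (V : semidiscrete R N B) : H1_0 A sigma V -> normL2 A sigma h V <= nrm (ipH1 A sigma h) V.
  exact: normL2_le_normH1.
have n2N (V : semidiscrete R N B) : H1_0 A sigma V -> normL2 A sigma h (- V) = normL2 A sigma h V.
  by move=> HV; have := nrmN L2ip HV.
have S_H V : S V -> H1_0 A sigma V by case.
have K_S : exists2 delta : R, 0 < delta & forall U V, K U -> H1_0 A sigma V ->
    nrm (ipH1 A sigma h) V < delta -> S (U + V).
  by exists d; [exact: d0|exact: Hd].
have fC := HL _ _ gG gF.
have frep V : S V -> exists2 g, H1_0 A sigma g & forall U, H1_0 A sigma U -> ipH1 A sigma h g U = dJ G F V U.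
  by move=> SV; apply: (riesz sigma_gt0 h_gt0); exact: Hrep.
have JE V : S V -> JJ V = J0 A sigma a h lambda G F V + gamma * nrm (ipH1 A sigma h) V ^+ 2.
  by move=> SV; apply: (J_J0 A_gt0 sigma_gt0 h_gt0 M0 (normr_ge0 normG) cp _ _ gG gF SV).
(* The gradient built from [riesz] shows that on K the choice made by [J'] is a genuine gradient and
   not the default 0. *)
have J'P V : K V -> grad (H1_0 A sigma) (ipH1 A sigma h) JJ V (J' A sigma a h G F lambda gamma V).
  move=> KV; have [g Gg _] := grad_ex Hip n2_ge0 n2_le S_H K_S fC frep JE g01 KV.
  exact: (@xgetPex _ 0 [set g | is_gradient A sigma h JJ V g] (ex_intro _ g Gg)).
(* The assumed inequality speaks of [J']; uniqueness of the pairing carries it over to an arbitrary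
   gradient, the form used by the abstract argument. *)
have strong U1 U2 g : K U1 -> K U2 -> grad (H1_0 A sigma) (ipH1 A sigma h) JJ U1 g ->
    8^-1 * normL2 A sigma h (U2 - U1) ^+ 2 + gamma * nrm (ipH1 A sigma h) (U2 - U1) ^+ 2 <=
    JJ U2 - JJ U1 - ipH1 A sigma h g (U2 - U1).
  move=> K1 K2 Gg; have HU : H1_0 A sigma (U2 - U1) by apply: (subspB Hip); [case: K2|case: K1].
  rewrite (grad_uniq Hip Gg (J'P _ K1) HU).
  exact: (lambda0P _ _ cG nG nF _ _ ll g01 _ _ K1 K2).
have Kconv U1 U2 (t : R) : K U1 -> K U2 -> 0 <= t <= 1 -> K (U1 + t *: (U2 - U1)).
  exact: KRbar_convex.
have Wmin_le V : K V -> JJ Wmin <= JJ V.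
  by move=> KV; have [->|VW] := pselect (V = Wmin); [exact: lexx|exact/ltW/Wm].
have KW n : K (W n) by case: n => [|n]; [exact: KR_KRbar|have [] := Wp n].
have step n : normH1 A sigma h (W n.+1 - Wmin) <= (1 - 2 * rho * gamma) * normH1 A sigma h (W n - Wmin).
  apply: (projected_step Hip n2_ge0 n2_le n2N S_H K_S Kconv fC frep JE g01 strong r0 rL (KW n) KWmin
    (J'P _ (KW n)) (J'P _ KWmin) Wmin_le (KW n.+1)).
  by have [] := Wp n.
set eta := 1 - 2 * rho * gamma in e01 step *; have /andP[eta0 eta1] := e01.
have bound n : normH1 A sigma h (W n - Wmin) <= eta ^+ n * normH1 A sigma h (W 0%N - Wmin).
  elim: n => [|n ih]; first by rewrite expr0 mul1r.
  by apply: le_trans (step n) _; rewrite exprS -mulrA ler_pM2l.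
split; last first.
  move=> n; have sym V : K V -> normH1 A sigma h (Wmin - V) = normH1 A sigma h (V - Wmin).
    by move=> [HV _]; apply: (nrmB Hip) => //; case: KWmin.
  by rewrite (sym _ (KW n)) (sym _ (KW 0%N)); exact: bound.
apply: (@squeeze_cvgr _ _ _ _ (fun=> 0) (fun n => eta ^+ n * normH1 A sigma h (W 0%N - Wmin))).
- by near=> n; rewrite sqrtr_ge0 bound.
- exact: cvg_cst.
- rewrite -[X in _ --> X](mul0r (normH1 A sigma h (W 0%N - Wmin))).
  apply: cvgM; last exact: cvg_cst.
  by apply: cvg_expr; rewrite ger0_norm// ltW.
Unshelve. all: by end_near. Qed.
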